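(* Let $\mathcal{T}$ be a topologically mixing random group extension of a random countable Markov shift $f$ with the relative BIP property by a countable group $G$. Suppose that $\varphi:\mathcal{E}\rightarrow\mathbb{R}$ is a locally fiber Hölder continuous function with $$\int_{\Omega}\|\varphi(\omega,\cdot)\|_{\infty}\,d\mathbb{P}(\omega)<\infty,\qquad \int_{\Omega}\left|\log\|\mathcal{L}_{\varphi}^{\omega}\mathbf{1}\|_{\infty}\right|d\mathbb{P}(\omega)<\infty$$ and $\Pi_{Gur}^{(r)}(f,\varphi)<\infty$. Then $$\log {\rm spr}_{\mathcal{H}}(\mathcal{L}_{\tilde{\varphi}}^{\omega})=\Pi_{Gur}^{(r)}(f,\varphi)\quad\text{for }\mathbb{P}\text{-a.e. }\omega\in \Omega$$ if and only if $G$ is amenable.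
   Context: **Random countable Markov shift.** $(\Omega,\mathcal{F},\mathbb{P})$ is a probability space and $\vartheta:\Omega\to\Omega$ an ergodic invertible $\mathbb{P}$-preserving transformation. $l$ is an $\mathbb{N}\cup\{\infty\}$-valued random variable with $l(\omega)>1$; $S(\omega)=\{j\in\mathbb{N}:j<l(\omega)\}$; $A_\omega=(\alpha_{i,j}(\omega))_{i\in S(\omega),j\in S(\vartheta\omega)}$ are matrices with entries in $\{0,1\}$ depending measurably on $\omega$. Put $\mathcal{E}_\omega=\{x=(x_0,x_1,\ldots):x_i\in S(\vartheta^i\omega),\ \alpha_{x_i,x_{i+1}}(\vartheta^i\omega)=1\ \forall i\ge 0\}$, assumed nonempty for a.e. $\omega$; $f_\omega:\mathcal{E}_\omega\to\mathcal{E}_{\vartheta\omega}$ is the left shift, $f=(f_\omega)_{\omega\in\Omega}$, $\mathcal{E}=\{(\omega,x):\omega\in\Omega,x\in\mathcal{E}_\omega\}$, $\Theta(\omega,x)=(\vartheta\omega,f_\omega x)$. **Words, mixing, BIP.** A word $(x_0,\ldots,x_{n-1})\in\mathbb{N}^n$ is $\omega$-admissible if $x_i<l(\vartheta^i\omega)$ for $0\le i\le n-1$ and $\alpha_{x_i,x_{i+1}}(\vartheta^i\omega)=1$ for $0\le i\le n-2$; $\mathcal{W}^n(\omega)$ is the set of such words; $[x_0,\ldots,x_{n-1}]_\omega=\{y\in\mathcal{E}_\omega:y_i=x_i,\ 0\le i\le n-1\}$. For a letter $a$, $\Omega_a=\{\omega:[a]_\omega\ne\emptyset\}$; $\mathcal{W}^1$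 is the set of letters $a$ with $\mathbb{P}(\Omega_a)>0$. For letters $a,b$, $\mathcal{W}^n_{a,b}(\omega)$ is the set of $(x_0,\ldots,x_{n-1})\in\mathcal{W}^n(\omega)$ with $x_0=a$ and $x_{n-1}b$ being $\vartheta^{n-1}\omega$-admissible. $f$ is topologically mixing if for all $a,b\in\mathcal{W}^1$ there is $N_{ab}\in\mathbb{N}$ such that for a.e. $\omega$ and all $n\ge N_{ab}$ with $a\in S(\omega)$, $b\in S(\vartheta^n\omega)$ one has $\mathcal{W}^n_{a,b}(\omega)\neq\emptyset$. $f$ has the relative big images and preimages (BIP) property if $f$ is topologically mixing and there is a family of finite sets $\mathcal{I}_{bip}(\omega)\subset\mathcal{W}^1(\omega)$, $\omega\in\Omega$, such that for a.e. $\omega$ and every $a\in\mathcal{W}^1(\omega)$ there exist $b\in\mathcal{I}_{bip}(\vartheta\omega)$ with $ab\in\mathcal{W}^2(\omega)$ and $c\in\mathcal{I}_{bip}(\vartheta^{-1}\omega)$ with $ca\in\mathcal{W}^2(\vartheta^{-1}\omega)$. **Potentials.** $V_n^\omega(\varphi)=\sup\{|\varphi(\omega,x)-\varphi(\omega,y)|:x,y\in\mathcal{E}_\omega,\ x_i=y_i,\ 0\le i\le n-1\}$. $\varphi$ is locally fiber Hölder continuous if there is a random variable $\kappa:\Omega\to\mathbb{N}$, $\kappa\ge1$, $\int\kappa\,d\mathbb{P}<\infty$, with $V_n^\omega(\varphi)\le\kappa(\omega)2^{-n}$ for a.e. $\omega$ and all $n\ge1$. $S_n\varphi=\sum_{i=0}^{n-1}\varphi\circ\Theta^i$.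 The random Perron–Frobenius operator is $\mathcal{L}_\varphi^\omega\phi(\vartheta\omega,x)=\sum_{y\in\mathcal{E}_\omega,f_\omega y=x}e^{\varphi(\omega,y)}\phi(\omega,y)$. In the integrability conditions $\|\cdot\|_\infty$ is the supremum norm over the fiber. **Random group extension.** Let $\psi:\mathbb{N}^{\mathbb{N}}\to G$ depend only on the coordinate $x_0$, and let $\psi_\omega=\psi|_{\mathcal{E}_\omega}$. The random group extension is $\mathcal{T}=(\mathcal{T}_\omega)$, $\mathcal{T}_\omega:\mathcal{E}_\omega\times G\to\mathcal{E}_{\vartheta\omega}\times G$, $\mathcal{T}_\omega(x,g)=(f_\omega x,g\psi_\omega(x))$. Write $\psi_\omega^n(x)=\psi_\omega(x)\psi_{\vartheta\omega}(f_\omega x)\cdots\psi_{\vartheta^{n-1}\omega}(f_\omega^{n-1}x)$, which depends only on $(x_0,\dots,x_{n-1})$, so $\psi_\omega^n(\alpha)$ makes sense for $\alpha\in\mathcal{W}^n(\omega)$. $\mathcal{T}$ is topologically mixing if for all $a,b\in\mathcal{W}^1$, $g\in G$ there is $N$ such that for a.e. $\omega$ and all $n\ge N$ with $a\in S(\omega)$, $b\in S(\vartheta^n\omega)$, there is $\alpha\in\mathcal{W}^n(\omega)$ with $[\alpha]_\omega\subset[a]_\omega$, $f_\omega^n([\alpha]_\omega)\supset[b]_{\vartheta^n\omega}$ and $\psi^n_\omega(\alpha)=g$. Put $\tilde\varphi(\omega,x,g)=\varphi(\omega,x)$ on $\mathcal{E}\times G$ and $\mathcal{L}_{\tilde\varphi}^\omega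 v(\vartheta\omega,x,g)=\sum_{y\in\mathcal{E}_\omega,f_\omega y=x}e^{\varphi(\omega,y)}v(\omega,y,g\psi_\omega(y)^{-1})$; $\mathcal{L}_{\tilde\varphi}^{\omega,n}=\mathcal{L}_{\tilde\varphi}^{\vartheta^{n-1}\omega}\circ\cdots\circ\mathcal{L}_{\tilde\varphi}^{\omega}$. **Relative Gurevič pressure.** For $a\in\mathcal{W}^1$ let $n_a^{(0)}(\omega)=0$, $n_a^{(k+1)}(\omega)=\min\{n>n_a^{(k)}(\omega):\vartheta^n\omega\in\Omega_a\}$. Set $Z_n^\omega(\varphi,a,a)=\sum_{\alpha\in\mathcal{W}^n_{a,a}(\omega)}\exp(\sup_{y\in[\alpha]_\omega}S_n\varphi(\omega,y))$. Then $\Pi_{Gur}^{(r)}(f,\varphi)$ is the value of $\lim_{j\to\infty}\frac{1}{n_a^{(j)}(\omega)}\log Z^\omega_{n_a^{(j)}(\omega)}(\varphi,a,a)$; this limit exists, is constant for a.e. $\omega\in\Omega_a$, and does not depend on $a$. **Gibbs measure, spaces, spectral radius.** When $f$ has relative BIP and $\Pi_{Gur}^{(r)}(f,\varphi)<\infty$, there are a unique $\Theta$-invariant fiber Gibbs probability measure $d\mu(\omega,x)=d\mu_\omega(x)d\mathbb{P}(\omega)$ and random variables $\lambda,C_\varphi:\Omega\to(0,\infty)$ with $\int\log\lambda_\omega d\mathbb{P}=\Pi_{Gur}^{(r)}(f,\varphi)$, $\int|\log C_\varphi|d\mathbb{P}<\infty$, and $C_\varphi(\omega)^{-1}\le\Lambda_n(\omega)\mu_\omega([x_0,\ldots,x_{n-1}]_\omega)e^{-S_n\varphi(\omega,x)}\le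 C_\varphi(\omega)$ for a.e. $\omega$, all $x\in\mathcal{E}_\omega$, all $n\ge1$, where $\Lambda_n(\omega)=\prod_{i=0}^{n-1}\lambda_{\vartheta^i\omega}$. $\mathcal{H}_\infty(\omega)$ is the space of functions $v:\mathcal{E}_\omega\times G\to\mathbb{R}$ with $\|v\|_{\mathcal{H}_\infty(\omega)}=(\sum_{g\in G}\|v(\cdot,g)\|_\infty^2)^{1/2}<\infty$, where here $\|\cdot\|_\infty$ is the $L^\infty(\mu_\omega)$-norm. Finally ${\rm spr}_{\mathcal{H}}(\mathcal{L}_{\tilde\varphi}^\omega)=\limsup_{n\to\infty}\|\mathcal{L}_{\tilde\varphi}^{\omega,n}\|^{1/n}$, where the norm is the operator norm from $\mathcal{H}_\infty(\omega)$ to $\mathcal{H}_\infty(\vartheta^n\omega)$. *)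

(* Defs.v *)
From HB Require Import structures.
From mathcomp Require Import all_boot all_order all_algebra.
From mathcomp Require Import all_classical all_reals all_analysis.

Set Implicit Arguments.
Unset Strict Implicit.
Unset Printing Implicit Defensive.

Import Order.TTheory GRing.Theory Num.Theory.
Import numFieldNormedType.Exports.

Local Open Scope classical_set_scope.
Local Open Scope ring_scope.

(* The set N^N is used in two guises: [nat -> nat], and the measurable space
   [trajectories], whose carrier is convertible to it and whose sigma-algebra is
   generated by the cylinders (the Borel sigma-algebra of the product of
   discrete spaces). *)
Definition cylinder_sets : set (set (nat -> nat)) :=
  [set C | exists n (u : nat -> nat),
     C = [set x | forall i, (i < n)%N -> x i = u i]].

Notation trajectories := (g_sigma_algebraType cylinder_sets).

Definition shift (x : nat -> nat) : nat -> nat := fun i => x i.+1.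

(* The order between N and N \cup {oo}, where [None] stands for oo. *)
Definition below (j : nat) (l : option nat) : bool :=
  if l is Some n then (j < n)%N else true.

Section Prelim.
Context {d : measure_display} {Om : measurableType d} {R : realType}.

Record random_shift (P : probability Om R) := RandomShift {
  base : Om -> Om ;
  base_inv : Om -> Om ;
  baseK : cancel base base_inv ;
  base_invK : cancel base_inv base ;
  measurable_base : measurable_fun [set: Om] base ;
  measurable_base_inv : measurable_fun [set: Om] base_inv ;
  base_preserving :
    forall A, measurable A -> P (base @^-1` A) = P A ;
  base_ergodic : forall A, measurable A -> base @^-1` A = A ->
    P A = 0%E \/ P A = 1%E ;
  bound : Om -> option nat ;
  measurable_bound : forall k : option nat, measurable (bound @^-1` [set k]) ;
  bound_gt1 : forall w, below 1 (bound w) ;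
  (* Only the entries with i \in S(w) and j \in S(base w) are meaningful. *)
  trans : Om -> nat -> nat -> bool ;
  measurable_trans : forall i j : nat, measurable
    [set w | below i (bound w) && below j (bound (base w)) && trans w i j] ;
  fiber_nonempty : {ae P, forall w, exists x : nat -> nat, forall i,
    below (x i) (bound (iter i base w)) /\
    trans (iter i base w) (x i) (x i.+1)}
}.

End Prelim.

Section Shift.
Context {d : measure_display} {Om : measurableType d} {R : realType}.
Context {P : probability Om R} (f : random_shift P).

Definition base_iter (n : nat) (w : Om) : Om := iter n (base f) w.

Definition alphabet (w : Om) : set nat := [set j | below j (bound f w)].

Definition fiber (w : Om) : set (nat -> nat) :=
  [set x | forall i, alphabet (base_iter i w) (x i) /\
                     trans f (base_iter i w) (x i) (x i.+1)].

Definition total_space : set (Om * trajectories) := [set z | fiber z.1 z.2].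

Definition skew (z : Om * trajectories) : Om * trajectories :=
  (base f z.1, shift z.2).

Definition words (n : nat) (w : Om) : set (seq nat) :=
  [set u | [/\ size u = n,
     forall i, (i < n)%N -> alphabet (base_iter i w) (nth 0%N u i) &
     forall i, (i.+1 < n)%N ->
       trans f (base_iter i w) (nth 0%N u i) (nth 0%N u i.+1)]].

Definition cylinder (w : Om) (u : seq nat) : set (nat -> nat) :=
  [set y | fiber w y /\ forall i, (i < size u)%N -> y i = nth 0%N u i].

Definition letter_set (a : nat) : set Om :=
  [set w | cylinder w [:: a] !=set0].

(* [letter_set a] is a projection, so P(letter_set a) > 0 is stated as: it is
   not contained in a measurable set of measure 0. *)
Definition letters : set nat := [set a | ~ P.-negligible (letter_set a)].

Definition words_between (n : nat) (a b : nat) (w : Om) : set (seq nat) :=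
  [set u | [/\ words n w u, ohead u = Some a &
     words 2 (base_iter n.-1 w) [:: last a u; b]]].

Definition top_mixing : Prop :=
  forall a b, letters a -> letters b -> exists N : nat,
    {ae P, forall w, forall n, (N <= n)%N ->
       alphabet w a -> alphabet (base_iter n w) b ->
       words_between n a b w !=set0}.

Definition relative_BIP : Prop :=
  top_mixing /\
  exists Ibip : Om -> set nat,
    (forall w, finite_set (Ibip w) /\ Ibip w `<=` alphabet w) /\
    {ae P, forall w, forall a, alphabet w a ->
      (exists2 b, Ibip (base f w) b & words 2 w [:: a; b]) /\
      (exists2 c, Ibip (base_inv f w) c & words 2 (base_inv f w) [:: c; a])}.

(* A potential is given as a function on Om x N^N; only its values on
   [total_space] are ever used. *)
Definition variation (phi : Om -> (nat -> nat) -> R) (n : nat)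
    (w : Om) : \bar R :=
  ereal_sup [set r | exists x y, [/\ fiber w x, fiber w y,
    (forall i, (i < n)%N -> x i = y i) & r = (`|phi w x - phi w y|)%:E]].

Definition locally_fiber_Holder (phi : Om -> (nat -> nat) -> R) : Prop :=
  exists kappa : Om -> nat,
    [/\ measurable_fun [set: Om] kappa,
        (forall w, (1 <= kappa w)%N),
        (\int[P]_w ((kappa w)%:R)%:E < +oo)%E &
        {ae P, forall w, forall n, (1 <= n)%N ->
           (variation phi n w <= ((kappa w)%:R * 2 ^- n)%:E)%E}].

Definition measurable_potential (phi : Om -> (nat -> nat) -> R) : Prop :=
  measurable_fun total_space (fun z : Om * trajectories => phi z.1 z.2).

Definition birkhoff (phi : Om -> (nat -> nat) -> R) (n : nat)
    (w : Om) (x : nat -> nat) : R :=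
  \sum_(i < n) phi (base_iter i w) (iter i shift x).

Definition sup_norm (w : Om) (h : (nat -> nat) -> \bar R) : \bar R :=
  ereal_sup [set (`|h x|)%E | x in fiber w].

Definition preimages (w : Om) (x : nat -> nat) : set (nat -> nat) :=
  [set y | fiber w y /\ shift y = x].

Definition transfer_one (phi : Om -> (nat -> nat) -> R) (w : Om)
    (x : nat -> nat) : \bar R :=
  (\esum_(y in preimages w x) (expR (phi w y))%:E)%E.

(* [xget] returns the least n > return_time a w k with base^n w \in Om_a, which
   exists for every k and almost every w by recurrence, and 0 otherwise. *)
Fixpoint return_time (a : nat) (w : Om) (k : nat) : nat :=
  if k is k'.+1 then
    xget 0%N [set n | [/\ (return_time a w k' < n)%N,
      letter_set a (base_iter n w) &
      forall m, (return_time a w k' < m)%N -> letter_set a (base_iter m w) ->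
        (n <= m)%N]]
  else 0%N.

Definition partition_fun (phi : Om -> (nat -> nat) -> R) (a : nat)
    (n : nat) (w : Om) : \bar R :=
  (\esum_(u in words_between n a a w)
     expeR (ereal_sup [set (birkhoff phi n w y)%:E | y in cylinder w u]))%E.

(* "p is the relative Gurevic pressure of (f, phi)". The set [letters] is not
   empty (the fibers are not), so that p is determined by this property. *)
Definition is_gurevic_pressure (phi : Om -> (nat -> nat) -> R)
    (p : \bar R) : Prop :=
  forall a, letters a -> {ae P, forall w, letter_set a w ->
    (fun j => ((return_time a w j)%:R^-1)%:E *
              lne (partition_fun phi a (return_time a w j) w))%E @ \oo --> p}.

Definition cocycle (lambda : Om -> R) (n : nat) (w : Om) : R :=
  \prod_(i < n) lambda (base_iter i w).

Record fiber_Gibbs (phi : Om -> (nat -> nat) -> R) (p : \bar R)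
    (mu : R.-pker Om ~> trajectories) (lambda C : Om -> R) : Prop :=
    FiberGibbs {
  gibbs_fiber : {ae P, forall w, mu w (fiber w) = 1%E} ;
  gibbs_invariant : forall D : set (Om * trajectories), measurable D ->
    (\int[P]_w mu w (xsection (skew @^-1` D) w) =
     \int[P]_w mu w (xsection D w))%E ;
  gibbs_measurable_lambda : measurable_fun [set: Om] lambda ;
  gibbs_lambda_gt0 : forall w, 0 < lambda w ;
  gibbs_lambda_pressure : (\int[P]_w (ln (lambda w))%:E)%E = p ;
  gibbs_measurable_C : measurable_fun [set: Om] C ;
  gibbs_C_gt0 : forall w, 0 < C w ;
  gibbs_C_integrable : (\int[P]_w (`|ln (C w)|)%:E < +oo)%E ;
  gibbs_bounds : {ae P, forall w, forall x n, fiber w x -> (1 <= n)%N ->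
    (C w)^-1 <=
      cocycle lambda n w * fine (mu w (cylinder w (mkseq x n))) *
      expR (- birkhoff phi n w x) <= C w}
}.

End Shift.

Section Extension.
Context {d : measure_display} {Om : measurableType d} {R : realType}.
Context {P : probability Om R} (f : random_shift P).
Context {G : groupType} (psi : (nat -> nat) -> G).

Fixpoint group_cocycle (n : nat) (x : nat -> nat) : G :=
  if n is n'.+1 then (psi x * group_cocycle n' (shift x))%g else 1%g.

(* Meant for psi depending only on x_0, in which case this is the value of
   [group_cocycle (size u)] at every sequence that begins with u. *)
Definition group_cocycle_word (u : seq nat) : G :=
  group_cocycle (size u) (nth 0%N u).

Definition ext_top_mixing : Prop :=
  forall a b, letters f a -> letters f b -> forall g : G, exists N : nat,
    {ae P, forall w, forall n, (N <= n)%N ->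
       alphabet f w a -> alphabet f (base_iter f n w) b ->
       exists u, [/\ words f n w u,
         cylinder f w u `<=` cylinder f w [:: a],
         cylinder f (base_iter f n w) [:: b] `<=` iter n shift @` cylinder f w u &
         group_cocycle_word u = g]}.

(* Sum of a summable family; junk when the family is not summable. *)
Definition rsum {I : choiceType} (A : set I) (h : I -> R) : R :=
  fine (\esum_(i in A) (Num.max (h i) 0)%:E)%E -
  fine (\esum_(i in A) (Num.max (- h i) 0)%:E)%E.

Definition ext_transfer (phi : Om -> (nat -> nat) -> R) (w : Om)
    (v : (nat -> nat) -> G -> R) : (nat -> nat) -> G -> R :=
  fun x g => rsum (preimages f w x)
    (fun y => expR (phi w y) * v y (g * (psi y)^-1)%g).

Fixpoint ext_transfer_iter (phi : Om -> (nat -> nat) -> R) (w : Om) (n : nat)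
    (v : (nat -> nat) -> G -> R) : (nat -> nat) -> G -> R :=
  if n is n'.+1 then
    ext_transfer phi (base_iter f n' w) (ext_transfer_iter phi w n' v)
  else v.

(* As mu w (fiber f w) = 1 for almost every w, the L^oo(mu_w)-norm does not
   depend on the values of v outside the fiber. *)
Definition Hnorm (mu : R.-pker Om ~> trajectories) (w : Om)
    (v : (nat -> nat) -> G -> R) : \bar R :=
  ((\esum_(g in [set: G])
      ('N[mu w]_+oo[(fun x : trajectories => (v x g)%:E)] ^+ 2)) `^ (2^-1))%E.

Definition Hspace (mu : R.-pker Om ~> trajectories) (w : Om) :
    set ((nat -> nat) -> G -> R) :=
  [set v | (forall g, measurable_fun (fiber f w : set trajectories)
                        (fun x : trajectories => v x g)) /\
           (Hnorm mu w v < +oo)%E].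

Definition Hopnorm (phi : Om -> (nat -> nat) -> R)
    (mu : R.-pker Om ~> trajectories) (w : Om) (n : nat) : \bar R :=
  ereal_sup [set Hnorm mu (base_iter f n w) (ext_transfer_iter phi w n v)
            | v in [set v | Hspace mu w v /\ (Hnorm mu w v <= 1)%E]].

Definition spr (phi : Om -> (nat -> nat) -> R)
    (mu : R.-pker Om ~> trajectories) (w : Om) : \bar R :=
  limn_esup (fun n => Hopnorm phi mu w n `^ (n%:R^-1))%E.

End Extension.

Definition amenable (R : realType) (G : groupType) : Prop :=
  exists m : set G -> R,
    [/\ forall A, 0 <= m A,
        m [set: G] = 1,
        forall A B, A `&` B = set0 -> m (A `|` B) = m A + m B &
        forall g A, m [set (g * x)%g | x in A] = m A].

(* Main.v *)
Require Import Defs.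
From mathcomp Require Import all_boot all_order all_algebra.
From mathcomp Require Import all_classical all_reals all_analysis.
From mathcomp Require Import measurable_realfun ess_sup_inf.
From mathcomp Require Import ring lra zify.

Set Implicit Arguments.
Unset Strict Implicit.
Unset Printing Implicit Defensive.

Import Order.TTheory GRing.Theory Num.Theory.
Import numFieldNormedType.Exports.

Local Open Scope classical_set_scope.
Local Open Scope ring_scope.

(** Let [q] be the pressure and [Lam n w] the product of the [n] first values of
[lambda] along the orbit of [w]. As [q] is the integral of [ln lambda], the ergodic
theorem says that [Lam n w] grows like [expR (n%:R * q)]. The theorem thus asks
whether the norm of the [n]-th iterate stays exponentially close to [Lam n w].

By the Gibbs property, the weight [expR (S_n phi)] of a word is, up to the factor
[C w], equal to [Lam n w] times the probability of the word. So the norm of the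
iterate compares to [Lam n w] times the norm, on the square-summable functions
on [G], of an average of translations: by the values of the group cocycle at the
words of length [n], each taken with its probability. Such an average has norm
at most [1], which bounds the spectral radius by [expR q] in all cases.

If [G] is amenable, finitely many translations always have a common almost
invariant vector ([amenable_almost_invariant]), on which their average acts almost
like the identity. This gives the lower bound [Hopnorm_ge], where a factor is lost
that only depends on the size of the alphabet at time [n]; since this size is
bounded along infinitely many [n], the radius is [expR q]. The existence of almost
invariant vectors is proved by contradiction: otherwise the average over some
finite symmetric set is a contraction, the sum of its resolvent series at a
positive vector is a positive function that decreases geometrically on average,
and the increments of its logarithm have a negative sum. But an invariant mean
integrates these increments to numbers that cancel in pairs.

If [G] is not amenable there are no almost invariant vectors
([almost_invariant_amenable]: a limit of almost invariant vectors along an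
ultrafilter would be an invariant mean), so the averages over suitable finite sets
[H] contract by an arbitrarily small factor ([strong_spectral_gap]). Since the
extension is mixing, there is a time [N] in which all elements of [H] are spelled
by words with conditional probabilities bounded from below, whenever the
environment is good: small alphabets and a moderate potential. The random word is
not a Markov chain, so that the branches of the tree of words that spell [H] do
not continue in the same way. But [gibbs_past] compares their continuations up to
a factor that depends on [C w] at the initial environment only, not on the time,
and the contraction by [H] was chosen strong enough to outweigh it
([block_contraction]). Good environments occur with positive frequency, each
contributes a fixed factor ([tree_contraction]), and the radius of an environment
with [C w <= C0] is below [expR q] by a factor that depends on [C0] only
([ae_spr_lt]).

Only finite alphabets occur: the potential is bounded on almost every fiber, so the
Gibbs property bounds the mass of each letter from below ([bound_finite]). *)

(** * Square-summable functions on a group *)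

Section square_norm.
Context {R : realType} {G : groupType}.
Implicit Types (u v : G -> R) (h g : G).

Definition sqnorm v : \bar R := (\esum_(g in [set: G]) ((v g) ^+ 2)%:E)%E.

Definition rtrans h v : G -> R := fun g => v (g * h)%g.

Lemma sqnorm_ge0 v : (0 <= sqnorm v)%E.
Proof. by apply: esum_ge0 => g _; rewrite lee_fin sqr_ge0. Qed.

Lemma sqnorm_rtrans h v : sqnorm (rtrans h v) = sqnorm v.
Proof.
rewrite /sqnorm [RHS](reindex_esum [set: G] _ (fun g => g * h)%g)//.
split => //; first by move=> x y _ _ /mulIg.
by move=> y _; exists (y * h^-1)%g => //; rewrite mulgVK.
Qed.

Lemma le_sqnorm u v : (forall g, `|u g| <= `|v g|) -> (sqnorm u <= sqnorm v)%E.
Proof.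
move=> uv; apply: le_esum => g _; rewrite lee_fin.
by rewrite -(real_normK (num_real (u g))) -(real_normK (num_real (v g)))
  lerXn2r// ?nnegrE.
Qed.

Lemma sqnorm_normr v : sqnorm (fun g => `|v g|) = sqnorm v.
Proof.
apply/eqP; rewrite eq_le; apply/andP.
by split; apply: le_sqnorm => g; rewrite normr_id.
Qed.

Lemma esumZl (I : choiceType) (A : set I) (c : R) (a : I -> \bar R) : 0 <= c ->
  (forall i, A i -> (0 <= a i)%E) ->
  (\esum_(i in A) (c%:E * a i) = c%:E * \esum_(i in A) a i)%E.
Proof.
suff le_c (b : R) (a' : I -> \bar R) : 0 <= b -> (forall i, A i -> 0 <= a' i)%E ->
    (\esum_(i in A) (b%:E * a' i) <= b%:E * \esum_(i in A) a' i)%E.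
  rewrite le_eqVlt => /predU1P[<- a0|c0 a0].
    by rewrite mul0e esum1// => i _; rewrite mul0e.
  apply/eqP; rewrite eq_le le_c ?(ltW c0)//=.
  rewrite -lee_pdivlMl//.
  apply: (le_trans _ (le_c c^-1 (fun i => c%:E * a i)%E _ _)).
  - apply: le_esum => i Ai.
    by rewrite muleA -EFinM mulVf ?gt_eqF// mul1e.
  - by rewrite invr_ge0 ltW.
  - by move=> i Ai; rewrite mule_ge0 ?lee_fin ?(ltW c0)// a0.
move=> b0 a0; apply: ge_ereal_sup => _ [X [finX XA] <-].
rewrite fsbig_finite//= big_seq -ge0_sume_distrr; last first.
  by move=> i; rewrite in_fset_set// inE => /XA/a0.
rewrite -big_seq.
by rewrite lee_wpmul2l ?lee_fin// -fsbig_finite// ereal_sup_ubound//; exists X.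
Qed.

Lemma sqnormZ c v : sqnorm (fun g => c * v g) = ((c ^+ 2)%:E * sqnorm v)%E.
Proof.
rewrite /sqnorm -esumZl ?sqr_ge0//; last by move=> g _; rewrite lee_fin sqr_ge0.
by apply: eq_esum => g _; rewrite exprMn EFinM.
Qed.

(** Every inequality between combinations of square norms below is an
inequality between squares of real numbers, summed over the group. *)
Lemma sum_sqnorm (I : choiceType) (r : seq I) (c : I -> R) (v : I -> G -> R) :
  (forall i, 0 <= c i) ->
  (\sum_(i <- r) (c i)%:E * sqnorm (v i) =
   \esum_(g in [set: G]) (\sum_(i <- r) c i * v i g ^+ 2)%:E)%E.
Proof.
move=> c0.
under [RHS]eq_esum do rewrite -sumEFin.
rewrite esum_sum; last by move=> g i _ _; rewrite lee_fin mulr_ge0 ?sqr_ge0.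
apply: eq_bigr => i _; rewrite /sqnorm -esumZl//.
by move=> g _; rewrite lee_fin sqr_ge0.
Qed.

Lemma sqr_sum_gap (I : eqType) (r : seq I) (p x : I -> R) i j :
  uniq r -> i \in r -> j \in r -> i != j -> (forall k, 0 <= p k) ->
  \sum_(k <- r) p k = 1 ->
  (\sum_(k <- r) p k * x k) ^+ 2 + p i * p j * (x i - x j) ^+ 2 <=
  \sum_(k <- r) p k * x k ^+ 2.
Proof.
move=> ur ir jr ij p0 p1; set m := \sum_(k <- r) p k * x k.
(* the variance, computed in two ways *)
have var : \sum_(k <- r) p k * (x k - m) ^+ 2 =
    \sum_(k <- r) p k * x k ^+ 2 - m ^+ 2.
  transitivity (\sum_(k <- r) (p k * x k ^+ 2 - 2 * m * (p k * x k)
      + m ^+ 2 * p k)); first by apply: eq_bigr => k _; ring.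
  by rewrite big_split/= sumrB -!mulr_sumr p1 -/m; ring.
have two : p i * (x i - m) ^+ 2 + p j * (x j - m) ^+ 2 <=
    \sum_(k <- r) p k * (x k - m) ^+ 2.
  rewrite (bigD1_seq i)//= lerD2l (big_rem j)//= eq_sym ij lerDl.
  by rewrite sumr_ge0// => k _; rewrite mulr_ge0 ?sqr_ge0.
have pij : p i + p j <= 1.
  rewrite -p1 (bigD1_seq i)//= lerD2l (big_rem j)//= eq_sym ij lerDl.
  by rewrite sumr_ge0.
have pi0 := p0 i; have pj0 := p0 j.
have : p i * p j * (x i - x j) ^+ 2 <=
    p i * (x i - m) ^+ 2 + p j * (x j - m) ^+ 2.
  set a := x i - m; set b := x j - m.
  have -> : x i - x j = a - b by rewrite /a /b; ring.
  have le_ab : (p i + p j) * (p i * a ^+ 2 + p j * b ^+ 2) <=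
      p i * a ^+ 2 + p j * b ^+ 2.
    rewrite ler_piMl// addr_ge0// mulr_ge0// sqr_ge0//.
  apply: le_trans le_ab.
  rewrite -subr_ge0 (_ : _ - _ = (p i * a + p j * b) ^+ 2) ?sqr_ge0//; ring.
by move: var two; rewrite /m; lra.
Qed.

Lemma sqr_sum_le (I : eqType) (r : seq I) (p x : I -> R) :
  (forall k, 0 <= p k) -> \sum_(k <- r) p k = 1 ->
  (\sum_(k <- r) p k * x k) ^+ 2 <= \sum_(k <- r) p k * x k ^+ 2.
Proof.
move=> p0 p1; set m := \sum_(k <- r) p k * x k.
have : 0 <= \sum_(k <- r) p k * (x k - m) ^+ 2.
  by rewrite sumr_ge0// => k _; rewrite mulr_ge0 ?sqr_ge0.
suff -> : \sum_(k <- r) p k * (x k - m) ^+ 2 =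
    \sum_(k <- r) p k * x k ^+ 2 - m ^+ 2 by lra.
transitivity (\sum_(k <- r) (p k * x k ^+ 2 - 2 * m * (p k * x k)
    + m ^+ 2 * p k)); first by apply: eq_bigr => k _; ring.
by rewrite big_split/= sumrB -!mulr_sumr p1 -/m; ring.
Qed.

(** Strict convexity of the square norm: two far apart members of an average
make the average short. *)
Lemma sqnorm_sum_gap (I : choiceType) (r : seq I) (p : I -> R) (v : I -> G -> R) i j :
  uniq r -> i \in r -> j \in r -> i != j -> (forall k, 0 <= p k) ->
  \sum_(k <- r) p k = 1 ->
  (sqnorm (fun g => \sum_(k <- r) p k * v k g)%R +
     (p i * p j)%:E * sqnorm (fun g => v i g - v j g)%R <=
   \sum_(k <- r) (p k)%:E * sqnorm (v k))%E.
Proof.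
move=> ur ir jr ij p0 p1; rewrite sum_sqnorm// /sqnorm -esumZl ?mulr_ge0//;
  last by move=> g _; rewrite lee_fin sqr_ge0.
rewrite -esumD.
- by apply: le_esum => g _; rewrite -EFinM -EFinD lee_fin sqr_sum_gap.
- by move=> g _; rewrite lee_fin sqr_ge0.
- by move=> g _; rewrite -EFinM lee_fin mulr_ge0 ?sqr_ge0// mulr_ge0.
Qed.

Lemma sqnorm_sum_le (I : choiceType) (r : seq I) (p : I -> R) (v : I -> G -> R) :
  (forall k, 0 <= p k) -> \sum_(k <- r) p k = 1 ->
  (sqnorm (fun g => \sum_(k <- r) p k * v k g)%R <=
   \sum_(k <- r) (p k)%:E * sqnorm (v k))%E.
Proof.
move=> p0 p1; rewrite sum_sqnorm//.
by apply: le_esum => g _; rewrite lee_fin sqr_sum_le.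
Qed.

(** The quadratic triangle inequality, with the trade-off between the two terms
left free. *)
Lemma sqnorm_triangle (t : R) u v : 0 < t ->
  (sqnorm u <= (1 + t)%:E * sqnorm v + (1 + t^-1)%:E * sqnorm (fun g => (u g - v g)%R))%E.
Proof.
move=> t0; have ti0 : 0 < t^-1 by rewrite invr_gt0.
rewrite /sqnorm -!esumZl ?addr_ge0 ?(ltW t0) ?(ltW ti0)//;
  try by move=> g _; rewrite lee_fin sqr_ge0.
rewrite -esumD; try by move=> g _; rewrite -EFinM lee_fin mulr_ge0 ?sqr_ge0//
  addr_ge0 ?(ltW t0) ?(ltW ti0).
apply: le_esum => g _; rewrite -!EFinM -EFinD lee_fin -subr_ge0.
set a := u g; set b := v g.
have -> : (1 + t) * b ^+ 2 + (1 + t^-1) * (a - b) ^+ 2 - a ^+ 2 =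
    t^-1 * (t * b - (a - b)) ^+ 2 by field; rewrite gt_eqF.
by apply: mulr_ge0; [exact: ltW|exact: sqr_ge0].
Qed.

End square_norm.

(** * Almost invariant vectors and the spectral gap *)

Section averages.
Context {R : realType} {G : groupType}.
Implicit Types (u v : G -> R) (h g : G) (H K : seq G).

Definition average H v : G -> R :=
  fun g => (size H)%:R^-1 * \sum_(h <- H) v (g * h)%g.

Let weight H : G -> R := fun=> (size H)%:R^-1.

Let weight_ge0 H h : 0 <= weight H h. Proof. by rewrite invr_ge0 ler0n. Qed.

Let weight_sum H : (0 < size H)%N -> \sum_(h <- H) weight H h = 1.
Proof.
move=> H0; rewrite /weight big_const_seq iter_addr_0 count_predT.
by rewrite -[LHS]mulr_natr mulVf// pnatr_eq0 -lt0n.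
Qed.

Let averageE H v :
  average H v = fun g => \sum_(h <- H) weight H h * rtrans h v g.
Proof. by apply/funext => g; rewrite -mulr_sumr. Qed.

Let sum_weight_sqnorm H v : (0 < size H)%N ->
  (\sum_(h <- H) (weight H h)%:E * sqnorm (rtrans h v) = sqnorm v)%E.
Proof.
move=> H0; under eq_bigr do rewrite sqnorm_rtrans.
rewrite -ge0_sume_distrl; last by move=> h _; rewrite lee_fin.
by rewrite sumEFin weight_sum// mul1e.
Qed.

Lemma sqnorm_average_le H v : (0 < size H)%N ->
  (sqnorm (average H v) <= sqnorm v)%E.
Proof.
move=> H0; rewrite averageE -[leRHS](sum_weight_sqnorm v H0).
exact: (sqnorm_sum_le (fun h => rtrans h v) (weight_ge0 H) (weight_sum H0)).
Qed.

Lemma average_flatten H K v :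
  average H (average K v) = average [seq (h * k)%g | h <- H, k <- K] v.
Proof.
apply/funext => g; rewrite /average size_allpairs natrM invfM -mulrA.
congr (_ * _); rewrite big_allpairs_dep mulr_sumr.
apply: eq_bigr => h _; congr (_ * _).
by apply: eq_bigr => k _; rewrite mulgA.
Qed.

Lemma average_ge0 H v : (forall g, 0 <= v g) -> forall g, 0 <= average H v g.
Proof. by move=> v0 g; rewrite mulr_ge0 ?invr_ge0 ?ler0n// sumr_ge0. Qed.

(** The right regular representation of [G] almost has invariant vectors. *)
Definition almost_invariant : Prop := forall K (e : R), 0 < e ->
  exists v, [/\ (0 < sqnorm v)%E, (sqnorm v < +oo)%E & forall k, k \in K ->
    (sqnorm (fun g => (v (g * k)%g - v g)%R) <= e%:E * sqnorm v)%E].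

(** Without almost invariant vectors, some element of a fixed finite set moves a
given vector by a fixed proportion. Together with [1%g] it provides two far apart
translates, and strict convexity makes the average short. The set is symmetrized
so that increments along it cancel in mean, as [mean_no_decrease] requires. *)
Lemma spectral_gap : ~ almost_invariant ->
  exists K (r : R), [/\ (0 < size K)%N,
    uniq K /\ (forall k, ((k^-1)%g \in K) = (k \in K)), 0 < r < 1 & forall v, (sqnorm v < +oo)%E ->
    (sqnorm (average K v) <= (r ^+ 2)%:E * sqnorm v)%E].
Proof.
move=> /existsNP[K0 /existsNP[e /not_implyP[e0 /forallNP gap]]].
pose K := undup (1%g :: K0 ++ [seq (k^-1)%g | k <- K0]).
have K1 : 1%g \in K by rewrite mem_undup inE eqxx.
have sK : (0 < size K)%N by case: K K1.
have Kinv k : ((k^-1)%g \in K) = (k \in K).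
  have inM h : (h \in [seq (k^-1)%g | k <- K0]) = ((h^-1)%g \in K0).
    by rewrite -{1}(invgK h) mem_map//; exact: invg_inj.
  by rewrite !mem_undup !inE !mem_cat invg_eq1 !inM invgK [in LHS](orbC (_ \in K0)).
pose c : R := Num.min (e / (size K)%:R ^+ 2) (2^-1).
have c0 : 0 < c by rewrite lt_min divr_gt0//= exprn_gt0// ltr0n.
have c1 : c <= 2^-1 by rewrite ge_min lexx orbT.
have r1 : 0 < 1 - c by lra.
exists K, (Num.sqrt (1 - c)); split=> //.
    by rewrite undup_uniq.
  by rewrite sqrtr_gt0 r1 -[ltRHS]sqrtr1 ltr_sqrt//; lra.
move=> v vfin; rewrite sqr_sqrtr ?(ltW r1)//.
have [v0|v0] := eqVneq (sqnorm v) 0%E.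
  by rewrite v0 mule0 -v0 sqnorm_average_le.
have {v0} v0 : (0 < sqnorm v)%E by rewrite lt_def v0 sqnorm_ge0.
have /not_and3P[//|//|/existsNP[k /not_implyP[kK0 /negP]]] := gap v.
rewrite -ltNge => far.
have k1 : k != 1%g.
  apply: contraTneq far => ->; rewrite -leNgt.
  rewrite (_ : sqnorm _ = 0)%E; first by rewrite mule_ge0 ?lee_fin ?(ltW e0)// ltW.
  by apply: esum1 => g _; rewrite mulg1 subrr expr0n.
have kK : k \in K by rewrite mem_undup inE mem_cat kK0 orbT.
have := sqnorm_sum_gap (fun h => rtrans h v) (undup_uniq _) kK K1 k1
  (weight_ge0 K) (weight_sum sK).
rewrite -averageE sum_weight_sqnorm// /weight.
have -> : (fun g => rtrans k v g - rtrans 1%g v g) = (fun g => v (g * k)%g - v g).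
  by apply/funext => g; rewrite /rtrans mulg1.
move: vfin far v0; case: (sqnorm v) (sqnorm_ge0 v) => // s s0 _ far v0 le_s.
have : (sqnorm (average K v) + (c * s)%:E <= s%:E)%E.
  apply: le_trans le_s; rewrite leeD2l//.
  apply: (@le_trans _ _ (((size K)%:R^-1 * (size K)%:R^-1)%:E * (e * s)%:E)%E).
    rewrite -EFinM lee_fin mulrA ler_wpM2r// ge_min; apply/orP; left.
    by rewrite expr2 invfM mulrC.
  by rewrite lee_wpmul2l ?lee_fin ?mulr_ge0 ?invr_ge0// EFinM ltW.
case: (sqnorm (average K v)) (sqnorm_ge0 (average K v)) => // a a0.
by rewrite -EFinD -EFinM !lee_fin; lra.
Qed.

(** A product of averages is an average over the products, so a gap can be
amplified. *)
Lemma strong_spectral_gap (d : R) : ~ almost_invariant -> 0 < d ->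
  exists2 H, (0 < size H)%N & forall v, (sqnorm v < +oo)%E ->
    (sqnorm (average H v) <= d%:E * sqnorm v)%E.
Proof.
move=> /spectral_gap[K [r [sK _ /andP[r0 r1] gap]]] d0.
have [n rn] : exists n, (r ^+ 2) ^+ n <= d.
  have : `|r ^+ 2| < 1 by rewrite ger0_norm ?sqr_ge0// expr2; nra.
  move=> /cvg_geometric -/(_ 1) /cvgrPdist_le /(_ _ d0)[n _ /(_ n (leqnn n))].
  rewrite /geometric/= mul1r sub0r normrN ger0_norm => [?|]; first by exists n.
  by rewrite exprn_ge0// sqr_ge0.
suff [H sH gapH] : exists2 H, (0 < size H)%N & forall v, (sqnorm v < +oo)%E ->
    (sqnorm (average H v) <= ((r ^+ 2) ^+ n)%:E * sqnorm v)%E.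
  exists H => // v vfin; apply: (le_trans (gapH v vfin)).
  by rewrite lee_wpmul2r ?sqnorm_ge0// lee_fin.
elim: n {rn} => [|n [H sH gapH]].
  exists [:: 1%g] => // v _; rewrite expr0 mul1e; exact: sqnorm_average_le.
exists [seq (h * k)%g | h <- H, k <- K]; first by rewrite size_allpairs muln_gt0 sH.
move=> v vfin; rewrite -average_flatten.
have avfin : (sqnorm (average K v) < +oo)%E.
  exact: le_lt_trans (sqnorm_average_le v sK) vfin.
apply: (le_trans (gapH _ avfin)); rewrite (exprSr _ n) EFinM -muleA.
by rewrite lee_wpmul2l ?gap// lee_fin exprn_ge0// sqr_ge0.
Qed.

End averages.
Arguments almost_invariant : clear implicits.

(** * Almost invariant vectors and amenability *)

Section finite_expectation.
Context {R : realType} {G : groupType} (m : set G -> R).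
Hypothesis mD : forall A B, A `&` B = set0 -> m (A `|` B) = m A + m B.

Lemma mean_set0 : m set0 = 0.
Proof.
have := @mD set0 set0; rewrite setI0 setU0 => /(_ erefl) /eqP.
by rewrite -subr_eq subrr => /eqP.
Qed.

Lemma mean_partition (T : finType) (F : G -> T) (A : pred T) :
  m [set g | A (F g)] = \sum_(t | A t) m [set g | F g = t].
Proof.
have memE (s : seq T) : uniq s ->
    m [set g | F g \in s] = \sum_(t <- s) m [set g | F g = t].
  elim: s => [_|t s IHs /= /andP[ts us]].
    by rewrite big_nil -[RHS]mean_set0; congr m; apply/seteqP; split.
  rewrite big_cons -IHs// -mD.
    congr m; apply/seteqP; split => g /=; rewrite inE.
      by move=> /orP[/eqP|]; [left|right].
    by move=> [->|->]; rewrite ?eqxx// orbT.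
  by apply/seteqP; split => // g [/= -> st]; rewrite st in ts.
rewrite -[RHS]big_enum/= -memE ?enum_uniq//.
by congr m; apply/seteqP; split => g /=; rewrite mem_enum.
Qed.

(** The integral of [c \o F] against a finitely additive [m]. *)
Definition expectation (T : finType) (F : G -> T) (c : T -> R) : R :=
  \sum_t c t * m [set g | F g = t].

Lemma expectation_comp (T T' : finType) (F : G -> T) (h : T -> T') (c : T' -> R) :
  expectation F (c \o h) = expectation (h \o F) c.
Proof.
rewrite /expectation (partition_big h xpredT)//=; apply: eq_bigr => t' _.
rewrite [X in _ = _ * m X](_ : _ = [set g | h (F g) == t']); last first.
  by apply/seteqP; split => g /= /eqP.
rewrite (mean_partition F (fun t => h t == t')) mulr_sumr.
by apply: eq_bigr => t /eqP->.
Qed.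

Lemma eq_expectation (T T' : finType) (F : G -> T) (F' : G -> T') c c' :
  (forall g, c (F g) = c' (F' g)) -> expectation F c = expectation F' c'.
Proof.
move=> cc'; pose FF g := (F g, F' g).
rewrite (_ : F = fst \o FF)// (_ : F' = snd \o FF)// -!expectation_comp.
apply: eq_bigr => t _.
have [->|/set0P[g /= gt]] := eqVneq [set g | FF g = t] set0.
  by rewrite mean_set0 !mulr0.
by rewrite -gt /= cc'.
Qed.

Lemma expectation_le (T : finType) (F : G -> T) (c : T -> R) (d : R) :
  (forall A, 0 <= m A) -> m [set: G] = 1 -> (forall g, c (F g) <= d) ->
  expectation F c <= d.
Proof.
move=> m0 m1 cd; rewrite -[d]mulr1 -m1.
rewrite (_ : [set: G] = [set g | xpredT (F g)]); last by apply/seteqP; split.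
rewrite (mean_partition F xpredT) mulr_sumr; apply: ler_sum => t _.
have [->|/set0P[g /= <-]] := eqVneq [set g | F g = t] set0.
  by rewrite mean_set0 !mulr0.
by rewrite ler_wpM2r.
Qed.

End finite_expectation.

Section mean_of_coboundary.
Context {R : realType} {G : groupType} (m : set G -> R).
Hypothesis m_ge0 : forall A, 0 <= m A.
Hypothesis mT : m [set: G] = 1.
Hypothesis mD : forall A B, A `&` B = set0 -> m (A `|` B) = m A + m B.
Hypothesis mM : forall g A, m [set (g * x)%g | x in A] = m A.

(** A right invariant mean, obtained by inversion. *)
Let mr (A : set G) := m [set g | A (g^-1)%g].

Let mr_ge0 A : 0 <= mr A. Proof. exact: m_ge0. Qed.

Let mrT : mr [set: G] = 1. Proof. by rewrite -mT. Qed.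

Let mrD A B : A `&` B = set0 -> mr (A `|` B) = mr A + mr B.
Proof.
move=> AB; rewrite /mr -mD//; apply/seteqP; split => // g [Ag Bg].
by have : set0 (g^-1)%g by rewrite -AB.
Qed.

Let mrM k A : mr [set g | A (g * k)%g] = mr A.
Proof.
rewrite /mr -[RHS](mM k); congr m; apply/seteqP; split => g /=.
  by move=> Ag; exists (k^-1 * g)%g; rewrite ?mulVKg// invgM invgK.
by move=> [x Ax <-]; rewrite invgM mulgVK.
Qed.

(** A mean integrates the increments of a function along right translations by
[k] and by the inverse of [k] to opposite numbers, so no function decreases on
average along a symmetric finite set. *)
Lemma mean_no_decrease (K : seq G) (L : G -> int) (B : nat) :
  uniq K -> (forall k, ((k^-1)%g \in K) = (k \in K)) ->
  (forall k g, k \in K -> `|L (g * k)%g - L g| <= B%:Z) ->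
  ~ (forall g, \sum_(k <- K) (L (g * k)%g - L g) <= -1).
Proof.
move=> uK Kinv LB decr.
(* Shifted by [B], the increments become indices in a finite type, over which
[expectation] is defined. *)
pose code k g : 'I_(2 * B).+1 := inord (absz (L (g * k)%g - L g + B%:Z)).
pose value (j : 'I_(2 * B).+1) : R := j%:R - B%:R.
have codeE k g : k \in K -> value (code k g) = (L (g * k)%g - L g)%:~R.
  move=> kK; have := LB k g kK; rewrite /value /code; set x := L _ - L _ => xB.
  rewrite inordK; last by move: xB; lia.
  have -> : ((absz (x + B%:Z))%:R : R) = (Posz (absz (x + B%:Z)))%:~R by [].
  have -> : Posz (absz (x + B%:Z)) = x + B%:Z by move: xB; lia.
  by rewrite intrD addrK.
pose e k := expectation mr (code k) value.
have eV k : k \in K -> e (k^-1)%g = - e k.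
  move=> kK; rewrite /e.
  rewrite (eq_expectation mrD (F' := fun g => code k (g * k^-1)%g)
    (c' := fun j => - value j)); last first.
    move=> g; rewrite !codeE//; last by rewrite Kinv.
    by rewrite mulgVK -intrN opprB.
  rewrite /expectation -sumrN; apply: eq_bigr => j _.
  by rewrite mulNr -(mrM (k^-1)%g [set g | code k g = j]).
have sum_e : \sum_(k <- K) e k = 0.
  have permK : perm_eq [seq (k^-1)%g | k <- K] K.
    apply: uniq_perm => //; first by rewrite map_inj_uniq//; exact: invg_inj.
    by move=> k; rewrite -{1}(invgK k) mem_map ?Kinv//; exact: invg_inj.
  have : \sum_(k <- K) e k = - \sum_(k <- K) e k; last by lra.
  rewrite -{1}(perm_big _ permK)/= big_map -sumrN big_seq [RHS]big_seq.
  by apply: eq_bigr => k /eV.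
pose F g := [ffun i : 'I_(size K) => code (tnth (in_tuple K) i) g].
pose c (t : {ffun 'I_(size K) -> 'I_(2 * B).+1}) : R := \sum_i value (t i).
have : expectation mr F c <= -1.
  apply: expectation_le => // g; rewrite /c.
  under eq_bigr do rewrite ffunE codeE ?mem_tnth//.
  rewrite -[X in X <= _](big_tnth _ _ _ xpredT
    (fun k => (L (g * k)%g - L g)%:~R : R)).
  by have := decr g; rewrite -(ler_int R) raddf_sum rmorphN1.
suff -> : expectation mr F c = \sum_(k <- K) e k by rewrite sum_e ler0N1.
rewrite /expectation /c; under eq_bigr do rewrite mulr_suml.
rewrite exchange_big/= [RHS]big_tnth; apply: eq_bigr => i _.
apply: (eq_expectation mrD (F := F) (F' := code (tnth (in_tuple K) i))
  (c := fun t => value (t i)) (c' := value)) => g.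
by rewrite ffunE.
Qed.

End mean_of_coboundary.

Section amenable_implies_almost_invariant.
Context {R : realType} {G : groupType}.

Lemma cvg_sum_seq (I : Type) (r : seq I) (a : I -> nat -> R) (l : I -> R) :
  (forall i, a i n @[n --> \oo] --> l i) ->
  (fun n => \sum_(i <- r) a i n) @ \oo --> \sum_(i <- r) l i.
Proof.
move=> al; elim: r => [|i r IHr].
  rewrite big_nil; under eq_fun do rewrite big_nil; exact: cvg_cst.
by rewrite big_cons; under eq_fun do rewrite big_cons; exact: cvgD.
Qed.

Lemma sqr_le_sqnorm (v : G -> R) g : ((v g ^+ 2)%:E <= sqnorm v)%E.
Proof.
apply: esum_ge; exists [set g]; first by split => //; exact: finite_set1.
by rewrite fsbig_set1.
Qed.

Lemma countable_positive_vector : countable [set: G] ->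
  exists w : G -> R, (forall g, 0 < w g) /\ (sqnorm w < +oo)%E.
Proof.
move=> /countable_injP[i injI].
pose a (n : nat) : R := 1 / (2 ^ (n + 1))%:R.
have a0 n : 0 < a n by rewrite divr_gt0// ltr0n expn_gt0.
exists (fun g => Num.sqrt (a (i g))); split; first by move=> g; rewrite sqrtr_gt0.
rewrite /sqnorm; under eq_esum do rewrite sqr_sqrtr ?(ltW (a0 _))//.
rewrite -(esum_image [set: G] i (fun n => (a n)%:E)); last exact: injI.
apply: (@le_lt_trans _ _ (\esum_(n in [set: nat]) (a n)%:E)%E).
  rewrite esum_mkcond; apply: le_esum => n _; case: ifP => _ //.
  by rewrite lee_fin ltW.
rewrite -nneseries_esumT; last by move=> n; rewrite lee_fin ltW.
by rewrite (cvg_lim _ (@cvg_geometric_eseries_half R 1 0))// ltry.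
Qed.

(** A contraction has a positive function that it multiplies by at most
[s^-1 < 1]: sum the resolvent series at any positive square-summable vector. *)
Lemma positive_supersolution (K : seq G) (r : R) :
  countable [set: G] -> (0 < size K)%N -> 0 < r < 1 ->
  (forall v : G -> R, (sqnorm v < +oo)%E ->
    (sqnorm (average K v) <= (r ^+ 2)%:E * sqnorm v)%E) ->
  exists s (u : G -> R), [/\ 1 < s, (forall g, 0 < u g) &
    forall g, average K u g <= s^-1 * u g].
Proof.
move=> cG sK /andP[r0 r1] gap.
have [w [w0 wfin]] := countable_positive_vector cG.
pose s : R := 2 / (1 + r).
have s1 : 1 < s by rewrite /s ltr_pdivlMr; lra.
have sr : s * r < 1 by rewrite /s mulrAC ltr_pdivrMr; lra.
have s0 : 0 < s by lra.
pose P n := iter n (average K) w.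
have P0 n g : 0 <= P n g.
  by elim: n g => [g|n IHn g] /=; [exact: ltW|exact: average_ge0].
have Pnorm n : (sqnorm (P n) <= ((r ^+ n) ^+ 2)%:E * sqnorm w)%E.
  elim: n => [|n IHn]; first by rewrite expr0 expr1n mul1e.
  have Pfin : (sqnorm (P n) < +oo)%E.
    by rewrite (le_lt_trans IHn)// lte_mul_pinfty ?lee_fin ?sqr_ge0.
  apply: (le_trans (gap _ Pfin)).
  rewrite (exprS r n) exprMn (EFinM (r ^+ 2)) -[leRHS]muleA.
  by rewrite lee_wpmul2l ?lee_fin ?sqr_ge0.
pose W := Num.sqrt (fine (sqnorm w)).
have PW n g : P n g <= r ^+ n * W.
  have rW0 : 0 <= r ^+ n * W by rewrite mulr_ge0 ?sqrtr_ge0// exprn_ge0// ltW.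
  rewrite -(@ler_pXn2r _ 2)// ?nnegrE// -lee_fin.
  apply: (le_trans (sqr_le_sqnorm _ _)); apply: (le_trans (Pnorm n)).
  rewrite exprMn (sqr_sqrtr (fine_ge0 (sqnorm_ge0 w))) (EFinM (_ ^+ 2)) fineK//.
  by rewrite ge0_fin_numE// sqnorm_ge0.
pose a g n := s ^+ n * P n g.
have a0 g n : 0 <= a g n by rewrite mulr_ge0// exprn_ge0// ltW.
have cvg_a g : cvgn (series (a g)).
  apply: (@series_le_cvg _ _ (geometric W (s * r))) => // [n|n|].
  - by rewrite mulr_ge0 ?sqrtr_ge0// exprn_ge0// mulr_ge0 ?ltW.
  - apply: (le_trans (ler_wpM2l (exprn_ge0 n (ltW s0)) (PW n g))).
    by rewrite mulrA -exprMn mulrC.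
  - by apply: is_cvg_geometric_series; rewrite ger0_norm// mulr_ge0 ?ltW.
pose u g := limn (series (a g)).
have le_u g n : series (a g) n <= u g.
  apply: nondecreasing_cvgn_le; last exact: cvg_a.
  exact: nondecreasing_series.
exists s, u; split=> // g.
  apply: (lt_le_trans _ (le_u g 1%N)).
  by rewrite /series/= big_nat1 /a expr0 mul1r.
have cvg_avg : (fun n => average K (fun h => series (a h) n) g) @ \oo -->
    average K u g.
  by apply: cvgMl_tmp; apply: cvg_sum_seq => k; exact: cvg_a.
apply: (ler_cvg_to cvg_avg (cvg_cst (s^-1 * u g))).
apply: nearW => n; rewrite ler_pdivlMl//.
apply: (le_trans _ (le_u g n.+1)).
have -> : series (a g) n.+1 = a g 0%N + \sum_(0 <= i < n) a g i.+1.
  by rewrite /series/= big_nat_recl.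
rewrite -[leLHS]add0r lerD//.
rewrite /average /series/= exchange_big/= mulrA mulr_sumr; apply: ler_sum => i _.
rewrite /a; have -> : P i.+1 g = (size K)%:R^-1 * \sum_(k <- K) P i (g * k)%g by [].
by rewrite -mulr_sumr exprS le_eqVlt; apply/predU1P; left; ring.
Qed.

(** The logarithm [L] of a supersolution decreases on average along the
symmetric set [K]; its increments are bounded because [K] is symmetric, and
rounding a large multiple of [L] makes them integers without losing the
decrease. *)
Lemma amenable_almost_invariant :
  countable [set: G] -> amenable R G -> almost_invariant R G.
Proof.
move=> cG [m [m0 m1 mD mM]]; apply: contrapT => /spectral_gap.
move=> [K [r [sK [uK Kinv] r01 gap]]].
have [s [u [s1 u0 decr]]] := positive_supersolution cG sK r01 gap.
have s0 : 0 < s by lra.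
pose N : R := (size K)%:R.
have N0 : 0 < N by rewrite ltr0n.
have ratio_le g k : k \in K -> u (g * k)%g <= N * u g.
  move=> kK; apply: (@le_trans _ _ (N * (s^-1 * u g))); last first.
    by rewrite ler_wpM2l ?(ltW N0)// ler_piMl ?(ltW (u0 g))// invf_le1// ltW.
  rewrite -ler_pdivrMl//; apply: le_trans (decr g).
  rewrite /average ler_wpM2l ?invr_ge0 ?ler0n// (bigD1_seq k)//= lerDl.
  by apply: sumr_ge0 => h _; exact: ltW.
have s1ln : 0 < ln s := ln_gt0 s1.
pose M : R := (ln s)^-1 + 1.
have M0 : 0 < M by rewrite addr_gt0// invr_gt0.
have Mln : 1 < M * ln s by rewrite mulrDl mulVf ?gt_eqF// mul1r ltrDl.
pose l g := ln (u g); pose L g := Num.floor (M * l g).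
have l_le g k : k \in K -> l (g * k)%g <= ln N + l g.
  by move=> kK; rewrite /l -lnM ?posrE// ler_ln ?posrE ?mulr_gt0// ratio_le.
have l_ge g k : k \in K -> l g <= ln N + l (g * k)%g.
  by move=> kK; rewrite -{1}(mulgK k g) l_le// Kinv.
have fl g : (L g)%:~R <= M * l g < (L g)%:~R + 1.
  by rewrite floor_le/= -[1 in X in _ < X]/(1%:~R) -intrD floorD1_gt.
pose B := Num.bound (M * ln N + 1).
have hB : M * ln N + 1 < B%:R by apply: archi_boundP;
  rewrite addr_ge0// mulr_ge0 ?(ltW M0)// ln_ge0// ler1n.
apply: (mean_no_decrease m0 m1 mD mM (K := K) (L := L) (B := B)) => //.
  move=> k g kK; rewrite ler_norml -!(ler_int R) !raddfB/= raddfN/=.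
  have /andP[a1 a2] := fl g; have /andP[b1 b2] := fl (g * k)%g.
  have le1 : M * l (g * k)%g <= M * (ln N + l g) by rewrite ler_pM2l// l_le.
  have le2 : M * l g <= M * (ln N + l (g * k)%g) by rewrite ler_pM2l// l_ge.
  move: le1 le2; rewrite !mulrDr => le1 le2.
  rewrite -!pmulrn.
  by apply/andP; split; lra.
move=> g; rewrite -(ltzD1 _ (-1)) addNr -(ltr_int R) raddf_sum/=.
have le_ln k : l (g * k)%g - l g <= u (g * k)%g / u g * s - ln s - 1.
  have /le_ln1Dx : -1 < u (g * k)%g / u g * s - 1.
    by rewrite ltrBrDr addNr !mulr_gt0 ?invr_gt0.
  rewrite addrC subrK lnM ?posrE ?divr_gt0// ln_div ?posrE//.
  by rewrite -/(l g) -/(l _); lra.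
have sum_ln : \sum_(k <- K) (l (g * k)%g - l g) <= - (N * ln s).
  apply: (le_trans (ler_sum _ (fun k _ => le_ln k))).
  have -> : \sum_(k <- K) (u (g * k)%g / u g * s - ln s - 1) =
      N * (average K u g) / u g * s - N * ln s - N.
    have sum_cst (a : R) : \sum_(k <- K) a = N * a.
      by rewrite big_const_seq iter_addr_0 count_predT mulr_natl.
    by rewrite !sumrB !sum_cst mulr1 /average mulVKf ?gt_eqF// !mulr_suml.
  suff : N * average K u g / u g * s <= N by lra.
  have avg1 : average K u g / u g * s <= 1.
    by rewrite -ler_pdivlMr// div1r ler_pdivrMr.
  have -> : N * average K u g / u g * s = N * (average K u g / u g * s) by ring.
  by rewrite ler_piMr// ltW.
apply: (@le_lt_trans _ _ (\sum_(k <- K) (M * (l (g * k)%g - l g) + 1))).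
  apply: ler_sum => k _; rewrite raddfB/=.
  by have /andP[? ?] := fl g; have /andP[? ?] := fl (g * k)%g; lra.
rewrite big_split/= -mulr_sumr big_const_seq iter_addr_0 count_predT -/N.
apply: (@le_lt_trans _ _ (M * (- (N * ln s)) + N)).
  by rewrite lerD2r ler_pM2l.
have : N * 1 < N * (M * ln s) by rewrite ltr_pM2l.
by lra.
Qed.

End amenable_implies_almost_invariant.

Lemma ultra_fmap (T U : Type) (f : T -> U) (F : set_system T) :
  UltraFilter F -> UltraFilter (f @ F).
Proof.
move=> FU; have FF : ProperFilter F by exact: ultra_proper.
split; first exact: fmap_proper_filter.
move=> H HH sFH; apply/seteqP; split => // A HA.
have [//|FnA] := in_ultra_setVsetC (f @^-1` A) FU.
have HnA : H (~` A) by exact: sFH.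
by have := filter_not_empty H; rewrite -(setICr A); case; exact: filterI.
Qed.

Lemma le_cvg_filter (R : realType) (T : Type) (F : set_system T)
    (f g : T -> R) (a b : R) : ProperFilter F ->
  f @ F --> a -> g @ F --> b -> F [set i | f i <= g i] -> a <= b.
Proof.
move=> PF fa gb fg; rewrite -subr_ge0.
apply: (cvgr_to_ge (cvgB gb fa)).
by apply: filterS fg => i /=; rewrite subr_ge0.
Qed.

Section almost_invariant_implies_amenable.
Context {R : realType} {G : groupType}.

(** The share of the mass of [v ^+ 2] that sits at the inverses of [A]; passing
to inverses exchanges right and left translations. *)
Definition mass_share (v : G -> R) (A : set G) : R :=
  fine (sqnorm (fun g => v g * \1_A (g^-1)%g)) / fine (sqnorm v).

Section mass_share.
Variable v : G -> R.
Hypotheses (v0 : (0 < sqnorm v)%E) (vfin : (sqnorm v < +oo)%E).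

Let le_v A : (sqnorm (fun g => v g * \1_A (g^-1)%g)%R <= sqnorm v)%E.
Proof.
apply: le_sqnorm => g; rewrite normrM ler_piMr// indicE.
by case: (_ \in _); rewrite ?normr1 ?normr0.
Qed.

Let finE A : (fine (sqnorm (fun g => v g * \1_A (g^-1)%g)))%:E =
  sqnorm (fun g => v g * \1_A (g^-1)%g).
Proof.
by rewrite fineK// ge0_fin_numE ?sqnorm_ge0//; exact: le_lt_trans (le_v _) vfin.
Qed.

Let finvE : (fine (sqnorm v))%:E = sqnorm v.
Proof. by rewrite fineK// ge0_fin_numE ?sqnorm_ge0. Qed.

Let finv_gt0 : 0 < fine (sqnorm v).
Proof. by rewrite -lte_fin finvE. Qed.

Lemma mass_share_ge0 A : 0 <= mass_share v A.
Proof. by rewrite divr_ge0 ?fine_ge0 ?sqnorm_ge0. Qed.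

Lemma mass_share_le1 A : mass_share v A <= 1.
Proof. by rewrite ler_pdivrMr// mul1r -lee_fin finE finvE. Qed.

Lemma mass_shareT : mass_share v [set: G] = 1.
Proof.
rewrite /mass_share (_ : (fun g => _) = v) ?divff ?gt_eqF//.
by apply/funext => g; rewrite indicT mulr1.
Qed.

Lemma mass_shareU A B : A `&` B = set0 ->
  mass_share v (A `|` B) = mass_share v A + mass_share v B.
Proof.
move=> AB; rewrite /mass_share -mulrDl; congr (_ / _).
apply: EFin_inj; rewrite EFinD !finE /sqnorm -esumD; try by
  move=> g _; rewrite lee_fin sqr_ge0.
apply: eq_esum => g _; rewrite -EFinD !indicE in_setU; congr _%:E.
case: (boolP (_ \in A)) => gA; case: (boolP (_ \in B)) => gB /=; try ring.
have : (A `&` B) (g^-1)%g by split; exact: set_mem.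
  by rewrite AB.
Qed.

Lemma mass_share_transl k A (t : R) : 0 < t ->
  (sqnorm (fun g => (v (g * k^-1)%g - v g)%R) <= (t ^+ 2)%:E * sqnorm v)%E ->
  mass_share v [set (k * x)%g | x in A] <= mass_share v A + (2 * t + t ^+ 2).
Proof.
move=> t0 near_v; set kA := [set _ | _ in _].
pose u g := v (g * k^-1)%g * \1_A (g^-1)%g.
pose w g := v g * \1_A (g^-1)%g.
have kAE : sqnorm (fun g => v g * \1_kA (g^-1)%g) = sqnorm u.
  rewrite -(sqnorm_rtrans (k^-1)%g (fun g => v g * \1_kA (g^-1)%g)).
  congr sqnorm; apply/funext => g; rewrite /u /rtrans; congr (_ * _).
  rewrite !indicE; congr (_%:R); congr nat_of_bool.
  rewrite invgM invgK; apply/idP/idP; rewrite !inE.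
    by move=> [x Ax /mulgI <-].
  by move=> Ag; exists (g^-1)%g.
have uw : (sqnorm (fun g => (u g - w g)%R) <= (t ^+ 2)%:E * sqnorm v)%E.
  apply: le_trans near_v; apply: le_sqnorm => g.
  rewrite /u /w -mulrBl normrM ler_piMr// indicE.
  by case: (_ \in _); rewrite ?normr1 ?normr0.
have := sqnorm_triangle u w t0; rewrite -kAE -finE => le_u.
have : (fine (sqnorm (fun g => v g * \1_kA (g^-1)%g)) <=
    (1 + t) * fine (sqnorm w) + (1 + t^-1) * (t ^+ 2 * fine (sqnorm v)))%R.
  rewrite -lee_fin EFinD; apply: (le_trans le_u).
  rewrite !EFinM (finE A) finvE leeD2l// lee_wpmul2l//.
  by rewrite lee_fin addr_ge0 ?invr_ge0 ?(ltW t0).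
have w1 : fine (sqnorm w) <= fine (sqnorm v) by rewrite -lee_fin finE finvE le_v.
move=> le_kA; rewrite /mass_share -/w ler_pdivrMr// mulrDl divfK ?gt_eqF//.
apply: (le_trans le_kA).
have -> : (1 + t^-1) * (t ^+ 2 * fine (sqnorm v)) =
    (t + t ^+ 2) * fine (sqnorm v) by field; rewrite gt_eqF.
have : t * fine (sqnorm w) <= t * fine (sqnorm v) by rewrite ler_pM2l.
lra.
Qed.

End mass_share.

(** A mean is a limit, along an ultrafilter, of the mass distributions of
ever more invariant vectors. *)
Lemma almost_invariant_amenable : almost_invariant R G -> amenable R G.
Proof.
move=> ai.
have small n : 0 < ((n.+1%:R : R)^-1) ^+ 2 by rewrite exprn_gt0// invr_gt0 ltr0n.
have /choice[v vP] := fun i : seq G * nat => ai i.1 _ (small i.2).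
pose D (p : seq G * nat) := [set i : seq G * nat |
  {subset p.1 <= i.1} /\ (p.2 <= i.2)%N].
have FD : ProperFilter (filter_from setT D).
  apply: filter_from_proper => [|p _]; last by exists p; split.
  apply: filter_fromT_filter => [|p q]; first by exists ([::], 0%N).
  exists (p.1 ++ q.1, maxn p.2 q.2) => i [/= sub]; rewrite geq_max => /andP[pi qi].
  by split; split=> // k kp; apply: sub; rewrite mem_cat kp ?orbT.
have [U [UU DU]] := ultraFilterLemma FD.
have UD p : U (D p) by apply: DU; exists p.
have PU : ProperFilter U by exact: ultra_proper.
have v0 i : (0 < sqnorm (v i))%E by have [] := vP i.
have vfin i : (sqnorm (v i) < +oo)%E by have [] := vP i.
have ex_lim A : exists l : R, (fun i => mass_share (v i) A) @ U --> l.
  have := @segment_compact R 0 1; rewrite compact_ultra => /(_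
    ((fun i => mass_share (v i) A) @ U) (ultra_fmap _ UU)).
  case; last by move=> l [_ lim_l]; exists l.
  apply: (@filterE _ U) => i /=.
  by rewrite in_itv/= mass_share_ge0// mass_share_le1.
have [m mP] := choice ex_lim.
have mM_le k A : m [set (k * x)%g | x in A] <= m A.
  apply/ler_addgt0Pl => e e0.
  have [n /= ne] : exists n : nat, 3 * (n.+1%:R : R)^-1 <= e.
    exists (Num.bound (3 / e)); rewrite ler_pdivrMr ?ltr0n// mulrC -ler_pdivrMr//.
    apply: ltW; apply: (lt_trans (archi_boundP _)); rewrite ?ltr_nat//.
    by rewrite divr_ge0// ltW.
  rewrite addrC; apply: (le_cvg_filter PU (mP _) (cvgD (mP A) (cvg_cst e))).
  apply: (@filterS _ U _ _ _ _ (UD ([:: (k^-1)%g], n))) => i [/= kK ni].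
  have t0 : 0 < ((i.2).+1%:R : R)^-1 by rewrite invr_gt0 ltr0n.
  have t1 : ((i.2).+1%:R : R)^-1 <= (n.+1%:R)^-1 by rewrite lef_pV2 ?posrE ?ltr0n// ler_nat.
  have t2 : ((i.2).+1%:R : R)^-1 <= 1 by rewrite invf_le1 ?ltr0n// ler1n.
  have [_ _ near_v] := vP i.
  apply: (le_trans (mass_share_transl (v0 i) (vfin i) A t0 (near_v _ (kK _ _)))).
    by rewrite inE.
  rewrite lerD2l; apply: le_trans ne.
  move: t1 t2 t0; set t := (_^-1); set tn := (_^-1); nra.
exists m; split.
- move=> A; apply: (le_cvg_filter PU (cvg_cst 0) (mP A)); apply: nearW => i.
  exact: mass_share_ge0.
- have limT := mP [set: G].
  suff lim1 : (fun i => mass_share (v i) [set: G]) @ U --> (1 : R).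
    by have := cvg_unique _ limT lim1; apply.
  rewrite (_ : (fun i => _) = cst 1); first exact: cvg_cst.
  by apply/funext => i; rewrite mass_shareT.
- move=> A B AB; have limAB := mP (A `|` B).
  suff limD : (fun i => mass_share (v i) (A `|` B)) @ U --> m A + m B.
    by have := cvg_unique _ limAB limD; apply.
  rewrite (_ : (fun i => _) = (fun i => mass_share (v i) A + mass_share (v i) B)).
    exact: cvgD (mP A) (mP B).
  by apply/funext => i; rewrite mass_shareU.
- move=> k A; apply/eqP; rewrite eq_le mM_le/=.
  rewrite [X in m X <= _](_ : A = [set (k^-1 * x)%g | x in [set (k * x)%g | x in A]]) ?mM_le//.
  apply/seteqP; split => [x Ax|_ [_ [x Ax <-]] <-]; last by rewrite mulKg.
  by exists (k * x)%g; rewrite ?mulKg//; exists x.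
Qed.

End almost_invariant_implies_amenable.

(** * Contraction along a tree of words *)

Section word_tree.
Context {R : realType} {G : groupType}.
Variables (psi : nat -> G) (l : nat -> nat).

Fixpoint tree_words (s m : nat) : seq (seq nat) :=
  if m is m'.+1 then
    [seq j :: v | j <- iota 0 (l s), v <- tree_words s.+1 m']
  else [:: [::]].

Definition word_value (u : seq nat) : G := foldr (fun j g => psi j * g)%g 1%g u.

Lemma word_value_cat u v : word_value (u ++ v) = (word_value u * word_value v)%g.
Proof. by elim: u => [|j u IHu] /=; rewrite ?mul1g// IHu mulgA. Qed.

Lemma mem_tree_words s m v : (v \in tree_words s m) =
  (size v == m) && all (fun i => (nth 0%N v i < l (s + i))%N) (iota 0 m).
Proof.
elim: m s v => [|m IHm] s v /=; first by rewrite inE size_eq0 andbT.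
case: v => [|j v]; first by apply/allpairsPdep => -[? [? [_ _]]].
rewrite addn0 /= eqSS.
have -> : all (fun i => (nth 0%N (j :: v) i < l (s + i))%N) (iota 1 m) =
    all (fun i => (nth 0%N v i < l (s.+1 + i))%N) (iota 0 m).
  rewrite -[1%N in LHS]addn0 iotaDl all_map; apply: eq_all => i /=.
  by rewrite add1n /= addSnnS.
rewrite andbCA -IHm; apply/allpairsPdep/andP.
  by move=> [j' [v' [+ v'm [-> ->]]]]; rewrite mem_iota add0n.
by move=> [jl vm]; exists j, v; rewrite mem_iota add0n.
Qed.

Lemma size_tree_words s m v : v \in tree_words s m -> size v = m.
Proof. by rewrite mem_tree_words => /andP[/eqP]. Qed.

Lemma tree_words_uniq s m : uniq (tree_words s m).
Proof.
elim: m s => // m IHm s; apply: allpairs_uniq; rewrite ?iota_uniq//.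
by move=> [j v] [j' v'] _ _ /= [-> ->].
Qed.

Lemma sum_tree_words_cat (F : seq nat -> R) s k m :
  \sum_(w <- tree_words s (k + m)) F w =
  \sum_(u <- tree_words s k) \sum_(v <- tree_words (s + k) m) F (u ++ v).
Proof.
elim: k s F => [|k IHk] s F; first by rewrite addn0 big_seq1.
rewrite addSn /= !big_allpairs_dep; apply: eq_bigr => j _.
by rewrite (IHk s.+1 (fun w => F (j :: w))) addSnnS.
Qed.

Lemma sum_tree_words1 (F : seq nat -> R) s :
  \sum_(w <- tree_words s 1) F w = \sum_(j <- iota 0 (l s)) F [:: j].
Proof.
change (tree_words s 1) with [seq j :: v | j <- iota 0 (l s), v <- tree_words s.+1 0].
by rewrite big_allpairs_dep; apply: eq_bigr => j _; exact: big_seq1.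
Qed.

Variable p : seq nat -> R.
Hypothesis p_ge0 : forall u, 0 <= p u.
Hypothesis p_sum : forall u,
  p u = \sum_(j <- iota 0 (l (size u))) p (rcons u j).

Lemma sum_tree_words x m : \sum_(v <- tree_words (size x) m) p (x ++ v) = p x.
Proof.
elim: m x => [|m IHm] x; first by rewrite big_seq1 cats0.
rewrite /= big_allpairs_dep [RHS]p_sum; apply: eq_bigr => j _.
by rewrite -IHm size_rcons; apply: eq_bigr => v _; rewrite cat_rcons.
Qed.

Lemma tree_words_le x m v : v \in tree_words (size x) m -> p (x ++ v) <= p x.
Proof.
move=> vm; rewrite -(sum_tree_words x m) (bigD1_seq v) ?tree_words_uniq//=.
by rewrite lerDl sumr_ge0.
Qed.

Variable b : G -> R.
Hypothesis b_ge0 : forall g, 0 <= b g.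

(** The expectation of [b], translated by the group element that the next [m]
letters spell, given that the word starts with [x]. *)
Definition branch (m : nat) (x : seq nat) : G -> R := fun g =>
  \sum_(v <- tree_words (size x) m) p (x ++ v) / p x * b (g * word_value v)%g.

Lemma branch_ge0 m x g : 0 <= branch m x g.
Proof. by apply: sumr_ge0 => v _; rewrite mulr_ge0// divr_ge0. Qed.

Lemma branch0 x : 0 < p x -> branch 0 x = b.
Proof.
move=> x0; apply/funext => g.
by rewrite /branch big_seq1 cats0 divff ?gt_eqF// mul1r mulg1.
Qed.

Lemma branch_split k m x : 0 < p x ->
  branch (k + m) x = fun g => \sum_(u <- tree_words (size x) k)
    p (x ++ u) / p x * rtrans (word_value u) (branch m (x ++ u)) g.
Proof.
move=> x0; apply/funext => g; rewrite /branch sum_tree_words_cat big_seq.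
rewrite [RHS]big_seq; apply: eq_bigr => u uk; rewrite /rtrans /branch mulr_sumr.
rewrite size_cat (size_tree_words uk) big_seq [RHS]big_seq; apply: eq_bigr => v vm.
rewrite catA word_value_cat mulgA !mulrA; congr (_ * _).
have [pu0|pu0] := eqVneq (p (x ++ u)) 0; last first.
  by field; rewrite pu0 gt_eqF.
have : p ((x ++ u) ++ v) <= p (x ++ u).
  by apply: (@tree_words_le _ m); rewrite size_cat (size_tree_words uk).
rewrite pu0 !mul0r => pv0.
suff -> : p ((x ++ u) ++ v) = 0 by rewrite mul0r.
by apply/eqP; rewrite eq_le pv0 p_ge0.
Qed.

Let weight x (u : seq nat) := p (x ++ u) / p x.

Let weight_ge0 x u : 0 <= weight x u. Proof. exact: divr_ge0. Qed.

Let weight_sum x k : 0 < p x -> \sum_(u <- tree_words (size x) k) weight x u = 1.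
Proof. by move=> x0; rewrite -mulr_suml sum_tree_words divff// gt_eqF. Qed.

Let sum_weight_le x k m (Q : R) : 0 < p x ->
  (forall u, u \in tree_words (size x) k -> 0 < p (x ++ u) ->
    (sqnorm (branch m (x ++ u)) <= Q%:E)%E) ->
  (\sum_(u <- tree_words (size x) k) (weight x u)%:E *
     sqnorm (rtrans (word_value u) (branch m (x ++ u))) <= Q%:E)%E.
Proof.
move=> x0 leQ; rewrite -[Q in leRHS]mul1r -(weight_sum k x0) mulr_suml -sumEFin.
rewrite big_seq [leRHS]big_seq; apply: lee_sum => u uk.
have [pu0|] := eqVneq (p (x ++ u)) 0; first by rewrite /weight pu0 !mul0r mul0e.
rewrite eq_sym => pu0; rewrite sqnorm_rtrans (EFinM (weight x u) Q).
rewrite lee_wpmul2l ?lee_fin//.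
by apply: leQ => //; rewrite lt_def eq_sym pu0 p_ge0.
Qed.

(** An average of translates is no longer than the longest of them. *)
Lemma sqnorm_branch_le k m x (Q : R) : 0 < p x ->
  (forall u, u \in tree_words (size x) k -> 0 < p (x ++ u) ->
    (sqnorm (branch m (x ++ u)) <= Q%:E)%E) ->
  (sqnorm (branch (k + m) x) <= Q%:E)%E.
Proof.
move=> x0 leQ; rewrite branch_split//.
apply: le_trans (sum_weight_le x0 leQ).
exact: (sqnorm_sum_le _ (weight_ge0 x) (weight_sum k x0)).
Qed.

Variable D : R.
Hypothesis D_ge1 : 1 <= D.
(* The future depends on the past only through the last letter, up to [D]. *)
Hypothesis p_past : forall X X' a v, size X = size X' ->
  0 < p (rcons X a) -> 0 < p (rcons X' a) ->
  p (rcons X a ++ v) / p (rcons X a) <= D * (p (rcons X' a ++ v) / p (rcons X' a)).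

Lemma branch_past m X X' a g : size X = size X' ->
  0 < p (rcons X a) -> 0 < p (rcons X' a) ->
  branch m (rcons X a) g <= D * branch m (rcons X' a) g.
Proof.
move=> sX X0 X'0; rewrite /branch !size_rcons sX mulr_sumr; apply: ler_sum => v _.
by rewrite mulrA ler_wpM2r// p_past.
Qed.

Variable H : seq G.
Hypothesis H_gt0 : (0 < size H)%N.
Hypothesis H_gap : forall v : G -> R, (sqnorm v < +oo)%E ->
  (sqnorm (average H v) <= ((8 * D ^+ 4)^-1)%:E * sqnorm v)%E.

Variable eta : R.
Hypothesis eta01 : 0 < eta <= 1.

(** Only words with a common last letter have comparable futures, so the words that
spell [H] have to end like a given word [u]; the factor [e] leaves room for the
value of that letter. *)
Definition rich_block (k : nat) (x : seq nat) : Prop :=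
  forall u, u \in tree_words (size x) k -> 0 < p (x ++ u) ->
  exists (e : G) (W : G -> seq nat), forall h, h \in H ->
    [/\ W h \in tree_words (size x) k, last 0%N (W h) = last 0%N u,
        word_value (W h) = (h * e)%g & eta * p x <= p (x ++ W h)].

Definition block_rate : R := 1 - eta ^+ 2 / (8 * D ^+ 2).

Lemma block_rate_ge12 : 2^-1 <= block_rate.
Proof.
have D0 : 0 < D := lt_le_trans ltr01 D_ge1.
have /andP[e0 e1] := eta01.
have D2 : 1 <= D ^+ 2 by rewrite expr_ge1// ltW.
have e2 : eta ^+ 2 <= 1 by rewrite expr_le1// ltW.
have : eta ^+ 2 / (8 * D ^+ 2) <= 2^-1.
  by rewrite ler_pdivrMr ?mulr_gt0 ?exprn_gt0//; lra.
by rewrite /block_rate; lra.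
Qed.

(** Either all branches at the end of the block are short, or some branch [Y] is
long. Then the branches reached through the words that spell [H] and end like
[Y] agree with [Y] up to the factor [D]; were their translates close to each
other, they would be close to an average of translates of [Y], which is much
shorter than [Y]. So two of them are far apart, and strict convexity applies. *)
Lemma block_contraction k m x (Q : R) : 0 < p x -> (0 < k)%N ->
  rich_block k x ->
  (forall u, u \in tree_words (size x) k -> 0 < p (x ++ u) ->
    (sqnorm (branch m (x ++ u)) <= Q%:E)%E) ->
  (sqnorm (branch (k + m) x) <= (block_rate * Q)%:E)%E.
Proof.
move=> x0 k0 rich leQ; have /andP[e0 e1] := eta01.
have D0 : 0 < D := lt_le_trans ltr01 D_ge1.
have [short|] := pselect (forall u, u \in tree_words (size x) k ->
    0 < p (x ++ u) -> (sqnorm (branch m (x ++ u)) <= (2^-1 * Q)%:E)%E).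
  have := sqnorm_branch_le x0 short.
  move=> /le_trans; apply; rewrite lee_fin ler_wpM2r ?block_rate_ge12//.
  have := sqnorm_branch_le x0 leQ.
  by move=> /(le_trans (sqnorm_ge0 _)).
move=> /existsNP[us /not_implyP[usk /not_implyP[pus /negP]]]; rewrite -ltNge.
have [e [W WP]] := rich us usk pus.
set Y := branch m (x ++ us); pose Yh h := branch m (x ++ W h).
have Y_le h : h \in H -> (forall g, Y g <= D * Yh h g) /\ (forall g, Yh h g <= D * Y g).
  move=> hH; have [Whk lastW _ pW] := WP h hH.
  have {pW} : 0 < p (x ++ W h) by apply: lt_le_trans pW; rewrite mulr_gt0.
  have := size_tree_words usk; have := size_tree_words Whk.
  rewrite /Y /Yh; move: lastW pus {Whk usk leQ}.
  case/lastP: (us) => [_ _ _ kE|u' c]; first by rewrite -kE in k0.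
  case/lastP: (W h) => [_ _ kE|w' c']; first by rewrite -kE in k0.
  rewrite !last_rcons -!rcons_cat => -> pu; rewrite !size_rcons => sw su pw.
  have sz : size w' = size u' by apply: succn_inj; rewrite sw su.
  by split=> g; apply: branch_past => //; rewrite !size_cat sz.
have Y0 g : 0 <= Y g := branch_ge0 _ _ _.
have Yh0 h g : 0 <= Yh h g := branch_ge0 _ _ _.
pose Z h := rtrans (h * e)%g (Yh h).
pose A := fun g => (size H)%:R^-1 * \sum_(h <- H) Z h g.
pose h0 := head 1%g H.
have h0H : h0 \in H by rewrite /h0; case: (H) H_gt0 => // h H' _; rewrite inE eqxx.
have YQ : (sqnorm Y <= Q%:E)%E by exact: leQ.
have Yfin : (sqnorm Y < +oo)%E by exact: le_lt_trans YQ (ltry _).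
have sqA : (sqnorm A <= (D ^+ 2 * (8 * D ^+ 4)^-1)%:E * sqnorm Y)%E.
  apply: (@le_trans _ _ (sqnorm (fun g => D * average H (rtrans e Y) g))).
    apply: le_sqnorm => g; rewrite ger0_norm; last first.
      by apply: mulr_ge0; [rewrite invr_ge0|apply: sumr_ge0 => h _; exact: Yh0].
    rewrite ger0_norm; last first.
      by rewrite mulr_ge0 ?(ltW D0)// average_ge0// => h; exact: Y0.
    rewrite /A /average mulrCA ler_wpM2l ?invr_ge0// mulr_sumr big_seq.
    rewrite [leRHS]big_seq; apply: ler_sum => h hH.
    by rewrite /Z /rtrans -!mulgA; have [_] := Y_le h hH; apply.
  rewrite sqnormZ (EFinM (D ^+ 2)) -[leRHS]muleA lee_wpmul2l ?lee_fin ?sqr_ge0//.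
  by rewrite -(sqnorm_rtrans e Y); apply: H_gap; rewrite sqnorm_rtrans.
have sqZ0 : (sqnorm Y <= (D ^+ 2)%:E * sqnorm (Z h0))%E.
  rewrite /Z sqnorm_rtrans -sqnormZ; apply: le_sqnorm => g.
  rewrite !ger0_norm ?mulr_ge0 ?(ltW D0)//.
  by have [+ _] := Y_le h0 h0H; apply.
have Z0fin : (sqnorm (Z h0) < +oo)%E.
  rewrite /Z sqnorm_rtrans; have [Wk _ _ pW] := WP h0 h0H.
  apply: le_lt_trans (leQ _ Wk _) (ltry _).
  by apply: lt_le_trans pW; rewrite mulr_gt0.
(* [A] has at most [1 / (8 * D ^+ 2)] and [Z h0] at least [1 / D ^+ 2] of the
square norm of [Y], which exceeds [Q / 2]; the triangle inequality with weights
[2, 2] therefore puts [Z h0] at a square distance above [c] from [A], hence from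
some [Z h]. *)
pose c : R := (8 * D ^+ 2)^-1 * Q.
move=> longY.
have D2 : 0 < D ^+ 2 by rewrite exprn_gt0.
have c0 : 0 <= c.
  apply: mulr_ge0; first by rewrite invr_ge0 mulr_ge0// ltW.
  by have := le_trans (sqnorm_ge0 _) YQ; rewrite lee_fin.
have [h hH far] : exists2 h, h \in H &
    (c%:E < sqnorm (fun g => (Z h0 g - Z h g)%R))%E.
  apply: contrapT => /forall2NP near.
  have near_c h : h \in H -> (sqnorm (fun g => (Z h0 g - Z h g)%R) <= c%:E)%E.
    by move=> hH; case: (near h) => // /negP; rewrite -leNgt.
  have nearA : (sqnorm (fun g => (Z h0 g - A g)%R) <= c%:E)%E.
    have H1 : \sum_(h <- H) (size H)%:R^-1 = 1 :> R.
      rewrite big_const_seq iter_addr_0 count_predT -[LHS]mulr_natr mulVf//.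
      by rewrite pnatr_eq0 -lt0n.
    have -> : (fun g => Z h0 g - A g) =
        (fun g => \sum_(h <- H) (size H)%:R^-1 * (Z h0 g - Z h g)).
      apply/funext => g; rewrite /A -mulr_sumr sumrB mulrBr; congr (_ - _).
      by rewrite mulr_sumr -mulr_suml H1 mul1r.
    apply: (le_trans (sqnorm_sum_le (fun h g => Z h0 g - Z h g)
      (p := fun=> (size H)%:R^-1) _ H1)); first by move=> _; rewrite invr_ge0.
    have -> : c = \sum_(h <- H) (size H)%:R^-1 * c by rewrite -mulr_suml H1 mul1r.
    rewrite -sumEFin big_seq [leRHS]big_seq.
    apply: lee_sum => h hH; rewrite (EFinM _^-1 c).
    by rewrite lee_wpmul2l ?lee_fin ?invr_ge0// near_c.
  have := sqnorm_triangle (Z h0) A ltr01.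
  move: longY Yfin sqA sqZ0 Z0fin nearA YQ.
  move: (sqnorm_ge0 Y) (sqnorm_ge0 (Z h0)) (sqnorm_ge0 A)
    (sqnorm_ge0 (fun g => Z h0 g - A g)).
  rewrite -/Y; case: (sqnorm Y) => // y; case: (sqnorm (Z h0)) => // z.
  case: (sqnorm A) => // a; case: (sqnorm (fun g => Z h0 g - A g)) => // q.
  rewrite -!EFinM -!EFinD !lee_fin !lte_fin => y0 z0 a0 q0 longY _ sqA sqZ0 _ qc yQ.
  rewrite invr1 => tri.
  have E1 : D ^+ 2 * (8 * D ^+ 4)^-1 = (8 * D ^+ 2)^-1 by field; rewrite gt_eqF.
  have E2 : y / D ^+ 2 <= z by rewrite ler_pdivrMr// mulrC.
  have E3 : y / D ^+ 2 = 8 * ((8 * D ^+ 2)^-1 * y) by field; rewrite gt_eqF.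
  move: sqA qc; rewrite E1 /c => sqA qc.
  have i0 : 0 < (8 * D ^+ 2)^-1 by rewrite invr_gt0 mulr_gt0.
  have : (8 * D ^+ 2)^-1 * Q < (8 * D ^+ 2)^-1 * (2 * y) by rewrite ltr_pM2l//; lra.
  rewrite E3 in E2; move: E2 sqA qc tri; move: ((8 * D ^+ 2)^-1) => i; lra.
have [W0k _ valW0 pW0] := WP h0 h0H; have [Wk _ valW pW] := WP h hH.
have WW : W h0 != W h.
  apply: contraTneq far => WW; rewrite -leNgt (_ : sqnorm _ = 0%E).
    by rewrite lee_fin.
  apply: esum1 => g _.
  by rewrite /Z /Yh WW -valW0 -valW WW subrr expr0n.
have := sqnorm_sum_gap (fun u => rtrans (word_value u) (branch m (x ++ u)))
  (tree_words_uniq _ _) W0k Wk WW (weight_ge0 x) (weight_sum k x0).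
rewrite -branch_split// valW0 valW => /le_trans /(_ (sum_weight_le x0 leQ)).
rewrite -/(Yh h0) -/(Yh h) -/(Z h0) -/(Z h) => gap.
have eta_w v : eta * p x <= p (x ++ v) -> eta <= weight x v.
  by move=> ?; rewrite /weight ler_pdivlMr.
have : (sqnorm (branch (k + m) x) + (eta ^+ 2 * c)%:E <= Q%:E)%E.
  apply: le_trans gap; rewrite leeD2l//.
  apply: (@le_trans _ _ ((weight x (W h0) * weight x (W h))%:E * c%:E)%E).
    rewrite -EFinM lee_fin ler_wpM2r//.
    by rewrite expr2 ler_pM ?(ltW e0)// eta_w.
  apply: lee_wpmul2l; last exact: ltW.
  by rewrite lee_fin; apply: mulr_ge0; exact: weight_ge0.
case: (sqnorm (branch (k + m) x)) (sqnorm_ge0 (branch (k + m) x)) => // s _.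
rewrite -EFinD !lee_fin /c /block_rate => le_s.
by rewrite mulrBl mul1r lerBrDr -mulrA.
Qed.

(** Disjoint rich blocks can be chosen greedily, so that [k] rich times
contribute at least one factor [block_rate]. *)
Lemma tree_contraction (n k : nat) (good : pred nat) (B : R) :
  (0 < k)%N -> 0 < p [::] ->
  (forall x, good (size x) -> (size x + k <= n)%N -> 0 < p x -> rich_block k x) ->
  (sqnorm b <= B%:E)%E ->
  exists2 c, (\sum_(0 <= i < n) good i <= k * c + k)%N &
    (sqnorm (branch n [::]) <= (block_rate ^+ c * B)%:E)%E.
Proof.
move=> k0 p0 rich bB.
suff bound m s : (s + m = n)%N -> exists2 c, (\sum_(s <= i < n) good i <= k * c + k)%N &
    forall x, size x = s -> 0 < p x ->
    (sqnorm (branch m x) <= (block_rate ^+ c * B)%:E)%E.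
  by have [c cn Hc] := bound n 0%N (add0n n); exists c => //; exact: Hc.
have [M] := ubnP m; elim: M m s => // M IHM m s /ltnSE mM smn.
have [mk|km] := ltnP m k.
  exists 0%N.
    rewrite muln0 add0n -smn; apply: (@leq_trans m); last exact: ltnW.
    apply: (@leq_trans (\sum_(s <= i < s + m) 1)); first by apply: leq_sum => i _; case: (good i).
    by rewrite sum_nat_const_nat muln1 addKn.
  move=> x sx x0; rewrite expr0 mul1r -[m]addn0; apply: sqnorm_branch_le => //.
  by move=> u _ pu; rewrite branch0.
have [gs|bs] := boolP (good s).
  have [||c cn Hc] := IHM (m - k)%N (s + k)%N.
  - by move: km k0 mM; lia.
  - by move: km smn; lia.
  exists c.+1.
    rewrite (@big_cat_nat _ _ _ (s + k))/=; [|by rewrite leq_addr|by move: km smn; lia].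
    apply: (@leq_trans (k + (k * c + k))); last by rewrite mulnS; lia.
    apply: leq_add => //.
    apply: (@leq_trans (\sum_(s <= i < s + k) 1)); first by apply: leq_sum => i _; case: (good i).
    by rewrite sum_nat_const_nat muln1 addKn.
  move=> x sx x0; rewrite exprS -mulrA -(subnKC km).
  apply: block_contraction => //.
    by apply: rich; rewrite ?sx//; move: km smn; lia.
  by move=> u uk pu; apply: Hc; rewrite ?size_cat ?sx ?(size_tree_words uk).
have m0 : (0 < m)%N by exact: leq_trans k0 km.
have [||c cn Hc] := IHM m.-1 s.+1.
- by move: m0 mM; lia.
- by move: m0 smn; lia.
exists c.
  rewrite big_ltn; last by move: m0 smn; lia.
  by rewrite (negbTE bs).
move=> x sx x0; rewrite -(prednK m0) -add1n; apply: sqnorm_branch_le => //.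
by move=> u uk pu; apply: Hc; rewrite ?size_cat ?sx ?(size_tree_words uk) ?addn1.
Qed.

End word_tree.

(** * Birkhoff's ergodic theorem *)

Section birkhoff_theorem.
Context {d : measure_display} {Om : measurableType d} {R : realType}.
Variables (P : probability Om R) (T : Om -> Om).
Hypothesis mT : measurable_fun [set: Om] T.
Hypothesis PT : forall A, measurable A -> P (T @^-1` A) = P A.
Hypothesis ergT : forall A, measurable A -> T @^-1` A = A ->
  P A = 0%E \/ P A = 1%E.

Let integral_T (h : Om -> R) : measurable_fun [set: Om] h ->
  P.-integrable [set: Om] (fun w => (h (T w))%:E) ->
  (\int[P]_w (h (T w))%:E = \int[P]_w (h w)%:E)%E.
Proof.
move=> mh ih.
have := @integral_pushforward _ _ _ _ R T mT P [set: Om] (EFin \o h).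
move=> /(_ _ _ measurableT) <-.
- apply: (eq_measure_integral P) => A mA _; exact: PT.
- by apply/measurable_EFinP.
- exact: ih.
Qed.

Let integrable_T (h : Om -> R) : P.-integrable [set: Om] (EFin \o h) ->
  P.-integrable [set: Om] (fun w => (h (T w))%:E).
Proof.
move=> /integrableP[mh ih]; apply/integrableP; split.
  apply/measurable_EFinP; apply: measurableT_comp => //.
  exact/measurable_EFinP.
have := @ge0_integral_pushforward _ _ _ _ R T mT P [set: Om]
  (fun w => `|(h w)%:E|)%E measurableT.
rewrite (_ : (\int[P]_(x in T @^-1` setT) _ = \int[P]_x `|(h (T x))%:E|)%E)// => <-.
- rewrite (eq_measure_integral P)// => A mA _; exact: PT.
- exact: measurableT_comp.
- by [].
Qed.

Definition orbit_sum (h : Om -> R) (n : nat) (w : Om) : R :=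
  \sum_(i < n) h (iter i T w).

Lemma orbit_sumS h n w : orbit_sum h n.+1 w = h w + orbit_sum h n (T w).
Proof.
rewrite /orbit_sum big_ord_recl /=; congr (_ + _); apply: eq_bigr => i _.
by rewrite -iterS iterSr.
Qed.

Lemma measurable_iter n : measurable_fun [set: Om] (iter n T).
Proof.
elim: n => [|n IHn] /=; first exact: measurable_id.
exact: (measurableT_comp mT IHn).
Qed.

Lemma measurable_orbit_sum h n : measurable_fun [set: Om] h ->
  measurable_fun [set: Om] (orbit_sum h n).
Proof.
move=> mh; apply: (measurable_sum _) => i.
exact: (measurableT_comp mh (measurable_iter i)).
Qed.

Section positive_integral.
Variable h : Om -> R.
Hypothesis ih : P.-integrable [set: Om] (EFin \o h).

Let mh : measurable_fun [set: Om] h.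
Proof. by apply/measurable_EFinP; exact: measurable_int ih. Qed.

Let unbounded : set Om :=
  \bigcap_(K : nat) \bigcup_(n : nat) [set w | orbit_sum h n w < - K%:R].

Let measurable_unbounded : measurable unbounded.
Proof.
apply: bigcapT_measurable => K; apply: bigcupT_measurable => n.
rewrite [X in measurable X](_ : _ = [set: Om] `&` orbit_sum h n @^-1` `]-oo, - K%:R[).
  by apply: measurable_orbit_sum => //; exact: measurable_itv.
by apply/seteqP; split => w /=; rewrite in_itv/= => // -[].
Qed.

Let unbounded_T : T @^-1` unbounded = unbounded.
Proof.
apply/seteqP; split => w /= wE K _.
  have [K' KK'] : exists K' : nat, h w + K%:R < K'%:R.
    by exists (Num.bound `|h w + K%:R|); apply: le_lt_trans (ler_norm _) _;
      exact: archi_boundP.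
  have [n _ /= wn] := wE K' I; exists n.+1 => //=.
  by rewrite orbit_sumS; lra.
have [K' KK'] : exists K' : nat, K%:R - h w < K'%:R.
  by exists (Num.bound `|K%:R - h w|); apply: le_lt_trans (ler_norm _) _;
    exact: archi_boundP.
have [[|n] _ /= wn] := wE K' I.
  by move: wn; rewrite /orbit_sum big_ord0 oppr_gt0 ltNge ler0n.
by exists n => //=; move: wn; rewrite orbit_sumS; lra.
Qed.

(** The minimum of the orbit sums of length at most [n]. *)
Fixpoint low (n : nat) (w : Om) : R :=
  if n is n'.+1 then Num.min 0 (h w + low n' (T w)) else 0.

Let low_le0 n w : low n w <= 0.
Proof. by case: n => [|n] //=; rewrite ge_min lexx. Qed.

Let low_le_sum n i w : (i <= n)%N -> low n w <= orbit_sum h i w.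
Proof.
elim: n i w => [|n IHn] [|i] w //=; rewrite ?leqn0// => le_in;
  first by rewrite /orbit_sum big_ord0.
  by rewrite /orbit_sum big_ord0 ge_min lexx.
by rewrite orbit_sumS ge_min lerD2l IHn// orbT.
Qed.

Let low_anti n w : low n.+1 w <= low n w.
Proof.
elim: n w => [|n IHn] w; first exact: low_le0.
change (Num.min 0 (h w + low n.+1 (T w)) <= Num.min 0 (h w + low n (T w))).
by rewrite le_min !ge_min lexx /= lerD2l IHn orbT.
Qed.

Let measurable_low n : measurable_fun [set: Om] (low n).
Proof.
elim: n => [|n IHn] /=; first exact: measurable_cst.
apply: measurable_minr; first exact: measurable_cst.
by apply: measurable_funD => //; exact: (measurableT_comp IHn mT).
Qed.

Let integrable_low n : P.-integrable [set: Om] (EFin \o low n).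
Proof.
elim: n => [|n IHn].
  by apply: finite_measure_integrable_cst.
apply: (le_integrable measurableT
  (g := EFin \o (fun w => `|h w| + `|low n (T w)|))).
- exact/measurable_EFinP.
- move=> w _; rewrite lee_fin [leRHS]ger0_norm ?addr_ge0//.
  rewrite (le_trans _ (ler_normD _ _))//= minEle; case: ifP => _ //.
  by rewrite normr0.
- rewrite (_ : _ \o _ = ((abse \o (EFin \o h)) \+
    (abse \o (fun w => (low n (T w))%:E)))%E)//.
  by apply: integrableD => //; apply: integrable_abse => //; exact: integrable_T.
Qed.

(** If the orbit sums were unbounded below, they would be so almost everywhere;
the increments [low n.+1 - low n \o T] tend to [h] there, are dominated by [h],
and have nonpositive integrals because [T] preserves [P]. *)
Let orbit_sum_bounded : (0 < \int[P]_w (h w)%:E)%E -> P unbounded = 0%E.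
Proof.
move=> h_gt0; have [//|PE1] := ergT measurable_unbounded unbounded_T.
exfalso; move: h_gt0; apply/negP; rewrite -leNgt.
pose g n w := low n.+1 w - low n (T w).
have gE n w : g n w = Num.min (- low n (T w)) (h w).
  by rewrite /g /= addr_minl sub0r addrK.
have mg n : measurable_fun [set: Om] (EFin \o g n).
  apply/measurable_EFinP; apply: measurable_funB => //.
  exact: (measurableT_comp (measurable_low n) mT).
have ae_unbounded : {ae P, forall w, unbounded w}.
  exists (~` unbounded); split; last by [].
    exact: measurableC.
  rewrite probability_setC// PE1 subee//.
have cvg_g : {ae P, forall w, [set: Om] w -> (fun n => (g n w)%:E) @ \oo --> (h w)%:E}.
  apply: filterS ae_unbounded => w; rewrite -unbounded_T => wE _.
  apply: cvg_near_cst.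
  have [K hK] : exists K : nat, h w < K%:R.
    by exists (Num.bound `|h w|); apply: le_lt_trans (ler_norm _) _;
      exact: archi_boundP.
  have [N _ /= lowN] := wE K I.
  exists N => // n /= Nn; rewrite gE; congr _%:E; apply/min_idPr.
  have : low n (T w) <= orbit_sum h N (T w) by exact: low_le_sum.
  lra.
have dom : {ae P, forall w n, [set: Om] w -> (`|(g n w)%:E| <= (`|h w|)%:E)%E}.
  apply: nearW => w n _; rewrite lee_fin gE minEle.
  case: ifP => // le_h; have := low_le0 n (T w) => low0.
  rewrite ger0_norm ?oppr_ge0//; apply: le_trans (ler_norm _).
  exact: le_h.
have [_ _ cvg_int] := dominated_convergence measurableT mg
  (measurable_int _ ih) cvg_g (integrable_abse ih) dom.
apply: (cvge_to_le cvg_int); apply: nearW => n /=.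
rewrite integralB_EFin//; last exact: integrable_T.
rewrite integral_T//; last exact: integrable_T.
rewrite sube_le0; apply: le_integral => //.
- exact: (integrable_low n.+1).
- exact: (integrable_low n).
by move=> w _; rewrite lee_fin low_anti.
Qed.

Lemma orbit_sum_lower_bound : (0 < \int[P]_w (h w)%:E)%E ->
  {ae P, forall w, exists K : R, forall n, K <= orbit_sum h n w}.
Proof.
move=> /orbit_sum_bounded P0; exists unbounded; split => // w /= nK K _.
apply: contrapT => nE; apply: nK; exists (- K%:R) => n.
by rewrite leNgt; apply/negP => lt_K; apply: nE; exists n.
Qed.

End positive_integral.

Lemma integrable_shift (h : Om -> R) (a : R) : P.-integrable [set: Om] (EFin \o h) ->
  P.-integrable [set: Om] (EFin \o (fun w => h w - a)).
Proof.
move=> ih; rewrite (_ : _ \o _ = ((EFin \o h) \- cst a%:E)%E)//.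
by apply: integrableB => //; exact: finite_measure_integrable_cst.
Qed.

(** One half of Birkhoff's theorem; the other half follows with [- h]. Subtract
slightly less than the mean: the integral becomes positive, so that the orbit sums
are bounded from below, which is a linear lower bound for those of [h]. *)
Theorem birkhoff_lower (h : Om -> R) : P.-integrable [set: Om] (EFin \o h) ->
  {ae P, forall w, forall e : R, 0 < e ->
    \forall n \near \oo, n%:R * (fine (\int[P]_w (h w)%:E) - e) <= orbit_sum h n w}.
Proof.
move=> ih; set c := fine _.
have cE : (\int[P]_w (h w)%:E)%E = c%:E.
  by rewrite /c fineK//; exact: integrable_fin_num.
have ae_j (j : nat) : {ae P, forall w, exists K : R, forall n,
    K <= orbit_sum (fun w => h w - (c - (j.+1%:R)^-1)) n w}.
  apply: orbit_sum_lower_bound; first exact: integrable_shift.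
  under eq_integral do rewrite EFinB.
  rewrite integralB_EFin//; last exact: finite_measure_integrable_cst.
  rewrite cE integral_cst// [X in (_ * X)%E](_ : _ = 1%E); last exact: probability_setT.
  rewrite mule1 -EFinB lte_fin.
  by rewrite opprB addrCA subrr addr0 invr_gt0 ltr0n.
apply: filterS (ae_foralln ae_j) => w wK e e0.
have [j ej] : exists j : nat, (j.+1%:R : R)^-1 < e / 2.
  exists (Num.bound (2 / e)); rewrite invf_plt ?posrE ?divr_gt0 ?ltr0n// invf_div.
  apply: (lt_trans (archi_boundP _)); rewrite ?ltr_nat//.
  by rewrite divr_ge0// ltW.
have [K hK] := wK j.
pose M := Num.bound (`|K| / (e / 2)).
exists M => // n /= Mn.
have KM : `|K| <= n%:R * (e / 2).
  rewrite -ler_pdivrMr ?divr_gt0//; apply: ltW.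
  by apply: (lt_le_trans (archi_boundP _)); rewrite ?ler_nat// divr_ge0// ltW// divr_gt0.
have : orbit_sum (fun w => h w - (c - (j.+1%:R)^-1)) n w =
    orbit_sum h n w - n%:R * (c - (j.+1%:R)^-1).
  by rewrite /orbit_sum sumrB big_const_ord iter_addr_0 mulr_natl.
have := hK n; have := ler_norm (- K); rewrite normrN.
have : n%:R * (j.+1%:R)^-1 <= n%:R * (e / 2) :> R by rewrite ler_wpM2l// ltW.
move: KM; move: (j.+1%:R^-1) (n%:R : R) => a N.
by rewrite !mulrBr; lra.
Qed.

End birkhoff_theorem.

(** * Visits to sets of positive measure *)

Section frequency.
Context {d : measure_display} {Om : measurableType d} {R : realType}.
Variables (P : probability Om R) (T : Om -> Om).
Hypothesis mT : measurable_fun [set: Om] T.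
Hypothesis PT : forall A, measurable A -> P (T @^-1` A) = P A.
Hypothesis ergT : forall A, measurable A -> T @^-1` A = A ->
  P A = 0%E \/ P A = 1%E.

Lemma visits_linear (E : set Om) : measurable E -> (0 < P E)%E ->
  {ae P, forall w, \forall n \near \oo,
    n%:R * (fine (P E) / 2) <= (\sum_(0 <= i < n) `[< E (iter i T w) >])%:R :> R}.
Proof.
move=> mE PE; have iE : P.-integrable [set: Om] (EFin \o (\1_E : Om -> R)).
  exact: (integrable_indic P mE).
apply: filterS (birkhoff_lower mT PT ergT iE) => w.
have PE0 : 0 < fine (P E).
  by rewrite fine_gt0// PE (le_lt_trans (probability_le1 _ _))// ltry.
rewrite integral_indic// setIT => /(_ (fine (P E) / 2)).
rewrite divr_gt0// => /(_ isT); apply: filterS => n.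
rewrite (_ : fine (P E) - _ = fine (P E) / 2); last by lra.
move=> /le_trans; apply; rewrite /orbit_sum big_mkord natr_sum le_eqVlt.
apply/predU1P; left; apply: eq_bigr => i _; rewrite indicE.
by congr (nat_of_bool _)%:R; apply/idP/asboolP; rewrite inE.
Qed.

Lemma visits_recur (E : set Om) : measurable E -> (0 < P E)%E ->
  {ae P, forall w, forall N, exists2 n, (N <= n)%N & E (iter n T w)}.
Proof.
move=> mE PE; apply: filterS (visits_linear mE PE) => w [N0 _ freq] N.
have PE0 : 0 < fine (P E).
  by rewrite fine_gt0// PE (le_lt_trans (probability_le1 _ _))// ltry.
apply: contrapT => noE.
pose n := maxn N0 (Num.bound (N%:R / (fine (P E) / 2))).
have := freq n (leq_maxl _ _); apply/negP; rewrite -ltNge.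
apply: (@le_lt_trans _ _ N%:R).
  rewrite ler_nat; apply: (@leq_trans (minn n N)); last exact: geq_minr.
  elim: n => [|m IHm]; first by rewrite big_nil.
  rewrite big_nat_recr//=; case: asboolP => [Em|_]; last first.
    by rewrite addn0 (leq_trans IHm)// leq_min geq_minr (leq_trans (geq_minl _ _)).
  have mN : (m < N)%N by rewrite ltnNge; apply/negP => Nm; apply: noE; exists m.
  by rewrite (minn_idPl mN) addn1 ltnS (leq_trans IHm)// geq_minl.
rewrite -ltr_pdivrMr ?divr_gt0//; apply: lt_le_trans (archi_boundP _) _.
  by rewrite divr_ge0// ltW// divr_gt0.
by rewrite ler_nat leq_maxr.
Qed.

Lemma exhaustion (F : nat -> set Om) (e : R) : (forall n, measurable (F n)) ->
  {homo F : n m / (n <= m)%N >-> n `<=` m} -> (forall w, exists n, F n w) -> 0 < e ->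
  exists n, (P (~` F n) < e%:E)%E.
Proof.
move=> mF homoF covF e0.
have : P \o (fun n => ~` F n) @ \oo --> P (\bigcap_n ~` F n).
  apply: nonincreasing_cvg_mu.
  - by rewrite (le_lt_trans (probability_le1 _ _)) ?ltry//; exact: measurableC.
  - by move=> n; exact: measurableC.
  - by apply: bigcapT_measurable => n; exact: measurableC.
  - by move=> n m nm; apply/subsetPset/subsetC; exact: homoF.
rewrite (_ : \bigcap_n _ = set0); last first.
  by apply/seteqP; split=> // w wF; have [n /(wF n I)] := covF w.
rewrite measure0 => /fine_cvgP[_].
move=> /cvgrPdist_lt/(_ _ e0)[n _ /(_ n (leqnn n))].
rewrite /= sub0r normrN => lt_e; exists n.
rewrite -[X in (X < _)%E]fineK ?lte_fin; first exact: le_lt_trans (ler_norm _) lt_e.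
rewrite ge0_fin_numE ?measure_ge0//.
by rewrite (le_lt_trans (probability_le1 _ _)) ?ltry//; exact: measurableC.
Qed.

End frequency.

(** * Null sets of trajectories *)

Section null_sets.
Context {R : realType}.

(** All trajectories that begin with [u]; unlike [cylinder], this does not
depend on a fiber. *)
Definition prefix_set (u : seq nat) : set trajectories :=
  [set x : nat -> nat | forall i, (i < size u)%N -> x i = nth 0%N u i].

Lemma prefix_mkseq (x : nat -> nat) n : prefix_set (mkseq x n) x.
Proof. by move=> i; rewrite size_mkseq => ni; rewrite nth_mkseq. Qed.

Lemma prefix_set_take u (x : nat -> nat) n : prefix_set u x ->
  (n <= size u)%N -> mkseq x n = take n u.
Proof.
move=> ux nu; apply: (@eq_from_nth _ 0%N); rewrite size_mkseq ?size_takel//.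
by move=> i i_n; rewrite nth_mkseq// nth_take// ux//; exact: leq_trans nu.
Qed.

Lemma measurable_prefix_set u : measurable (prefix_set u).
Proof. by apply: sub_sigma_algebra; exists (size u), (nth 0%N u). Qed.

Definition prefix_open (U : set trajectories) :=
  forall x : nat -> nat, U x -> exists n, prefix_set (mkseq x n) `<=` U.

(** An open set is the disjoint union of the prefix sets of the minimal words, of
length at least [n], whose prefix sets it contains. *)
Definition minimal_words (n : nat) (U : set trajectories) : set (seq nat) :=
  [set u | [/\ (n <= size u)%N, prefix_set u `<=` U &
    forall k, (n <= k < size u)%N -> ~ (prefix_set (take k u) `<=` U)]].

(** An enumeration of the prefix sets of the words in [Wd], padded by [set0]. *)
Definition coded (Wd : set (seq nat)) (k : nat) : set trajectories :=
  if pickle_inv k is Some u then if `[< Wd u >] then prefix_set u else set0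
  else set0.

Lemma measurable_coded Wd k : measurable (coded Wd k).
Proof.
rewrite /coded; case: pickle_inv => [u|]; last exact: measurable0.
by case: asboolP => _; [exact: measurable_prefix_set|exact: measurable0].
Qed.

Lemma coded_pickle Wd u : Wd u -> coded Wd (pickle u) = prefix_set u.
Proof. by move=> Wu; rewrite /coded pickleK_inv asboolT. Qed.

Lemma bigcup_coded n U : prefix_open U ->
  \bigcup_k coded (minimal_words n U) k = U.
Proof.
move=> oU; apply/seteqP; split => [x [k _]|x Ux].
  rewrite /coded; case: pickle_inv => // u; case: asboolP => // -[_ uU _].
  exact: uU.
have ex_m : exists m, (n <= m)%N && `[< prefix_set (mkseq x m) `<=` U >].
  have [m mU] := oU x Ux; exists (maxn m n); rewrite leq_maxr/=.
  apply/asboolP => y yx; apply: mU => i; rewrite size_mkseq => im.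
  rewrite yx ?size_mkseq ?leq_max ?im// !nth_mkseq// leq_max im//.
case: (ex_minnP ex_m) => m /andP[nm /asboolP mU] min_m.
have Wm : minimal_words n U (mkseq x m).
  split=> //; rewrite ?size_mkseq// => k /andP[nk km].
  rewrite -(prefix_set_take (@prefix_mkseq x m)) ?size_mkseq ?(ltnW km)// => kU.
  by have := min_m k; rewrite nk asboolT// leqNgt km => /(_ isT).
exists (pickle (mkseq x m)) => //; rewrite coded_pickle//; exact: prefix_mkseq.
Qed.

Lemma trivIset_coded n U : trivIset [set: nat] (coded (minimal_words n U)).
Proof.
have size_le v v' (x : nat -> nat) : minimal_words n U v -> minimal_words n U v' ->
    prefix_set v x -> prefix_set v' x -> (size v <= size v')%N.
  move=> [_ _ min_v] [nv' v'U _] vx v'x; rewrite leqNgt; apply/negP => lt_vv'.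
  apply: (min_v (size v')); first by rewrite nv'.
  by rewrite -(prefix_set_take vx (ltnW lt_vv')) (prefix_set_take v'x)// take_size.
move=> k k' _ _ [x []]; rewrite /coded.
case kE: (pickle_inv k) => [u|//]; case k'E: (pickle_inv k') => [u'|//].
case: asboolP => // Wu ux; case: asboolP => // Wu' ux'.
have sE : size u = size u'.
  by apply/eqP; rewrite eqn_leq (size_le u u' x)//= (size_le u' u x).
have uu' : u = u'.
  rewrite -(take_size u) -(prefix_set_take ux (leqnn _)) sE.
  by rewrite (prefix_set_take ux' (leqnn _)) take_size.
have /= <- : oapp pickle k (pickle_inv k : option (seq nat)) = k.
  exact: (@pickle_invK (seq nat) k).
have /= <- : oapp pickle k' (pickle_inv k' : option (seq nat)) = k'.
  exact: (@pickle_invK (seq nat) k').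
by rewrite kE k'E uu'.
Qed.

Lemma measurable_prefix_open U : prefix_open U -> measurable U.
Proof.
move=> oU; rewrite -(bigcup_coded 0 oU); apply: bigcupT_measurable => k.
exact: measurable_coded.
Qed.

Lemma prefix_openI U V : prefix_open U -> prefix_open V -> prefix_open (U `&` V).
Proof.
move=> oU oV x [/oU[m mU] /oV[n nV]]; exists (maxn m n) => y yx.
split; [apply: mU|apply: nV] => i; rewrite size_mkseq => im;
  by rewrite yx ?size_mkseq ?leq_max ?im ?orbT// !nth_mkseq// leq_max im ?orbT.
Qed.

Lemma prefix_open_bigcup (I : Type) (U : I -> set trajectories) :
  (forall i, prefix_open (U i)) -> prefix_open (\bigcup_i U i).
Proof.
by move=> oU x [i _ /oU[n nU]]; exists n => y /nU Uy; exists i.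
Qed.

Variable mu : {measure set trajectories -> \bar R}.
Hypothesis mu_fin : (mu [set: trajectories] < +oo)%E.

Let mu_lty A : measurable A -> (mu A < +oo)%E.
Proof. by move=> mA; apply: le_lt_trans mu_fin; apply: le_measure; rewrite ?inE. Qed.

Lemma geometric_sum (e : R) :
  (\sum_(k <oo) (e / (2 ^ (k + 1))%:R)%:E = e%:E)%E.
Proof.
by rewrite (cvg_lim _ (@cvg_geometric_eseries_half R e 0))// expr0 divr1.
Qed.

(** The condition is symmetric in [A] and its complement, which makes these sets a
sigma-algebra. *)
Definition outer_regular : set (set trajectories) := [set A | forall e : R, 0 < e ->
  exists U V, [/\ prefix_open U, prefix_open V, A `<=` U, ~` A `<=` V &
    (mu (U `&` V) <= e%:E)%E]].

Lemma outer_regular_sigma_algebra : sigma_algebra [set: trajectories] outer_regular.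
Proof.
split.
- move=> e e0; exists set0, [set: trajectories]; split=> //.
    by move=> x _; exists 0%N.
  by rewrite set0I measure0 lee_fin ltW.
- move=> A rA e e0; have [U [V [oU oV AU AV UV]]] := rA e e0.
  exists V, U; split=> //; first by rewrite setTD.
    by rewrite setTD setCK.
  by rewrite setIC.
- move=> A rA e e0.
  have e2 k : 0 < e / 2 / (2 ^ (k + 1))%:R by rewrite !divr_gt0// ltr0n expn_gt0.
  have /choice[UV UVP] : forall k, exists UV : set trajectories * set trajectories,
      [/\ prefix_open UV.1, prefix_open UV.2, A k `<=` UV.1, ~` A k `<=` UV.2 &
      (mu (UV.1 `&` UV.2) <= (e / 2 / (2 ^ (k + 1))%:R)%:E)%E].
    by move=> k; have [U [V UVP]] := rA k _ (e2 k); exists (U, V).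
  pose U := \bigcup_k (UV k).1.
  have oU : prefix_open U.
    by apply: prefix_open_bigcup => k; have [] := UVP k.
  pose V n := \bigcap_(k in `I_n) (UV k).2.
  have VS n : V n.+1 = V n `&` (UV n).2.
    rewrite /V; apply/seteqP; split => x /=.
      by move=> xV; split=> [k /= kn|]; apply: xV => /=; rewrite ?ltnS// ltnW.
    by move=> [xV xn] k /=; rewrite ltnS leq_eqVlt => /predU1P[->//|]; exact: xV.
  have oV n : prefix_open (V n).
    elim: n => [|n IHn]; first by move=> x _; exists 0%N => y _ k.
    by rewrite VS; apply: prefix_openI => //; have [] := UVP n.
  pose D n := U `&` V n.
  have mD n : measurable (D n).
    by apply: measurable_prefix_open; exact: prefix_openI.
  have mDI : measurable (\bigcap_n D n) by exact: bigcapT_measurable.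
  have muD : (mu (\bigcap_n D n) <= (e / 2)%:E)%E.
    have mk k : measurable ((UV k).1 `&` (UV k).2).
      by apply: measurable_prefix_open; have [? ? _ _ _] := UVP k; exact: prefix_openI.
    apply: (le_trans (measure_sigma_subadditive mu mk mDI _)).
      move=> x xD; have [[k _ xU] _] := xD 0%N I; exists k => //; split=> //.
      by have [_ xV] := xD k.+1 I; apply: xV => /=.
    rewrite -(geometric_sum (e / 2)); apply: lee_nneseries => k _ //.
    by have [] := UVP k.
  have decrD : {homo D : n m / (n <= m)%N >-> (m <= n)%O}.
    move=> n m nm; apply/subsetPset; apply: setIS => x xV k /= kn; apply: xV => /=.
    exact: leq_trans nm.
  have := nonincreasing_cvg_mu (mu_lty (mD 0%N)) mD mDI decrD.
  have lt_e : (mu (\bigcap_n D n) < e%:E)%E.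
    by apply: (le_lt_trans muD); rewrite lte_fin; lra.
  move=> /(_ [set y | (y < e%:E)%E]) [|n _ /(_ n (leqnn n)) /= muDn].
    by apply: open_nbhs_nbhs; split=> //; exact: open_ereal_lt_ereal.
  exists U, (V n); split=> //.
  - by move=> x [k _ Ax]; exists k => //; have [_ _ + _ _] := UVP k; apply.
  - move=> x nAx k _; have [_ _ _ + _] := UVP k; apply => Ax.
    by apply: nAx; exists k.
  - exact: ltW.
Qed.

Lemma measurable_outer_regular (A : set trajectories) : measurable A -> outer_regular A.
Proof.
apply: smallest_sub; first exact: outer_regular_sigma_algebra.
move=> _ [n [u ->]] e e0; set C := [set x | _].
have CE (x : nat -> nat) k : (n <= k)%N -> forall y, prefix_set (mkseq x k) y ->
    forall i, (i < n)%N -> y i = x i.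
  move=> nk y yx i ni; rewrite yx ?size_mkseq ?nth_mkseq//; exact: leq_trans nk.
exists C, (~` C); split=> //.
- move=> x Cx; exists n => y yx i ni.
  by rewrite (CE x n (leqnn n) y yx i ni) Cx.
- move=> x nCx; exists n => y yx Cy; apply: nCx => i ni.
  by rewrite -(CE x n (leqnn n) y yx i ni) Cy.
- by rewrite setICr measure0 lee_fin ltW.
Qed.

(** Outer regularity, where the open set is cut into prefix sets of long words; the
Gibbs property will compare the mass of such sets before and after shifts. *)
Lemma null_set_cover (N : set trajectories) (n : nat) (e : R) :
  mu.-negligible N -> 0 < e ->
  exists Wd : set (seq nat), [/\ forall u, Wd u -> (n <= size u)%N,
    N `<=` \bigcup_k coded Wd k & (\sum_(k <oo) mu (coded Wd k) <= e%:E)%E].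
Proof.
move=> [B [mB B0 NB]] e0.
have [U [V [oU oV BU BV UVe]]] := measurable_outer_regular mB e0.
exists (minimal_words n U); split; first by move=> u [].
  by rewrite bigcup_coded//; exact: subset_trans BU.
rewrite -measure_semi_bigcup ?bigcup_coded//.
- rewrite (measureDI mu (B := V)); [|exact: measurable_prefix_open..].
  rewrite [X in (X + _)%E](_ : _ = 0%E) ?add0e//.
  apply: (subset_measure0 _ mB _ B0).
    by apply: measurableD; exact: measurable_prefix_open.
  by move=> x [_ nVx]; apply: contrapT => nBx; apply: nVx; exact: BV.
- by move=> k; exact: measurable_coded.
- exact: trivIset_coded.
- exact: measurable_prefix_open.
Qed.

End null_sets.

(** * Trajectories, words and fibers *)

Local Notation shift := Defs.shift.

Section trajectories.
Implicit Types (x y z : nat -> nat) (u v : seq nat).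

Definition prepend u z : nat -> nat :=
  fun i => if (i < size u)%N then nth 0%N u i else z (i - size u)%N.

Lemma iter_shift n x i : iter n shift x i = x (n + i)%N.
Proof. by elim: n x i => [|n IHn] x i //=; rewrite /shift IHn addnS. Qed.

Lemma shift_prepend u z : iter (size u) shift (prepend u z) = z.
Proof.
apply/funext => i; rewrite iter_shift /prepend.
by rewrite ltnNge leq_addr/= addKn.
Qed.

Lemma mkseq_prepend u z : mkseq (prepend u z) (size u) = u.
Proof.
apply: (@eq_from_nth _ 0%N); rewrite size_mkseq// => i iu.
by rewrite nth_mkseq// /prepend iu.
Qed.

Lemma prepend_mkseq x n : prepend (mkseq x n) (iter n shift x) = x.
Proof.
apply/funext => i; rewrite /prepend size_mkseq; case: ltnP => ni.
  by rewrite nth_mkseq.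
by rewrite iter_shift subnKC.
Qed.

Lemma prepend_rcons u j z : prepend (rcons u j) z = prepend u (prepend [:: j] z).
Proof.
apply/funext => i; rewrite /prepend size_rcons nth_rcons ltnS leq_eqVlt /=.
case: ltngtP => //= [iu|->]; last by rewrite subnn.
by rewrite ltnNge subn_gt0 iu/= subnS -subn1 -subnDA addn1 subnS.
Qed.

Lemma mkseq_cat x m n : mkseq x (m + n) = mkseq x m ++ mkseq (iter m shift x) n.
Proof.
rewrite /mkseq iotaD map_cat add0n; congr (_ ++ _).
rewrite -[in LHS](addn0 m) iotaDl -map_comp.
by apply: eq_map => i /=; rewrite iter_shift.
Qed.

Lemma prefix_setP u x : prefix_set u x <-> mkseq x (size u) = u.
Proof.
split=> [ux|<-]; last by move=> i; rewrite size_mkseq => im; rewrite nth_mkseq.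
by rewrite (prefix_set_take ux)// take_size.
Qed.

End trajectories.

Section fibers.
Context {d : measure_display} {Om : measurableType d} {R : realType}.
Context {P : probability Om R} (f : random_shift P).
Implicit Types (w : Om) (x y z : nat -> nat) (u v : seq nat).

Lemma base_iterD m n w : base_iter f (m + n) w = base_iter f n (base_iter f m w).
Proof. by rewrite /base_iter addnC iterD. Qed.

Lemma cylinderE w u x : cylinder f w u x <-> fiber f w x /\ mkseq x (size u) = u.
Proof. by rewrite /cylinder/= -prefix_setP. Qed.

Lemma fiber_shift n w x : fiber f w x -> fiber f (base_iter f n w) (iter n shift x).
Proof. by move=> wx i; rewrite -base_iterD !iter_shift addnS. Qed.

(** Admissibility only concerns pairs of consecutive letters. *)
Lemma fiber_glue w x z n : fiber f w x -> fiber f (base_iter f n w) z ->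
  x n = z 0%N -> fiber f w (prepend (mkseq x n) z).
Proof.
move=> wx wz xz i; rewrite /prepend size_mkseq.
case: (ltnP i n) => ni; last first.
  have := wz (i - n)%N; rewrite -base_iterD subnKC// => -[? ?].
  by rewrite ltnNge leqW//= subSn.
rewrite nth_mkseq//; case: (ltnP i.+1 n) => ni1; first by rewrite nth_mkseq//; exact: wx.
have iE : i.+1 = n by apply/eqP; rewrite eqn_leq ni ni1.
by rewrite iE subnn -xz -iE; exact: wx.
Qed.

Lemma measurable_fiber w : measurable (fiber f w : set trajectories).
Proof.
rewrite [X in measurable X](_ : _ = \bigcap_(n : nat)
  \bigcup_k (if pickle_inv k is Some u then
     if (size u == n.+2) && `[< alphabet f (base_iter f n w) (nth 0%N u n) /\
        trans f (base_iter f n w) (nth 0%N u n) (nth 0%N u n.+1) >]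
     then prefix_set u else set0 else set0)); last first.
  apply/seteqP; split => [x wx n _|x xP i].
    exists (pickle (mkseq x n.+2)) => //.
    rewrite pickleK_inv size_mkseq eqxx !nth_mkseq//= asboolT//.
    exact: prefix_mkseq.
  have [k _] := xP i I; case: pickle_inv => // u; case: ifP => //.
  move=> /andP[/eqP su /asboolP].
  by move=> + ux; rewrite -!ux// su.
apply: bigcapT_measurable => n; apply: bigcupT_measurable => k.
case: pickle_inv => [u|]; last exact: measurable0.
by case: ifP => _; [exact: measurable_prefix_set|exact: measurable0].
Qed.

Lemma cylinder_fiberI w u :
  cylinder f w u = (fiber f w : set trajectories) `&` prefix_set u.
Proof. by []. Qed.

Lemma measurable_cylinder w u : measurable (cylinder f w u : set trajectories).
Proof.
rewrite cylinder_fiberI; apply: measurableI; first exact: measurable_fiber.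
exact: measurable_prefix_set.
Qed.

Lemma birkhoffD (phi : Om -> (nat -> nat) -> R) m n w x :
  birkhoff f phi (m + n) w x =
  birkhoff f phi m w x + birkhoff f phi n (base_iter f m w) (iter m shift x).
Proof.
rewrite /birkhoff big_split_ord/=; congr (_ + _); apply: eq_bigr => i _.
by rewrite base_iterD addnC iterD.
Qed.

Lemma cocycleD (lambda : Om -> R) m n w :
  cocycle f lambda (m + n) w =
  cocycle f lambda m w * cocycle f lambda n (base_iter f m w).
Proof.
rewrite /cocycle big_split_ord/=; congr (_ * _); apply: eq_bigr => i _.
by rewrite base_iterD.
Qed.

End fibers.

(** * The tree of words of a Gibbs measure *)

Section gibbs_tree.
Context {d : measure_display} {Om : measurableType d} {R : realType}.
Context {P : probability Om R} (f : random_shift P).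
Variables (phi : Om -> (nat -> nat) -> R).
Variables (mu : R.-pker Om ~> trajectories) (lambda C : Om -> R).
Implicit Types (w : Om) (x y z : nat -> nat) (u v : seq nat).

Definition alphabet_size w : nat := odflt 0%N (bound f w).

Definition potential_bound w : R :=
  fine (sup_norm f w (fun x => (phi w x)%:E)).

(** The conditions are imposed at all times of the forward orbit, so that they
are inherited by later environments. *)
Definition regular_env w : Prop := forall n, let w' := base_iter f n w in
  [/\ (exists m, bound f w' = Some m), mu w' (fiber f w') = 1%E,
      (sup_norm f w' (fun x => (phi w' x)%:E) < +oo)%E &
      forall x k, fiber f w' x -> (1 <= k)%N ->
        (C w')^-1 <= cocycle f lambda k w' *
          fine (mu w' (cylinder f w' (mkseq x k))) *
          expR (- birkhoff f phi k w' x) <= C w'].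

Hypothesis lambda_gt0 : forall w, 0 < lambda w.
Hypothesis C_gt0 : forall w, 0 < C w.

Definition word_prob w u : R := fine (mu w (cylinder f w u)).

Lemma regular_env_base_iter n w : regular_env w -> regular_env (base_iter f n w).
Proof. by move=> rw m; have := rw (n + m)%N; rewrite base_iterD. Qed.

Lemma alphabet_regular w : regular_env w -> forall n j,
  alphabet f (base_iter f n w) j <-> (j < alphabet_size (base_iter f n w))%N.
Proof.
by move=> rw n j; have [[m wm] _ _ _] := rw n; rewrite /alphabet/alphabet_size/= wm.
Qed.

Lemma cocycle_gt0 n w : 0 < cocycle f lambda n w.
Proof. by apply: prodr_gt0 => i _; exact: lambda_gt0. Qed.

Lemma prob_lty w (A : set trajectories) : measurable A -> (mu w A < +oo)%E.
Proof.
move=> mA; apply: (@le_lt_trans _ _ (mu w [set: trajectories])).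
  by apply: le_measure; rewrite ?inE.
by rewrite prob_kernel ltry.
Qed.

Lemma word_probE w u : (word_prob w u)%:E = mu w (cylinder f w u).
Proof.
rewrite fineK// ge0_fin_numE; last exact: measure_ge0.
by apply: prob_lty; exact: measurable_cylinder.
Qed.

Lemma word_prob_ge0 w u : 0 <= word_prob w u.
Proof. by rewrite fine_ge0. Qed.

Lemma cylinder_nil w : cylinder f w [::] = fiber f w.
Proof. by apply/seteqP; split => x => [[]|]. Qed.

Lemma word_prob_nil w : regular_env w -> word_prob w [::] = 1.
Proof.
by move=> rw; have [_ w1 _ _] := rw 0%N; rewrite /word_prob cylinder_nil w1.
Qed.

Lemma word_prob_sum w : regular_env w -> forall u, word_prob w u =
  \sum_(j <- iota 0 (alphabet_size (base_iter f (size u) w))) word_prob w (rcons u j).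
Proof.
move=> rw u; apply: EFin_inj; rewrite -sumEFin word_probE.
under eq_bigr do rewrite word_probE.
set K := alphabet_size _.
have cylS (x : nat -> nat) j : cylinder f w (rcons u j) x <->
    cylinder f w u x /\ x (size u) = j.
  rewrite !cylinderE size_rcons -addn1 mkseq_cat cats1/= iter_shift addn0.
  split=> [[wx /rcons_inj[? ?]]|[[wx ux] xj]]; first by [].
  by split; rewrite // ux xj.
have -> : iota 0 K = index_iota 0 K by rewrite /index_iota subn0.
rewrite big_mkord.
transitivity (mu w (\big[setU/set0]_(j < K)
    (cylinder f w (rcons u j) : set trajectories))).
  congr (mu w _); rewrite -(bigcup_mkord K (fun j => cylinder f w (rcons u j) : set trajectories)); apply/seteqP; split => [x ux|x].
    exists (x (size u)); last by apply/cylS.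
    by rewrite /= -alphabet_regular//; have [/(_ (size u))[]] := ux.
  by move=> -[j _ /cylS[]].
apply: (@measure_bigsetU _ _ _ (mu w)
  (fun j => cylinder f w (rcons u j) : set trajectories)).
  by move=> j; exact: measurable_cylinder.
by move=> i j _ _ [x []] /cylS[_ <-] /cylS[_ <-].
Qed.

Lemma C_ge1 w : regular_env w -> 1 <= C w.
Proof.
move=> rw; have [_ w1 _ Cw] := rw 0%N.
have [x wx] : exists x, fiber f w x.
  apply: contrapT => /forallNP nx.
  have : mu w (fiber f w) = 0%E.
    by rewrite (_ : fiber f w = set0) ?measure0//; apply/seteqP; split => // x /nx.
  by rewrite w1 => /eqP; rewrite onee_eq0.
have /andP[C1 C2] := Cw x 1%N wx (leqnn 1).
rewrite leNgt; apply/negP => C_lt1.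
have := le_trans C1 C2; apply/negP; rewrite -ltNge.
by apply: (lt_trans C_lt1); rewrite invf_gt1.
Qed.

Lemma gibbs_le w x n : regular_env w -> fiber f w x ->
  word_prob w (mkseq x n) <=
    C w / cocycle f lambda n w * expR (birkhoff f phi n w x).
Proof.
move=> rw wx; case: n => [|n].
  by rewrite /cocycle /birkhoff !big_ord0 expR0 divr1 mulr1 word_prob_nil// C_ge1.
have [_ _ _ Cw] := rw 0%N; have /andP[_] := Cw x n.+1 wx isT.
rewrite expRN -ler_pdivlMr ?invr_gt0 ?expR_gt0// invrK mulrC -ler_pdivlMr ?cocycle_gt0//.
by rewrite mulrAC.
Qed.

Lemma gibbs_ge w x n : regular_env w -> fiber f w x ->
  (C w)^-1 / cocycle f lambda n w * expR (birkhoff f phi n w x) <=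
    word_prob w (mkseq x n).
Proof.
move=> rw wx; case: n => [|n].
  rewrite /cocycle /birkhoff !big_ord0 expR0 divr1 mulr1 word_prob_nil//.
  by rewrite invf_le1// C_ge1.
have [_ _ _ Cw] := rw 0%N; have /andP[+ _] := Cw x n.+1 wx isT.
rewrite expRN -ler_pdivrMr ?invr_gt0 ?expR_gt0// invrK mulrC => le_p.
by rewrite mulrAC ler_pdivrMr ?cocycle_gt0// mulrC [leRHS]mulrC.
Qed.

Lemma word_prob_gt0 w x n : regular_env w -> fiber f w x ->
  0 < word_prob w (mkseq x n).
Proof.
move=> rw wx; apply: lt_le_trans (gibbs_ge n rw wx).
by rewrite !mulr_gt0 ?invr_gt0 ?expR_gt0 ?cocycle_gt0.
Qed.

Lemma word_prob_gt0_ex w u : 0 < word_prob w u ->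
  exists2 x, fiber f w x & mkseq x (size u) = u.
Proof.
move=> pu; have [[x /cylinderE[wx ux]]|] := pselect (cylinder f w u !=set0).
  by exists x.
move=> /set0P/negP; rewrite negbK => /eqP u0.
by move: pu; rewrite /word_prob u0 measure0 ltxx.
Qed.

Lemma potential_le w x : regular_env w -> fiber f w x ->
  `|phi w x| <= potential_bound w.
Proof.
move=> rw wx; have [_ _ fin _] := rw 0%N.
rewrite -lee_fin fineK; first by apply: ereal_sup_ubound; exists x.
rewrite ge0_fin_numE//; apply: (@le_trans _ _ (`|phi w x|)%:E); first by rewrite lee_fin.
by apply: ereal_sup_ubound; exists x.
Qed.

Lemma birkhoff_le w x n : regular_env w -> fiber f w x ->
  `|birkhoff f phi n w x| <= \sum_(i < n) potential_bound (base_iter f i w).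
Proof.
move=> rw wx; apply: (le_trans (ler_norm_sum _ _ _)); apply: ler_sum => i _.
apply: potential_le; first exact: regular_env_base_iter.
exact: fiber_shift.
Qed.

(** The past enters the Gibbs weight of a longer word only through a factor that
cancels in conditional probabilities; what remains is the Gibbs constant of the
initial environment, whatever the length of the past. *)
Lemma gibbs_past w : regular_env w -> forall u u' a v, size u = size u' ->
  0 < word_prob w (rcons u a) -> 0 < word_prob w (rcons u' a) ->
  word_prob w (rcons u a ++ v) / word_prob w (rcons u a) <=
    C w ^+ 4 * (word_prob w (rcons u' a ++ v) / word_prob w (rcons u' a)).
Proof.
move=> rw u u' a v su pu pu'.
have [pv0|pv] := eqVneq (word_prob w (rcons u a ++ v)) 0.
  rewrite pv0 mul0r mulr_ge0 ?exprn_ge0 ?(ltW (C_gt0 _))//.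
  by rewrite divr_ge0 ?word_prob_ge0.
have {pv} /word_prob_gt0_ex[x wx ux] : 0 < word_prob w (rcons u a ++ v).
  by rewrite lt_def pv word_prob_ge0.
have [x' wx' ux'] := word_prob_gt0_ex pu'.
pose s := size u; pose m := size v.
have sE : size (rcons u a ++ v) = (s.+1 + m)%N by rewrite size_cat size_rcons.
have s'E : size (rcons u' a) = s.+1 by rewrite size_rcons -su.
rewrite sE mkseq_cat in ux; rewrite s'E in ux'.
have [xu xv] : mkseq x s.+1 = rcons u a /\ mkseq (iter s.+1 shift x) m = v.
  by move/eqP: ux; rewrite eqseq_cat ?size_mkseq ?size_rcons// => /andP[/eqP -> /eqP ->].
have xa : x s = a.
  by rewrite -[LHS](nth_mkseq 0%N x (n := s.+1))// xu nth_rcons ltnn eqxx.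
have xa' : x' s = a.
  by rewrite -[LHS](nth_mkseq 0%N x' (n := s.+1))// ux' nth_rcons -su ltnn eqxx.
pose y := prepend (mkseq x' s) (iter s shift x).
have wy : fiber f w y.
  apply: fiber_glue => //; first exact: fiber_shift.
  by rewrite iter_shift addn0 xa xa'.
have ys : mkseq y s.+1 = rcons u' a.
  rewrite -ux'; apply: (@eq_from_nth _ 0%N); rewrite !size_mkseq// => i iS.
  rewrite !nth_mkseq// /y /prepend size_mkseq; case: ltnP => si.
    by rewrite nth_mkseq.
  have -> : i = s by apply/eqP; rewrite eqn_leq si -ltnS iS.
  by rewrite subnn iter_shift addn0 xa xa'.
have ysh : iter s.+1 shift y = iter s.+1 shift x.
  have := shift_prepend (mkseq x' s) (iter s shift x).
  by rewrite size_mkseq -/y /= => ->.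
have yE : mkseq y (s.+1 + m) = rcons u' a ++ v by rewrite mkseq_cat ys ysh xv.
have xE : mkseq x (s.+1 + m) = rcons u a ++ v by rewrite mkseq_cat ux.
have := gibbs_le (s.+1 + m) rw wx; have := gibbs_ge s.+1 rw wx.
have := gibbs_ge (s.+1 + m) rw wy; have := gibbs_le s.+1 rw wy.
rewrite xE yE xu ys !birkhoffD ysh !expRD cocycleD.
have c0 := C_gt0 w.
have := cocycle_gt0 s.+1 w; have := cocycle_gt0 m (base_iter f s.+1 w).
have := expR_gt0 (birkhoff f phi s.+1 w x).
have := expR_gt0 (birkhoff f phi s.+1 w y).
have := expR_gt0 (birkhoff f phi m (base_iter f s.+1 w) (iter s.+1 shift x)).
move: (expR _) (expR _) (expR _) (cocycle _ _ s.+1 _) (cocycle _ _ m _).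
move=> ex ey e L1 L2 e0 ey0 ex0 L20 L10.
move: pu pu'; move: (word_prob _ _) (word_prob _ _) (word_prob _ _) (word_prob _ _).
move=> p2 p2' p1' p1 p10 p10' le_p1' ge_p2' ge_p1 le_p2.
have step1 : p2 / p1 <= C w ^+ 2 / L2 * e.
  rewrite ler_pdivrMr//; apply: (le_trans le_p2).
  apply: (@le_trans _ _ (C w ^+ 2 / L2 * e * ((C w)^-1 / L1 * ex))).
    by rewrite le_eqVlt; apply/predU1P; left; field; rewrite !gt_eqF.
  by rewrite ler_pM2l// !mulr_gt0 ?invr_gt0 ?exprn_gt0.
have step2 : (C w ^+ 2)^-1 / L2 * e <= p2' / p1'.
  rewrite ler_pdivlMr//; apply: le_trans ge_p2'.
  apply: (@le_trans _ _ ((C w ^+ 2)^-1 / L2 * e * (C w / L1 * ey))).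
    by rewrite ler_pM2l// !mulr_gt0 ?invr_gt0 ?exprn_gt0.
  by rewrite le_eqVlt; apply/predU1P; left; field; rewrite !gt_eqF.
apply: (le_trans step1).
apply: (@le_trans _ _ (C w ^+ 4 * ((C w ^+ 2)^-1 / L2 * e))).
  by rewrite le_eqVlt; apply/predU1P; left; field; rewrite !gt_eqF.
by rewrite ler_pM2l ?exprn_gt0.
Qed.

End gibbs_tree.

(** * Iterated transfer operators *)

Section roots.
Context {R : realType}.

Lemma sqrte_le (X : \bar R) (c : R) : (0 <= X)%E -> 0 <= c ->
  (X `^ 2^-1 <= c%:E)%E = (X <= (c ^+ 2)%:E)%E.
Proof.
case: X => [r| |//]; last first.
  by move=> _ _; rewrite poweRyr// ?invr_eq0// !leye_eq.
rewrite lee_fin poweR_EFin => r0 c0; rewrite powR12_sqrt// !lee_fin.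
by rewrite -{2}(sqr_sqrtr r0) ler_pXn2r// nnegrE.
Qed.

Lemma sqrte_ge (X : \bar R) (c : R) : (0 <= X)%E -> 0 <= c ->
  ((c ^+ 2)%:E <= X)%E -> (c%:E <= X `^ 2^-1)%E.
Proof.
case: X => [r| |//]; last first.
  by move=> _ _ _; rewrite poweRyr// ?invr_eq0// leey.
rewrite lee_fin poweR_EFin => r0 c0; rewrite powR12_sqrt// !lee_fin.
by rewrite -{1}(sqr_sqrtr r0) ler_pXn2r// nnegrE.
Qed.

End roots.

Section adjoint.
Context {R : realType} {G : groupType}.

Lemma sqnorm_sum_lty (I : Type) (s : seq I) (v : I -> G -> R) :
  (forall i, (sqnorm (v i) < +oo)%E) ->
  (sqnorm (fun g => (\sum_(i <- s) v i g)%R) < +oo)%E.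
Proof.
move=> vfin; elim: s => [|i s IHs].
  rewrite (_ : sqnorm _ = 0%E)//; apply: esum1 => g _.
  by rewrite big_nil expr0n.
under eq_fun do rewrite big_cons.
set t := fun g => \sum_(j <- s) v j g in IHs *.
apply: (le_lt_trans (sqnorm_triangle (fun g => v i g + t g) (v i) ltr01)).
have -> : (fun g => v i g + t g - v i g) = t.
  by apply/funext => g; rewrite addrAC subrr add0r.
by rewrite lte_add_pinfty// lte_mul_pinfty.
Qed.

(** A sum of translations has the same norm as its adjoint, which translates by
the inverses. *)
Lemma sqnorm_adjoint (I : choiceType) (s : seq I) (c : I -> R) (h : I -> G) (r : R) :
  (forall i, 0 <= c i) -> 0 < r ->
  (forall b : G -> R, (forall g, 0 <= b g) -> (sqnorm b < +oo)%E ->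
    (sqnorm (fun g => (\sum_(i <- s) c i * b (g * h i)%g)%R) <= r%:E * sqnorm b)%E) ->
  forall b : G -> R, (forall g, 0 <= b g) -> (sqnorm b < +oo)%E ->
    (sqnorm (fun g => (\sum_(i <- s) c i * b (g * (h i)^-1)%g)%R) <= r%:E * sqnorm b)%E.
Proof.
move=> c0 r0 norm_le b b0 bfin.
set a := fun g => \sum_(i <- s) c i * b (g * (h i)^-1)%g.
pose a' := fun g => \sum_(i <- s) c i * a (g * h i)%g.
have a0 g : 0 <= a g by apply: sumr_ge0 => i _; rewrite mulr_ge0.
have afin : (sqnorm a < +oo)%E.
  apply: (@sqnorm_sum_lty I s (fun i g => c i * b (g * (h i)^-1)%g)) => i.
  rewrite sqnormZ lte_mul_pinfty ?lee_fin ?sqr_ge0//.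
  by rewrite (sqnorm_rtrans (h i)^-1%g b).
have a'_le : (sqnorm a' <= r%:E * sqnorm a)%E := norm_le a a0 afin.
have aE : sqnorm a = (\esum_(g in [set: G]) (a' g * b g)%:E)%E.
  transitivity (\sum_(i <- s) \esum_(g in [set: G])
      (c i * (a g * b (g * (h i)^-1)%g))%:E)%E.
    rewrite -esum_sum; last by move=> g i _ _; rewrite lee_fin !mulr_ge0.
    apply: eq_esum => g _; rewrite sumEFin; congr _%:E.
    by rewrite expr2 {2}/a mulr_sumr; apply: eq_bigr => i _; rewrite mulrCA.
  transitivity (\sum_(i <- s) \esum_(g in [set: G])
      (c i * (a (g * h i)%g * b g))%:E)%E; last first.
    rewrite -esum_sum; last by move=> g i _ _; rewrite lee_fin !mulr_ge0.
    apply: eq_esum => g _; rewrite sumEFin; congr _%:E.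
    by rewrite /a' mulr_suml; apply: eq_bigr => i _; rewrite mulrA.
  apply: eq_bigr => i _.
  rewrite (reindex_esum [set: G] [set: G] (fun g => g * h i)%g)//.
    by apply: eq_esum => g _; rewrite mulgK.
  split => //; first by move=> x y _ _ /mulIg.
  by move=> y _; exists (y * (h i)^-1)%g => //; rewrite mulgVK.
have : (sqnorm a <= (2^-1)%:E * sqnorm a + (r / 2)%:E * sqnorm b)%E.
  rewrite [X in (X <= _)%E]aE.
  apply: (@le_trans _ _ ((r^-1 / 2)%:E * sqnorm a' + (r / 2)%:E * sqnorm b)%E).
    rewrite /sqnorm -!esumZl ?divr_ge0 ?invr_ge0 ?(ltW r0)//;
      try by move=> g _; rewrite lee_fin sqr_ge0.
    rewrite -esumD; try by move=> g _; rewrite -EFinM lee_fin mulr_ge0 ?sqr_ge0//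
      divr_ge0 ?invr_ge0 ?(ltW r0).
    apply: le_esum => g _; rewrite -!EFinM -EFinD lee_fin -subr_ge0.
    have -> : r^-1 / 2 * a' g ^+ 2 + r / 2 * b g ^+ 2 - a' g * b g =
        r^-1 / 2 * (a' g - r * b g) ^+ 2 by field; rewrite gt_eqF.
    by apply: mulr_ge0; [rewrite divr_ge0 ?invr_ge0 ?(ltW r0)|exact: sqr_ge0].
  rewrite leeD2r//.
  apply: (@le_trans _ _ ((r^-1 / 2)%:E * (r%:E * sqnorm a))%E).
    by rewrite lee_wpmul2l// lee_fin divr_ge0 ?invr_ge0 ?(ltW r0).
  by rewrite muleA -EFinM mulrAC mulVf ?gt_eqF// mul1r.
move: afin bfin; case: (sqnorm a) (sqnorm_ge0 a) => // x x0 _.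
case: (sqnorm b) (sqnorm_ge0 b) => // y y0 _.
by rewrite -!EFinM -EFinD !lee_fin; lra.
Qed.

End adjoint.

Section transfer.
Context {d : measure_display} {Om : measurableType d} {R : realType}.
Context {P : probability Om R} (f : random_shift P).
Context {G : groupType} (psi : (nat -> nat) -> G).
Variables (phi : Om -> (nat -> nat) -> R).
Variables (mu : R.-pker Om ~> trajectories) (lambda C : Om -> R).
Implicit Types (w : Om) (x y z : nat -> nat) (u v : seq nat).
Hypothesis psi0 : forall x y, x 0%N = y 0%N -> psi x = psi y.
Hypothesis lambda_gt0 : forall w, 0 < lambda w.
Hypothesis C_gt0 : forall w, 0 < C w.

(** [psi] as a function of the first coordinate. *)
Definition psi_letter (j : nat) : G := psi (fun=> j).

Definition env_words w : nat -> nat -> seq (seq nat) :=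
  tree_words (fun n => alphabet_size f (base_iter f n w)).

Lemma group_cocycle_word_value u :
  group_cocycle_word psi u = word_value psi_letter u.
Proof.
rewrite /group_cocycle_word; elim: u => [|j u IHu] //=.
rewrite -IHu; congr (_ * _)%g; exact: psi0.
Qed.

Lemma rsum_seq (I : choiceType) (s : seq I) (h : I -> R) : uniq s ->
  rsum [set` s] h = \sum_(i <- s) h i.
Proof.
move=> us.
have esumE (a : I -> R) : (forall i, 0 <= a i) ->
    (\esum_(i in [set` s]) (a i)%:E)%E = (\sum_(i <- s) a i)%:E.
  move=> a0; rewrite (esum_fset (finite_seq s)); last by move=> i _; rewrite lee_fin.
  by rewrite -(fsbig_seq _ _ us) sumEFin.
rewrite /rsum !esumE; try by move=> i; rewrite le_max lexx orbT.
rewrite -sumrB; apply: eq_bigr => i _.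
by case: (leP (h i) 0) => hi; case: (leP (- h i) 0) => hi' //; lra.
Qed.

(** The alphabets of a regular environment are finite, so the sums [rsum] are
finite and the iterated operator unfolds into one sum over words. *)
Lemma ext_transfer_iterE w n (v : (nat -> nat) -> G -> R) x g :
  regular_env f phi mu lambda C w -> fiber f (base_iter f n w) x ->
  ext_transfer_iter f psi phi w n v x g =
  \sum_(u <- env_words w 0 n | `[< fiber f w (prepend u x) >])
    expR (birkhoff f phi n w (prepend u x)) *
    v (prepend u x) (g * (word_value psi_letter u)^-1)%g.
Proof.
move=> rw; elim: n x g => [|n IHn] x g wx.
  have nilx : prepend [::] x = x by apply/funext => i; rewrite /prepend subn0.
  rewrite /env_words/= big_mkcond/= big_seq1 nilx asboolT//.
  by rewrite /birkhoff big_ord0 expR0 mul1r invg1 mulg1.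
pose wn := base_iter f n w.
pose s := [seq prepend [:: j] x | j <- iota 0 (alphabet_size f wn)
  & `[< fiber f wn (prepend [:: j] x) >]].
have us : uniq s.
  rewrite map_inj_uniq ?filter_uniq ?iota_uniq// => i j /(congr1 (@^~ 0%N)).
  by rewrite /prepend.
have preE : preimages f wn x = [set` s].
  apply/seteqP; split => y /=.
    move=> [wy yx]; have yE : y = prepend [:: y 0%N] x.
      by rewrite -yx -[LHS](prepend_mkseq y 1).
    apply/mapP; exists (y 0%N) => //; rewrite mem_filter mem_iota add0n -yE.
    rewrite asboolT//=.
    by apply/(alphabet_regular rw); have [] := wy 0%N.
  move=> /mapP[j]; rewrite mem_filter => /andP[/asboolP wj _] ->.
  by split => //; exact: (shift_prepend [:: j] x).
rewrite [LHS](_ : _ =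
  ext_transfer f psi phi wn (ext_transfer_iter f psi phi w n v) x g)//.
rewrite /ext_transfer preE rsum_seq// /s big_map big_filter big_mkcond.
rewrite [RHS]big_mkcond -addn1 /env_words sum_tree_words_cat exchange_big.
rewrite sum_tree_words1 add0n -/wn; apply: eq_bigr => j _.
under [RHS]eq_bigr do rewrite cats1 prepend_rcons addn1.
have [jx|njx] := asboolP (fiber f wn (prepend [:: j] x)); last first.
  rewrite big_seq big1// => u /size_tree_words un; case: asboolP => // wu; exfalso.
  by apply: njx; have := fiber_shift (size u) wu; rewrite shift_prepend un.
rewrite IHn// mulr_sumr [LHS]big_mkcond big_seq [RHS]big_seq.
apply: eq_bigr => u /size_tree_words un; case: asboolP => // _.
have sh : iter n shift (prepend u (prepend [:: j] x)) = prepend [:: j] x.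
  by rewrite -un shift_prepend.
rewrite -[in RHS](addn1 n) birkhoffD -/wn sh expRD mulrA.
rewrite -[rcons u j]cats1 word_value_cat/= mulg1 invgM mulgA.
have -> : psi (prepend [:: j] x) = psi_letter j by exact: psi0.
congr (_ * _); rewrite mulrC; congr (_ * expR _).
by rewrite /birkhoff big_ord1.
Qed.

End transfer.

(** * Norms of the iterated transfer operators *)

Section operator_norm.
Context {d : measure_display} {Om : measurableType d} {R : realType}.
Context {P : probability Om R} (f : random_shift P).
Context {G : groupType} (psi : (nat -> nat) -> G).
Variables (phi : Om -> (nat -> nat) -> R).
Variables (mu : R.-pker Om ~> trajectories) (lambda C : Om -> R).
Implicit Types (w : Om) (x y z : nat -> nat) (u : seq nat).
Hypothesis psi0 : forall x y, x 0%N = y 0%N -> psi x = psi y.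
Hypothesis lambda_gt0 : forall w, 0 < lambda w.
Hypothesis C_gt0 : forall w, 0 < C w.

Local Notation regular := (regular_env f phi mu lambda C).
Local Notation prob := (word_prob f mu).
Local Notation Lam := (cocycle f lambda).

(** The Gibbs property compares a cylinder with its image, so the shift maps null
sets to null sets; hence an essential bound on a function is a bound at almost
every point that enters its image under the transfer operator. *)
Lemma null_image w n (N : set trajectories) : regular w ->
  (mu w).-negligible N ->
  (mu (base_iter f n w)).-negligible
    [set x : trajectories | fiber f (base_iter f n w) x /\
      exists u, [/\ size u = n, fiber f w (prepend u x) & N (prepend u x)]].
Proof.
move=> rw N0; set wn := base_iter f n w.
have rwn : regular wn by exact: regular_env_base_iter.
pose S := \sum_(i < n) potential_bound f phi (base_iter f i w).
pose K := C wn * C w * Lam n w * expR S.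
have K0 : 0 < K by rewrite !mulr_gt0 ?expR_gt0 ?cocycle_gt0.
have image_le u : (n.+1 <= size u)%N -> cylinder f w u !=set0 ->
    (mu wn (cylinder f wn (drop n u)) <= K%:E * mu w (prefix_set u))%E.
  move=> nu [y /cylinderE[wy yu]].
  apply: (@le_trans _ _ (K%:E * mu w (cylinder f w u))%E); last first.
    rewrite lee_wpmul2l ?lee_fin ?(ltW K0)//; apply: le_measure; rewrite ?inE.
    - exact: measurable_cylinder.
    - exact: measurable_prefix_set.
    - by rewrite cylinder_fiberI; exact: subIsetr.
  rewrite -!word_probE -EFinM lee_fin.
  pose q := (size u - n)%N.
  have nq : (n + q)%N = size u by rewrite subnKC// ltnW.
  have yd : mkseq (iter n shift y) q = drop n u.
    by rewrite -yu -nq mkseq_cat drop_size_cat// size_mkseq.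
  have := gibbs_le lambda_gt0 C_gt0 q rwn (fiber_shift n wy).
  have := gibbs_ge lambda_gt0 C_gt0 (n + q) rw wy.
  rewrite yd nq yu -nq birkhoffD cocycleD expRD -/wn => ge_p le_p.
  apply: (le_trans le_p).
  have S_le : (expR (birkhoff f phi n w y))^-1 <= expR S.
    rewrite -expRN ler_expR; apply: le_trans (birkhoff_le n rw wy).
    by rewrite -normrN ler_norm.
  have L1 := cocycle_gt0 f lambda_gt0 n w; have L2 := cocycle_gt0 f lambda_gt0 q wn.
  have c1 := C_gt0 w; have c2 := C_gt0 wn.
  have e1 := expR_gt0 (birkhoff f phi n w y).
  have e2 := expR_gt0 (birkhoff f phi q wn (iter n shift y)).
  apply: (@le_trans _ _ (C wn * C w * Lam n w * (expR (birkhoff f phi n w y))^-1 *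
      prob w u)).
    rewrite -ler_pdivrMl; last by rewrite !mulr_gt0// invr_gt0.
    apply: le_trans ge_p; rewrite le_eqVlt; apply/predU1P; left.
    by field; rewrite !gt_eqF.
  apply: ler_wpM2r; first exact: word_prob_ge0.
  by rewrite ler_pM2l// !mulr_gt0.
pose image (Wd : set (seq nat)) (k : nat) : set trajectories :=
  if pickle_inv k is Some u then
    if `[< Wd u /\ cylinder f w u !=set0 >] then cylinder f wn (drop n u) else set0
  else set0.
have m_image Wd k : measurable (image Wd k).
  rewrite /image; case: pickle_inv => [u|]; last exact: measurable0.
  by case: ifP => _; [exact: measurable_cylinder|exact: measurable0].
have e0 (m : nat) : 0 < (m.+1%:R : R)^-1 by rewrite invr_gt0 ltr0n.
have /choice[Wd WdP] := fun m : nat => null_set_cover (prob_lty mu w measurableT)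
  n.+1 N0 (e0 m).
pose S' m := \bigcup_k image (Wd m) k.
have mS' m : measurable (S' m) by exact: bigcupT_measurable.
exists (\bigcap_m S' m); split.
- exact: bigcapT_measurable.
- have muS' m : (mu wn (S' m) <= (K / m.+1%:R)%:E)%E.
    have [sizeWd _ massWd] := WdP m.
    apply: (le_trans (measure_sigma_subadditive (mu wn) (m_image (Wd m)) (mS' m) _)).
      by [].
    apply: (@le_trans _ _ (\sum_(k <oo) (K%:E * mu w (coded (Wd m) k)))%E).
      apply: lee_nneseries => [k _ _|k _]; first exact: measure_ge0.
      rewrite /image /coded; case: pickle_inv => [u|]; last by rewrite !measure0 mule0.
      case: asboolP => [[Wu cu]|_]; last first.
        by rewrite measure0 mule_ge0 ?lee_fin ?(ltW K0)//; exact: measure_ge0.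
      by rewrite asboolT//; apply: image_le => //; exact: sizeWd.
    rewrite nneseriesZl ?lee_fin; last by move=> k _; exact: measure_ge0.
    by rewrite (EFinM K) lee_wpmul2l ?lee_fin ?(ltW K0).
  apply/eqP; rewrite eq_le measure_ge0 andbT; apply/lee_addgt0Pr => e e_gt0.
  have [m Km] : exists m : nat, K / m.+1%:R <= e.
    exists (Num.bound (K / e)); rewrite ler_pdivrMr ?ltr0n// mulrC -ler_pdivrMr//.
    apply: ltW; apply: (lt_trans (archi_boundP _)); rewrite ?ltr_nat//.
    by rewrite divr_ge0// ltW.
  rewrite add0e; apply: (@le_trans _ _ (mu wn (S' m))).
    apply: le_measure; rewrite ?inE//; first exact: bigcapT_measurable.
    by move=> x xS; exact: xS.
  by apply: (le_trans (muS' m)); rewrite lee_fin.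
- move=> x [wx [u [su wux Nux]]] m _.
  have [sizeWd coverWd _] := WdP m.
  have [k _] := coverWd _ Nux; rewrite /coded.
  case kE: (pickle_inv k) => [t|//]; case: asboolP => // Wt tux.
  exists k => //; rewrite /image kE asboolT; last first.
    by split=> //; exists (prepend u x).
  apply/cylinderE; split=> //; rewrite size_drop.
  have nt : (n <= size t)%N by apply: ltnW; exact: sizeWd.
  move/prefix_setP : tux; rewrite -{1}(subnKC nt) mkseq_cat => tE.
  have sh : iter n shift (prepend u x) = x by rewrite -su shift_prepend.
  by rewrite -[in RHS]tE drop_size_cat ?size_mkseq// sh.
Qed.

Section upper_bound.
Hypothesis countG : countable [set: G].

Let Linf w (v : (nat -> nat) -> G -> R) g : \bar R :=
  ('N[mu w]_+oo[(fun x : trajectories => (v x g)%:E)])%E.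

Lemma LnormyE w (h : trajectories -> \bar R) :
  ('N[mu w]_+oo[h])%E = ess_sup (mu w) (abse \o h).
Proof. by rewrite unlock /= prob_kernel lte01. Qed.

Lemma HnormE w v : Hnorm mu w v = ((\esum_(g in [set: G]) (Linf w v g ^+ 2)) `^ 2^-1)%E.
Proof. by []. Qed.

Lemma Linf_ge0 w v g : (0 <= Linf w v g)%E.
Proof. exact: Lnorm_ge0. Qed.

Lemma esum_Linf_ge0 w v : (0 <= \esum_(g in [set: G]) (Linf w v g ^+ 2))%E.
Proof. by apply: esum_ge0 => g _; rewrite expe_ge0// Linf_ge0. Qed.

(** With [b g] the essential bound on the vector at [g], the Gibbs property bounds
the image by [C w * Lam n w] times the average of the translates of [b], by the
inverses of the values of the words. The average in [branch] translates by the
values themselves, and is its adjoint. *)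
Lemma Hopnorm_le w n (r : R) : regular w -> 0 < r ->
  (forall b : G -> R, (forall g, 0 <= b g) -> (sqnorm b < +oo)%E ->
    (sqnorm (branch (psi_letter psi)
       (fun m => alphabet_size f (base_iter f m w)) (prob w) b n [::]) <=
     (r ^+ 2)%:E * sqnorm b)%E) ->
  (Hopnorm f psi phi mu w n <= (C w * Lam n w * r)%:E)%E.
Proof.
move=> rw r0 tree_le; apply: ge_ereal_sup => _ [v [_ v1] <-].
set wn := base_iter f n w.
have c0 : 0 < C w * Lam n w by rewrite mulr_gt0 ?cocycle_gt0.
pose b g := fine (Linf w v g).
have sum1 : (\esum_(g in [set: G]) (Linf w v g ^+ 2) <= 1)%E.
  by move: v1; rewrite HnormE sqrte_le ?esum_Linf_ge0// expr1n.
have LinfE g : Linf w v g = (b g)%:E.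
  rewrite fineK// ge0_fin_numE ?Linf_ge0//.
  have : (Linf w v g ^+ 2 <= 1)%E.
    apply: le_trans sum1; apply: esum_ge; exists [set g].
      by split => //; exact: finite_set1.
    by rewrite fsbig_set1.
  case: (Linf w v g) => [t|//|//]; first by rewrite ltry.
have b0 g : 0 <= b g by rewrite fine_ge0 ?Linf_ge0.
have sqb : (sqnorm b <= 1)%E.
  apply: le_trans sum1; apply: le_esum => g _.
  by rewrite LinfE EFin_expe.
have bfin : (sqnorm b < +oo)%E by exact: le_lt_trans sqb (ltry _).
pose F g := \sum_(u <- env_words f w 0 n)
  prob w u * b (g * (word_value (psi_letter psi) u)^-1)%g.
have sqF : (sqnorm F <= (r ^+ 2)%:E)%E.
  apply: (@le_trans _ _ ((r ^+ 2)%:E * sqnorm b)%E); last first.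
    by rewrite -[leRHS]mule1 lee_wpmul2l// lee_fin sqr_ge0.
  apply: sqnorm_adjoint => //.
  - by move=> u; exact: word_prob_ge0.
  - by rewrite exprn_gt0.
  move=> b' b'0 b'fin; apply: le_trans (tree_le b' b'0 b'fin).
  rewrite le_eqVlt; apply/predU1P; left; congr sqnorm; apply/funext => g.
  by rewrite /branch; apply: eq_bigr => u _; rewrite (word_prob_nil rw) divr1.
have F0 g : 0 <= F g.
  by apply: sumr_ge0 => u _; apply: mulr_ge0; [exact: word_prob_ge0|exact: b0].
have ae_v : {ae mu w, forall y : trajectories, forall g, `|v y g| <= b g}.
  have /countable_injP[i injI] := countG.
  have ae_k k : {ae mu w, forall y : trajectories, forall g, i g = k -> `|v y g| <= b g}.
    have [[g gk]|nog] := pselect (exists g, i g = k); last first.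
      by apply: nearW => y g gk; exfalso; apply: nog; exists g.
    have := ess_sup_ge (mu w) (abse \o (fun x : trajectories => (v x g)%:E)).
    rewrite -LnormyE -/(Linf w v g) LinfE; apply: filterS => y /= vy g' g'k.
    have -> : g' = g by apply: injI; rewrite ?inE// g'k.
    by rewrite -lee_fin.
  apply: filterS (ae_foralln ae_k) => y vy g; exact: vy.
have ae_Lv : {ae mu wn, forall x : trajectories, forall g,
    `|ext_transfer_iter f psi phi w n v x g| <= C w * Lam n w * F g}.
  have null_bad := null_image n rw ae_v.
  have ae_fiber : {ae mu wn, forall x : trajectories, fiber f wn x}.
    exists (~` (fiber f wn : set trajectories)); split => //.
      by apply: measurableC; exact: measurable_fiber.
    have [_ fib1 _ _] := rw n.
    have mfib := measurable_fiber f wn.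
    have : mu wn [set: trajectories] = (mu wn (fiber f wn) + mu wn (~` (fiber f wn : set trajectories)))%E.
      rewrite -measureU ?setUv ?setICr//; exact: measurableC.
    rewrite prob_kernel fib1.
    case: (mu wn (~` (fiber f wn : set trajectories))) => [t|//|//].
    by rewrite -EFinD => -[] t0; congr _%:E; lra.
  have ae_good : {ae mu wn, forall x : trajectories, ~ (fiber f wn x /\
      exists u, [/\ size u = n, fiber f w (prepend u x) &
        ~ (forall g, `|v (prepend u x) g| <= b g)])}.
    move: null_bad; apply: negligibleS => x /=; exact: contrapT.
  apply: negligibleS (negligibleU ae_fiber ae_good) => x /= bad_x.
  apply: contrapT => /not_orP[/contrapT wx /contrapT good]; apply: bad_x => g.
  rewrite (ext_transfer_iterE psi0 _ _ rw wx).
  apply: (le_trans (ler_norm_sum _ _ _)).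
  rewrite big_mkcond /F mulr_sumr big_seq [leRHS]big_seq; apply: ler_sum => u un.
  have su := size_tree_words un.
  have pb0 h : 0 <= C w * Lam n w * (prob w u * b h).
    apply: mulr_ge0; first exact: ltW.
    by apply: mulr_ge0; [exact: word_prob_ge0|exact: b0].
  case: asboolP => // wux; rewrite normrM ger0_norm ?expR_ge0// mulrA.
  apply: ler_pM => //.
    have := gibbs_ge lambda_gt0 C_gt0 n rw wux.
    rewrite -{3}su mkseq_prepend => ge_p.
    rewrite -ler_pdivrMl//; apply: le_trans ge_p; rewrite invfM//.
  apply: contrapT => /negP; rewrite -ltNge => lt_b; apply: good; split=> //.
  exists u; split => // all_le.
  by have := all_le (g * (word_value (psi_letter psi) u)^-1)%g; rewrite leNgt lt_b.
have Linf_le g : (Linf wn (ext_transfer_iter f psi phi w n v) g <=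
    (C w * Lam n w * F g)%:E)%E.
  rewrite /Linf LnormyE; apply/ess_supP; apply: filterS ae_Lv => x /(_ g) le_F.
  by rewrite /= lee_fin.
have CF0 g : 0 <= C w * Lam n w * F g by rewrite mulr_ge0 ?(ltW c0).
rewrite HnormE sqrte_le ?esum_Linf_ge0//; last by rewrite mulr_ge0 ?(ltW c0) ?(ltW r0).
apply: (@le_trans _ _ (sqnorm (fun g => C w * Lam n w * F g))).
  apply: le_esum => g _; move: (Linf_le g) (Linf_ge0 wn (ext_transfer_iter f psi phi w n v) g).
  case: (Linf _ _ _) => [t| |]//; rewrite !lee_fin => t_le t0.
  by rewrite -expr2 ler_pXn2r// nnegrE.
by rewrite sqnormZ (exprMn _ _ r) (EFinM (_ ^+ 2)) lee_wpmul2l// lee_fin sqr_ge0.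
Qed.

End upper_bound.

End operator_norm.

Section lower_bound.
Context {d : measure_display} {Om : measurableType d} {R : realType}.
Context {P : probability Om R} (f : random_shift P).
Context {G : groupType} (psi : (nat -> nat) -> G).
Variables (phi : Om -> (nat -> nat) -> R).
Variables (mu : R.-pker Om ~> trajectories) (lambda C : Om -> R).
Implicit Types (w : Om) (x y z : nat -> nat) (u : seq nat).
Hypothesis psi0 : forall x y, x 0%N = y 0%N -> psi x = psi y.
Hypothesis lambda_gt0 : forall w, 0 < lambda w.
Hypothesis C_gt0 : forall w, 0 < C w.

Local Notation regular := (regular_env f phi mu lambda C).
Local Notation prob := (word_prob f mu).
Local Notation Lam := (cocycle f lambda).

Lemma ess_sup_ge_on (m : {measure set trajectories -> \bar R})
    (A : set trajectories) (h : trajectories -> \bar R) (c : \bar R) :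
  measurable A -> (0 < m A)%E -> (forall x, A x -> (c <= h x)%E) ->
  (c <= ess_sup m h)%E.
Proof.
move=> mA A0 ch; rewrite leNgt; apply/negP => lt_c.
have [B [mB B0 hB]] := ess_sup_ge m h.
move: A0; rewrite (subset_measure0 mA mB _ B0) ?ltxx// => x Ax.
apply: hB => /= hx; have := le_lt_trans (le_trans (ch x Ax) hx) lt_c.
by rewrite ltxx.
Qed.

Lemma word_prob_rcons_le w u b : regular w -> prob w (rcons u b) <= prob w u.
Proof.
move=> rw; rewrite -lee_fin !word_probE; apply: le_measure; rewrite ?inE.
- exact: measurable_cylinder.
- exact: measurable_cylinder.
- move=> x [wx ux]; split=> // i iu.
  by rewrite ux ?size_rcons ?ltnS ?(ltnW iu)// nth_rcons iu.
Qed.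

(** On an almost invariant vector the operator acts almost like multiplication by
its total mass, which is at least [(C w)^-1 * Lam n w] times the probability of
some letter at time [n]. *)
Lemma Hopnorm_ge w n : regular w -> almost_invariant R G ->
  (((C w)^-1 * Lam n w / (4 * (alphabet_size f (base_iter f n w))%:R))%:E <=
    Hopnorm f psi phi mu w n)%E.
Proof.
move=> rw ai; set wn := base_iter f n w; set ell := alphabet_size f wn.
have rwn : regular wn by exact: regular_env_base_iter.
pose W := env_words f w 0 n.
have sumW : \sum_(b <- iota 0 ell) \sum_(u <- W) prob w (rcons u b) = 1.
  rewrite exchange_big/= -(word_prob_nil rw).
  rewrite -(sum_tree_words (l := fun m => alphabet_size f (base_iter f m w))
    (word_prob_sum rw) [::] n).
  rewrite /W big_seq [RHS]big_seq; apply: eq_bigr => u un.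
  by rewrite [RHS](word_prob_sum rw) (size_tree_words un).
have ell0 : (0 < ell)%N.
  rewrite lt0n; apply/eqP => ell0; move: sumW; rewrite ell0 big_nil => /eqP.
  by rewrite eq_sym oner_eq0.
have ellR : 0 < ell%:R :> R by rewrite ltr0n.
have [b bQ] : exists b, (2 * ell%:R)^-1 <= \sum_(u <- W) prob w (rcons u b).
  apply: contrapT => /forallNP small.
  suff : \sum_(b <- iota 0 ell) \sum_(u <- W) prob w (rcons u b) <= 2^-1.
    by rewrite sumW; lra.
  apply: (@le_trans _ _ (\sum_(b <- iota 0 ell) (2 * ell%:R)^-1)).
    by apply: ler_sum => b _; have /negP := small b; rewrite -ltNge => /ltW.
  rewrite big_const_seq iter_addr_0 count_predT size_iota.
  suff -> : (2 * ell%:R)^-1 *+ ell = 2^-1 :> R by [].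
  by rewrite -[LHS]mulr_natr; field; rewrite gt_eqF.
set Q := \sum_(u <- W) _ in bQ.
have Q0 : 0 < Q by apply: lt_le_trans bQ; rewrite invr_gt0 mulr_gt0.
(* a normalized, nonnegative, almost invariant vector *)
have [w0 [w0_ge0 sqw0 inv_w0]] : exists w0 : G -> R, [/\ forall g, 0 <= w0 g,
    sqnorm w0 = 1%E & forall u, u \in W ->
    (sqnorm (fun g => (w0 g - w0 (g * (word_value (psi_letter psi) u)^-1)%g)%R) <=
      (4^-1)%:E)%E].
  have q0 : 0 < 4^-1 :> R by rewrite invr_gt0.
  have [v [v0 vfin vinv]] :=
    ai [seq ((word_value (psi_letter psi) u)^-1)%g | u <- W] _ q0.
  have vE : sqnorm v = (fine (sqnorm v))%:E.
    by rewrite fineK// ge0_fin_numE// ltW.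
  set s := fine (sqnorm v) in vE.
  have s0 : 0 < s by move: v0; rewrite vE lte_fin.
  have sE : ((Num.sqrt s)^-1 ^+ 2) = s^-1 by rewrite exprVn sqr_sqrtr// ltW.
  exists (fun g => (Num.sqrt s)^-1 * `|v g|); split.
  - by move=> g; rewrite mulr_ge0// invr_ge0 sqrtr_ge0.
  - by rewrite sqnormZ sqnorm_normr vE sE -EFinM mulVf ?gt_eqF.
  - move=> u uW.
    under [X in sqnorm X]eq_fun do rewrite -mulrBr.
    rewrite sqnormZ sE.
    apply: (@le_trans _ _ ((s^-1)%:E * ((4^-1)%:E * sqnorm v))%E).
      rewrite lee_wpmul2l ?lee_fin ?invr_ge0 ?(ltW s0)//.
      apply: le_trans (vinv _ (map_f _ uW)); apply: le_sqnorm => g.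
      by rewrite distrC; apply: ler_dist_dist.
    by rewrite vE -!EFinM lee_fin mulrCA mulVf ?gt_eqF// mulr1.
pose v (x : nat -> nat) (g : G) := w0 g.
have Hv : Hnorm mu w v = 1%E.
  rewrite HnormE.
  have -> : (\esum_(g in [set: G])
      ('N[mu w]_+oo[(fun x : trajectories => (v x g)%:E)] ^+ 2) = sqnorm w0)%E.
    apply: eq_esum => g _; rewrite LnormyE.
    rewrite (_ : abse \o _ = cst (w0 g)%:E); last first.
      by apply/funext => x /=; rewrite ger0_norm.
    by rewrite ess_sup_cst ?EFin_expe// prob_kernel lte01.
  by rewrite sqw0 poweR_EFin powR1.
have HSv : Hspace f mu w v.
  split; last by rewrite Hv ltry.
  by move=> g; exact: measurable_cst.
pose F g := \sum_(u <- W) prob w (rcons u b) *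
  w0 (g * (word_value (psi_letter psi) u)^-1)%g.
have F0 g : 0 <= F g.
  by apply: sumr_ge0 => u _; rewrite mulr_ge0// word_prob_ge0.
have sqF : (((Q / 2) ^+ 2)%:E <= sqnorm F)%E.
  have wt_ge0 u : 0 <= prob w (rcons u b) / Q.
    by rewrite divr_ge0 ?word_prob_ge0// ltW.
  have wt_sum : \sum_(u <- W) prob w (rcons u b) / Q = 1.
    by rewrite -mulr_suml divff// gt_eqF.
  have near_F : (sqnorm (fun g => (Q * w0 g - F g)%R) <= (Q ^+ 2 / 4)%:E)%E.
    have -> : (fun g => Q * w0 g - F g) = (fun g => Q * \sum_(u <- W)
        prob w (rcons u b) / Q *
        (w0 g - w0 (g * (word_value (psi_letter psi) u)^-1)%g)).
      apply/funext => g; rewrite mulr_sumr {1}/Q mulr_suml -sumrB.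
      apply: eq_bigr => u _; rewrite mulrA mulrCA divff ?gt_eqF// mulr1.
      by rewrite mulrBr.
    rewrite sqnormZ (EFinM (Q ^+ 2)) lee_wpmul2l ?lee_fin ?sqr_ge0//.
    apply: (le_trans (sqnorm_sum_le (fun u g => w0 g -
      w0 (g * (word_value (psi_letter psi) u)^-1)%g) wt_ge0 wt_sum)).
    have -> : (4^-1 : R) = \sum_(u <- W) prob w (rcons u b) / Q * 4^-1.
      by rewrite -mulr_suml wt_sum mul1r.
    rewrite -sumEFin big_seq [leRHS]big_seq; apply: lee_sum => u uW.
    by rewrite (EFinM (_ / Q)) lee_wpmul2l ?lee_fin ?wt_ge0// inv_w0.
  have := sqnorm_triangle (fun g => Q * w0 g) F ltr01.
  rewrite sqnormZ sqw0 mule1; move: near_F.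
  case: (sqnorm F) (sqnorm_ge0 F) => [t| |]//; last by move=> *; rewrite leey.
  case: (sqnorm (fun g => Q * w0 g - F g)) (sqnorm_ge0 (fun g => Q * w0 g - F g)) => // q.
  rewrite -!EFinM -!EFinD !lee_fin invr1 => q0 t0 q_le tri.
  have -> : (Q / 2) ^+ 2 = Q ^+ 2 / 4 by field.
  by move: q_le tri; move: (Q ^+ 2) => Q2; lra.
have [u0 u0W u0b] : exists2 u, u \in W & 0 < prob w (rcons u b).
  apply: contrapT => /forall2NP none; move: Q0; apply/negP; rewrite -leNgt.
  rewrite /Q big_seq; apply: sumr_le0 => u uW.
  by case: (none u) => // /negP; rewrite -leNgt.
have cyl0 : (0 < mu wn (cylinder f wn [:: b]))%E.
  rewrite -word_probE lte_fin.
  have [z wz zE] := word_prob_gt0_ex u0b.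
  have := word_prob_gt0 lambda_gt0 C_gt0 1 rwn (fiber_shift n wz).
  rewrite /mkseq/= iter_shift addn0.
  suff -> : z n = b by [].
  have su := size_tree_words u0W.
  have := nth_mkseq 0%N z (ltnSn n); rewrite -{1}su -(size_rcons u0 b) zE.
  by rewrite nth_rcons su ltnn eqxx.
have Lv_ge (x : nat -> nat) g : cylinder f wn [:: b] x ->
    (C w)^-1 * Lam n w * F g <= ext_transfer_iter f psi phi w n v x g.
  move=> /cylinderE[wx [xb]].
  rewrite (ext_transfer_iterE psi0 _ _ rw wx) /F mulr_sumr [leRHS]big_mkcond.
  rewrite -/W big_seq [leRHS]big_seq; apply: ler_sum => u uW.
  have su := size_tree_words uW.
  have [p0|p0] := eqVneq (prob w (rcons u b)) 0.
    rewrite p0 mul0r mulr0; case: ifP => // _.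
    by rewrite mulr_ge0 ?expR_ge0.
  have {p0} [z wz zE] : exists2 z, fiber f w z & mkseq z (size (rcons u b)) = rcons u b.
    by apply: (word_prob_gt0_ex (mu := mu)); rewrite lt_def p0 word_prob_ge0.
  move: zE; rewrite size_rcons su -addn1 mkseq_cat cats1 /mkseq/= iter_shift addn0.
  move=> /rcons_inj[zu zb].
  have wux : fiber f w (prepend u x).
    by rewrite -zu; apply: fiber_glue; rewrite // zb xb.
  rewrite asboolT// mulrA ler_wpM2r//.
  have := gibbs_le lambda_gt0 C_gt0 n rw wux.
  have -> : mkseq (prepend u x) n = u by rewrite -su mkseq_prepend.
  have c0 := C_gt0 w; have L0 := cocycle_gt0 f lambda_gt0 n w.
  move=> /(le_trans (word_prob_rcons_le u b rw)) le_p.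
  apply: (@le_trans _ _ ((C w)^-1 * Lam n w * (C w / Lam n w *
      expR (birkhoff f phi n w (prepend u x))))).
    by apply: ler_wpM2l le_p; rewrite mulr_ge0 ?invr_ge0 ?(ltW c0) ?(ltW L0).
  by rewrite le_eqVlt; apply/predU1P; left; field; rewrite !gt_eqF.
have CL0 : 0 < (C w)^-1 * Lam n w by rewrite mulr_gt0 ?invr_gt0 ?cocycle_gt0.
apply: (@le_trans _ _ (Hnorm mu wn (ext_transfer_iter f psi phi w n v))); last first.
  by apply: ereal_sup_ubound; exists v => //; split; rewrite // Hv.
apply: (@le_trans _ _ ((C w)^-1 * Lam n w * (Q / 2))%:E).
  rewrite lee_fin; apply: ler_wpM2l; first exact: ltW.
  have -> : (4 * ell%:R)^-1 = (2 * ell%:R)^-1 / 2 :> R by field; rewrite gt_eqF.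
  by rewrite ler_pM2r ?invr_gt0.
rewrite HnormE; apply: sqrte_ge; first by apply: esum_Linf_ge0.
  by rewrite mulr_ge0 ?(ltW CL0)// divr_ge0// ltW.
apply: (@le_trans _ _ (sqnorm (fun g => (C w)^-1 * Lam n w * F g))).
  by rewrite sqnormZ exprMn (EFinM (_ ^+ 2)) lee_wpmul2l// lee_fin sqr_ge0.
apply: le_esum => g _.
have : (((C w)^-1 * Lam n w * F g)%:E <= 'N[mu wn]_+oo[(fun x : trajectories =>
    (ext_transfer_iter f psi phi w n v x g)%:E)])%E.
  rewrite LnormyE; apply: (ess_sup_ge_on (measurable_cylinder f wn [:: b]) cyl0).
  by move=> x bx; rewrite lee_fin; apply: le_trans (ler_norm _); exact: Lv_ge.
have CF0 : 0 <= (C w)^-1 * Lam n w * F g by rewrite mulr_ge0 ?(ltW CL0).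
case: ('N[_]_+oo[_])%E => [t|_|//]; last by rewrite /= leey.
by rewrite !lee_fin => le_t; rewrite -expr2 ler_pXn2r ?nnegrE// (le_trans CF0).
Qed.

End lower_bound.

(** * Decay of the norms over a group without almost invariant vectors *)

Section decay.
Context {d : measure_display} {Om : measurableType d} {R : realType}.
Context {P : probability Om R} (f : random_shift P).
Context {G : groupType} (psi : (nat -> nat) -> G).
Variables (phi : Om -> (nat -> nat) -> R).
Variables (mu : R.-pker Om ~> trajectories) (lambda C : Om -> R).
Implicit Types (w : Om) (x y z : nat -> nat) (u t : seq nat).
Hypothesis psi0 : forall x y, x 0%N = y 0%N -> psi x = psi y.
Hypothesis lambda_gt0 : forall w, 0 < lambda w.
Hypothesis C_gt0 : forall w, 0 < C w.

Local Notation regular := (regular_env f phi mu lambda C).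
Local Notation prob := (word_prob f mu).
Local Notation Lam := (cocycle f lambda).
Local Notation sizes w := (fun m => alphabet_size f (base_iter f m w)).

(** What topological mixing of the extension provides for the elements of [H], at
one time. *)
Definition spelling_env (H : seq G) (N : nat) w : Prop :=
  forall a c h, cylinder f w [:: a] !=set0 ->
  cylinder f (base_iter f N w) [:: c] !=set0 -> h \in H ->
  exists u, [/\ words f N w u, cylinder f w u `<=` cylinder f w [:: a],
    cylinder f (base_iter f N w) [:: c] `<=` iter N shift @` cylinder f w u &
    group_cocycle_word psi u = h].

(** The inverse of this is a lower bound, up to Gibbs constants, for the
conditional probability of a block of length [k]. *)
Definition block_cost (k : nat) w : R :=
  Lam k w * expR (\sum_(i < k) potential_bound f phi (base_iter f i w)).

Definition good_env (H : seq G) (N : nat) (B : R) w : bool :=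
  `[< spelling_env H N w /\ block_cost N.+1 w <= B >].

Lemma block_cost_gt0 k w : 0 < block_cost k w.
Proof. by rewrite mulr_gt0 ?expR_gt0 ?cocycle_gt0. Qed.

(** A word that spells [h] is inserted between the given past and the last letter
of the block, by gluing trajectories. The Gibbs property bounds its probability
from below; the last letter is the common right factor. *)
Lemma gibbs_rich_block (H : seq G) (N : nat) (eta : R) w (u : seq nat) :
  regular w -> spelling_env H N (base_iter f (size u) w) ->
  eta <= (C w ^+ 2 * block_cost N.+1 (base_iter f (size u) w))^-1 ->
  0 < prob w u ->
  rich_block (psi_letter psi) (sizes w) (prob w) H eta N.+1 u.
Proof.
move=> rw; set s := size u; set ws := base_iter f s w => spell le_eta pu v vk puv.
have rws : regular ws by exact: regular_env_base_iter.
have sv := size_tree_words vk.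
have [z wz] := word_prob_gt0_ex puv.
rewrite size_cat sv -/s mkseq_cat => /eqP; rewrite eqseq_cat ?size_mkseq//.
move=> /andP[/eqP zu /eqP zv].
pose zs := iter s shift z; have wzs : fiber f ws zs by exact: fiber_shift.
have last_v : last 0%N v = zs N by rewrite -zv mkseqS last_rcons.
pose T := iter N shift zs.
have wT : fiber f (base_iter f N ws) T by exact: fiber_shift.
have cylT : cylinder f (base_iter f N ws) [:: zs N] T.
  by apply/cylinderE; split=> //; rewrite /mkseq/= /T iter_shift addn0.
have cyl_zs : cylinder f ws [:: zs 0%N] zs by apply/cylinderE.
have /choice[t tP] h : exists t, h \in H -> [/\ words f N ws t,
    cylinder f ws t `<=` cylinder f ws [:: zs 0%N],
    cylinder f (base_iter f N ws) [:: zs N] `<=` iter N shift @` cylinder f ws t &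
    group_cocycle_word psi t = h].
  have [hH|] := boolP (h \in H); last by exists [::].
  have [t tP] := spell (zs 0%N) (zs N) h (ex_intro _ _ cyl_zs)
    (ex_intro _ _ cylT) hH.
  by exists t.
exists (psi_letter psi (zs N)), (fun h => rcons (t h) (zs N)) => h hH.
have [[st _ _] t_a t_c t_h] := tP h hH.
have [y /[dup] yt /cylinderE[wy]] := t_c T cylT.
rewrite st => y_t yT.
have ya : y 0%N = z s.
  have /cylinderE[_ [->]] := t_a y yt.
  by rewrite /zs iter_shift addn0.
pose Y := prepend (mkseq z s) y.
have wY : fiber f w Y by apply: fiber_glue.
have Ys : mkseq Y s = u.
  by rewrite -zu -[in LHS](size_mkseq z s) mkseq_prepend.
have Ysh : iter s shift Y = y.
  by rewrite -[in LHS](size_mkseq z s) shift_prepend.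
have yN : mkseq y N.+1 = rcons (t h) (zs N).
  rewrite mkseqS y_t; congr rcons.
  by have := congr1 (@^~ 0%N) yT; rewrite /T !iter_shift !addn0.
have YE : mkseq Y (s + N.+1) = u ++ rcons (t h) (zs N).
  by rewrite mkseq_cat Ys Ysh yN.
split.
- rewrite mem_tree_words -yN size_mkseq eqxx andTb; apply/allP => i.
  rewrite mem_iota add0n => /andP[_ iN]; rewrite nth_mkseq//.
  by rewrite -/s base_iterD; apply/(alphabet_regular rws); have [] := wy i.
- by rewrite last_rcons last_v.
- by rewrite -cats1 word_value_cat -(group_cocycle_word_value psi0) t_h/= mulg1.
have := gibbs_ge lambda_gt0 C_gt0 (s + N.+1) rw wY.
have := gibbs_le lambda_gt0 C_gt0 s rw wY.
rewrite YE Ys birkhoffD cocycleD Ysh expRD -/ws => pu_le ge_p.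
have := birkhoff_le N.+1 rws wy.
set S := \sum_(i < N.+1) _ => S_ge.
have {}S_ge : expR (- S) <= expR (birkhoff f phi N.+1 ws y).
  rewrite ler_expR; have := ler_norm (- birkhoff f phi N.+1 ws y); rewrite normrN.
  by move: S_ge; lra.
have c0 := C_gt0 w; have L1 := cocycle_gt0 f lambda_gt0 s w.
have L2 := cocycle_gt0 f lambda_gt0 N.+1 ws.
have e1 := expR_gt0 (birkhoff f phi s w Y).
have e2 := expR_gt0 S.
apply: (@le_trans _ _ ((C w ^+ 2 * block_cost N.+1 ws)^-1 * prob w u)).
  by rewrite ler_pM2r.
apply: le_trans ge_p.
apply: (@le_trans _ _ ((C w ^+ 2 * block_cost N.+1 ws)^-1 *
    (C w / Lam s w * expR (birkhoff f phi s w Y)))).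
  by rewrite ler_pM2l// invr_gt0 mulr_gt0 ?exprn_gt0 ?block_cost_gt0.
rewrite mulrA; apply: (@le_trans _ _ ((C w)^-1 / (Lam s w * Lam N.+1 ws) *
    expR (birkhoff f phi s w Y) * expR (- S))).
  rewrite le_eqVlt; apply/predU1P; left; rewrite expRN /block_cost -/S.
  by field; rewrite !gt_eqF.
by rewrite [leRHS]mulrA ler_pM2l// !mulr_gt0 ?invr_gt0 ?mulr_gt0.
Qed.

Hypothesis countG : countable [set: G].

(** The tree of words contracts at every good time that is not covered by an
earlier block. The square root appears because [block_rate] bounds square norms. *)
Lemma Hopnorm_decay (C0 B : R) (H : seq G) (N : nat) w n :
  regular w -> C w <= C0 -> 1 <= C0 -> 1 <= B -> (0 < size H)%N ->
  (forall v : G -> R, (sqnorm v < +oo)%E ->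
    (sqnorm (average H v) <= ((8 * (C0 ^+ 4) ^+ 4)^-1)%:E * sqnorm v)%E) ->
  (Hopnorm f psi phi mu w n <= (C0 * Lam n w *
    Num.sqrt (block_rate (C0 ^+ 4) (C0 ^+ 2 * B)^-1 ^+
      ((\sum_(0 <= i < n) good_env H N B (base_iter f i w)) %/ N.+1).-1))%:E)%E.
Proof.
move=> rw CC0 C01 B1 H0 gap.
set good := fun i => good_env H N B (base_iter f i w).
set c := (_ %/ _).-1.
set D := C0 ^+ 4 in gap *; set eta := (C0 ^+ 2 * B)^-1; set rho := block_rate D eta.
have C00 : 0 < C0 by exact: lt_le_trans ltr01 C01.
have B0 : 0 < B by exact: lt_le_trans ltr01 B1.
have C2B : 1 <= C0 ^+ 2 * B by rewrite -[1]mulr1 ler_pM ?exprn_ege1.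
have eta01 : 0 < eta <= 1.
  by rewrite invr_gt0 invf_le1 ?(lt_le_trans ltr01 C2B)// C2B.
have D1 : 1 <= D by exact: exprn_ege1.
have rho12 : 2^-1 <= rho := block_rate_ge12 D1 eta01.
have rho0 : 0 < rho by apply: lt_le_trans rho12; rewrite invr_gt0.
have rho1 : rho <= 1.
  rewrite /rho /block_rate gerBl divr_ge0 ?sqr_ge0//.
  by rewrite mulr_ge0// sqr_ge0.
have past u u' a v : size u = size u' ->
    0 < prob w (rcons u a) -> 0 < prob w (rcons u' a) ->
    prob w (rcons u a ++ v) / prob w (rcons u a) <=
    D * (prob w (rcons u' a ++ v) / prob w (rcons u' a)).
  move=> su pu pu'; apply: (le_trans (gibbs_past lambda_gt0 C_gt0 rw v su pu pu')).
  apply: ler_wpM2r; first by rewrite divr_ge0 ?word_prob_ge0.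
  by rewrite lerXn2r ?nnegrE ?(ltW C00) ?(ltW (C_gt0 w)).
apply: (@le_trans _ _ (C w * Lam n w * Num.sqrt (rho ^+ c))%:E); last first.
  by rewrite lee_fin !ler_wpM2r ?sqrtr_ge0 ?(ltW (cocycle_gt0 _ _ _ _)).
apply: Hopnorm_le => //; first by rewrite sqrtr_gt0 exprn_gt0.
move=> b b0 bfin; rewrite sqr_sqrtr ?exprn_ge0 ?(ltW rho0)//.
have bE : sqnorm b = (fine (sqnorm b))%:E.
  by rewrite fineK// ge0_fin_numE ?sqnorm_ge0.
have p0 : 0 < prob w [::] by rewrite (word_prob_nil rw).
have rich u : good (size u) -> (size u + N.+1 <= n)%N -> 0 < prob w u ->
    rich_block (psi_letter psi) (sizes w) (prob w) H eta N.+1 u.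
  move=> /asboolP[spell cost] _ pu; apply: gibbs_rich_block => //.
  have pos1 := mulr_gt0 (exprn_gt0 2 (C_gt0 w))
    (block_cost_gt0 N.+1 (base_iter f (size u) w)).
  rewrite /eta lef_pV2 ?posrE ?(lt_le_trans ltr01 C2B)//.
  apply: ler_pM; [exact: sqr_ge0|exact: ltW (block_cost_gt0 _ _)| |exact: cost].
  by rewrite lerXn2r ?nnegrE ?(ltW C00) ?(ltW (C_gt0 w)).
have bB : (sqnorm b <= (fine (sqnorm b))%:E)%E by rewrite -bE.
have [c' c'_ge le_b] := tree_contraction (word_prob_ge0 f mu w) (word_prob_sum rw)
  b0 D1 past H0 gap eta01 (ltn0Sn N) p0 rich bB.
have s0 : 0 <= fine (sqnorm b) by rewrite fine_ge0 ?sqnorm_ge0.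
apply: (le_trans le_b); rewrite [X in (_ <= _ * X)%E]bE -EFinM lee_fin.
apply: ler_wpM2r => //; apply: ler_wiXn2l; rewrite ?(ltW rho0)//.
rewrite /c -subn1 leq_subLR add1n.
by have := leq_div2r N.+1 c'_ge; rewrite -mulnSr mulKn.
Qed.

End decay.

(** * Roots of exponentially growing sequences *)

Section growth_rate.
Context {R : realType}.
Implicit Types (h : nat -> \bar R) (q K : R).

Lemma root_le (X : \bar R) (n : nat) q : (0 <= X)%E -> (0 < n)%N ->
  (X <= (expR (n%:R * q))%:E)%E -> (X `^ n%:R^-1 <= (expR q)%:E)%E.
Proof.
move=> X0 n0 Xq; have nR : 0 < n%:R :> R by rewrite ltr0n.
have -> : expR q = expR (n%:R * q) `^ n%:R^-1.
  by rewrite /powR gt_eqF ?expR_gt0// expRK mulKf// gt_eqF.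
by rewrite -poweR_EFin; apply: gt0_ler_poweR;
  rewrite ?invr_ge0 ?in_itv/= ?X0 ?leey ?lee_fin ?expR_ge0 ?(ltW nR).
Qed.

Lemma root_ge (X : \bar R) (n : nat) q : (0 < n)%N ->
  ((expR (n%:R * q))%:E <= X)%E -> ((expR q)%:E <= X `^ n%:R^-1)%E.
Proof.
move=> n0 Xq; have nR : 0 < n%:R :> R by rewrite ltr0n.
have -> : expR q = expR (n%:R * q) `^ n%:R^-1.
  by rewrite /powR gt_eqF ?expR_gt0// expRK mulKf// gt_eqF.
have X0 : (0 <= X)%E by apply: le_trans Xq; rewrite lee_fin expR_ge0.
by rewrite -poweR_EFin; apply: gt0_ler_poweR;
  rewrite ?invr_ge0 ?in_itv/= ?X0 ?leey ?lee_fin ?expR_ge0 ?(ltW nR).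
Qed.

Lemma limn_esupE (u : nat -> \bar R) : limn_esup u = ereal_inf (range (esups u)).
Proof. by rewrite limn_esup_lim; apply/cvg_lim => //; exact: cvg_esups_inf. Qed.

(** A constant factor is absorbed by an arbitrarily small change of the rate. *)
Lemma expR_absorb K q (e : R) : 0 < K -> 0 < e ->
  \forall n \near \oo, K * expR (n%:R * q) <= expR (n%:R * (q + e)).
Proof.
move=> K0 e0; exists (Num.bound (`|ln K| / e)) => // n /= Kn.
have : `|ln K| <= n%:R * e.
  rewrite -ler_pdivrMr//; apply: ltW; apply: lt_le_trans (archi_boundP _) _.
    by rewrite divr_ge0// ltW.
  by rewrite ler_nat.
have := ler_norm (ln K) => lnK1 lnK2.
rewrite -{1}(lnK (_ : K \in Num.pos)) ?posrE// -expRD ler_expR mulrDr; lra.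
Qed.

Lemma limn_esup_root_le h q : (forall n, (0 <= h n)%E) ->
  (forall e : R, 0 < e -> exists2 K, 0 < K &
    \forall n \near \oo, (h n <= (K * expR (n%:R * (q + e)))%:E)%E) ->
  (limn_esup (fun n => h n `^ n%:R^-1) <= (expR q)%:E)%E.
Proof.
move=> h0 hq; rewrite limn_esupE.
have bound (e : R) : 0 < e ->
    (ereal_inf (range (esups (fun n => h n `^ n%:R^-1))) <= (expR (q + e))%:E)%E.
  move=> e0; have e20 : 0 < e / 2 by rewrite divr_gt0.
  have [K K0 [N1 _ hN1]] := hq _ e20.
  have [N2 _ hN2] := expR_absorb (q + e / 2) K0 e20.
  pose N := (maxn N1 N2).+1.
  apply: (@le_trans _ _ (esups (fun n => h n `^ n%:R^-1)%E N)).
    by apply: ereal_inf_lbound; exists N.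
  apply: ge_ereal_sup => _ [n /= Nn <-].
  have n1 : (N1 <= n)%N by apply: leq_trans Nn; rewrite leqW// leq_maxl.
  have n2 : (N2 <= n)%N by apply: leq_trans Nn; rewrite leqW// leq_maxr.
  apply: root_le => //; first exact: leq_ltn_trans Nn.
  apply: (le_trans (hN1 n n1)); rewrite lee_fin.
  have -> : q + e = q + e / 2 + e / 2 by field.
  exact: hN2.
apply/lee_addgt0Pr => t t0.
have q0 := expR_gt0 q.
pose e := ln (1 + t / expR q).
have e0 : 0 < e by rewrite ln_gt0// ltrDl divr_gt0.
apply: (le_trans (bound e e0)); rewrite -EFinD lee_fin expRD lnK ?posrE.
  by rewrite mulrDr mulr1 mulrCA divff ?mulr1 ?gt_eqF.
by rewrite addr_gt0// divr_gt0.
Qed.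

Lemma limn_esup_root_ge h q :
  (forall e : R, 0 < e -> exists2 K, 0 < K &
    forall N, exists2 n, (N <= n)%N & ((K * expR (n%:R * (q - e)))%:E <= h n)%E) ->
  ((expR q)%:E <= limn_esup (fun n => h n `^ n%:R^-1))%E.
Proof.
move=> hq; rewrite limn_esupE.
have bound (e : R) : 0 < e -> ((expR (q - e))%:E <=
    ereal_inf (range (esups (fun n => h n `^ n%:R^-1))))%E.
  move=> e0; have e20 : 0 < e / 2 by rewrite divr_gt0.
  have [K K0 hK] := hq _ e20.
  have Ki0 : 0 < K^-1 by rewrite invr_gt0.
  have [N2 _ hN2] := expR_absorb (q - e) Ki0 e20.
  apply: le_ereal_inf_tmp => _ [N _ <-].
  have [n Nn hn] := hK (maxn N N2).+1.
  have n1 : (N <= n)%N by apply: leq_trans Nn; rewrite leqW// leq_maxl.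
  have n2 : (N2 <= n)%N by apply: leq_trans Nn; rewrite leqW// leq_maxr.
  apply: (@le_trans _ _ (h n `^ n%:R^-1)%E); last first.
    by apply: ereal_sup_ubound; exists n.
  apply: root_ge; first exact: leq_ltn_trans Nn.
  apply: le_trans hn; rewrite lee_fin -ler_pdivrMl//.
  have -> : q - e / 2 = q - e + e / 2 by field.
  exact: hN2.
apply/lee_addgt0Pr => t t0.
have q0 := expR_gt0 q.
pose e := ln (1 + t / expR q).
have e0 : 0 < e by rewrite ln_gt0// ltrDl divr_gt0.
apply: (@le_trans _ _ ((expR (q - e))%:E + t%:E)%E); last by rewrite leeD2r// bound.
have x0 : 0 < 1 + t / expR q by rewrite addr_gt0// divr_gt0.
rewrite -EFinD lee_fin expRD expRN lnK ?posrE//.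
have -> : 1 + t / expR q = (expR q + t) / expR q by field; rewrite gt_eqF.
rewrite invf_div mulrA -lerBlDr -subr_ge0.
have -> : expR q * expR q / (expR q + t) - (expR q - t) = t ^+ 2 / (expR q + t).
  by field; rewrite gt_eqF// addr_gt0.
by apply: divr_ge0; [exact: sqr_ge0|rewrite addr_ge0// ltW].
Qed.

End growth_rate.

(** * Almost every environment *)

Section almost_every_environment.
Context {d : measure_display} {Om : measurableType d} {R : realType}.
Context {P : probability Om R} (f : random_shift P).
Context {G : groupType} (psi : (nat -> nat) -> G).
Variables (phi : Om -> (nat -> nat) -> R) (p : \bar R).
Variables (mu : R.-pker Om ~> trajectories) (lambda C : Om -> R).
Implicit Types (w : Om) (x y z : nat -> nat) (u t : seq nat).

Local Notation regular := (regular_env f phi mu lambda C).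
Local Notation Lam := (cocycle f lambda).

Let ae_and (A B : Om -> Prop) : {ae P, forall w, A w} -> {ae P, forall w, B w} ->
  {ae P, forall w, A w /\ B w}.
Proof. by move=> aeA aeB; apply: filterI. Qed.

Lemma base_iter_preserving n (A : set Om) : measurable A ->
  P (base_iter f n @^-1` A) = P A.
Proof.
move=> mA; elim: n => [|n IHn]; first by [].
rewrite (_ : _ @^-1` _ = base f @^-1` (base_iter f n @^-1` A)); last first.
  by rewrite -comp_preimage (_ : _ \o _ = base_iter f n.+1)//;
    apply/funext => w; rewrite /base_iter iterSr.
rewrite base_preserving// -[X in measurable X]setTI.
exact: (measurable_iter (measurable_base f) n measurableT mA).
Qed.

Lemma ae_base_iter (Q : Om -> Prop) : {ae P, forall w, Q w} ->
  {ae P, forall w, forall n, Q (base_iter f n w)}.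
Proof.
move=> [N [mN N0 QN]]; apply: ae_foralln => n.
exists (base_iter f n @^-1` N); split.
- rewrite -[X in measurable X]setTI.
  exact: (measurable_iter (measurable_base f) n measurableT mN).
- exact: etrans (base_iter_preserving n mN) N0.
- by move=> w /= nQ; apply: QN.
Qed.

Lemma words2E w a b : words f 2 w [:: a; b] <->
  [/\ alphabet f w a, alphabet f (base f w) b & trans f w a b].
Proof.
split=> [[_ al tr]|[wa wb ab]].
  by split; [exact: (al 0%N)|exact: (al 1%N)|exact: (tr 0%N)].
split=> // [[|[|i]]|[|i]]//.
Qed.

(** Successors are chosen one after the other. *)
Lemma letter_extends w :
  (forall n a, alphabet f (base_iter f n w) a ->
    exists b, words f 2 (base_iter f n w) [:: a; b]) ->
  forall a, alphabet f w a -> cylinder f w [:: a] !=set0.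
Proof.
move=> succ a wa.
pose s n a := xget 0%N [set b | words f 2 (base_iter f n w) [:: a; b]].
have sP n b : alphabet f (base_iter f n w) b ->
    words f 2 (base_iter f n w) [:: b; s n b].
  move=> /succ[c cP].
  apply: (@xgetPex _ 0%N [set c | words f 2 (base_iter f n w) [:: b; c]]).
  by exists c.
pose x := fix x n := if n is n'.+1 then s n' (x n') else a.
have xP n : alphabet f (base_iter f n w) (x n).
  elim: n => [//|n IHn] /=; have /words2E[_ + _] := sP n _ IHn.
  by rewrite -[base f (base_iter f n w)]/(base_iter f n.+1 w).
exists x; apply/cylinderE; split=> // n; split=> //.
by have /words2E[_ _] := sP n _ (xP n).
Qed.

Hypothesis lambda_gt0 : forall w, 0 < lambda w.
Hypothesis C_gt0 : forall w, 0 < C w.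

(** What the hypotheses say about a single environment. The finiteness of the
alphabets, which [regular_env] adds, is a consequence at all times. *)
Definition local_env w : Prop :=
  [/\ mu w (fiber f w) = 1%E,
      (sup_norm f w (fun x => (phi w x)%:E) < +oo)%E,
      (forall x k, fiber f w x -> (1 <= k)%N ->
        (C w)^-1 <= Lam k w * fine (mu w (cylinder f w (mkseq x k))) *
          expR (- birkhoff f phi k w x) <= C w) &
      (forall a, alphabet f w a -> exists b, words f 2 w [:: a; b])].

(** Each letter has Gibbs mass bounded from below, so there are finitely many. *)
Lemma bound_finite w : (forall n, local_env (base_iter f n w)) ->
  exists m, bound f w = Some m.
Proof.
move=> loc; have [w1 wfin gibbs _] := loc 0%N.
case wb: (bound f w) => [m|]; first by exists m.
exfalso.
have al a : alphabet f w a by rewrite /alphabet/= wb.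
have [x0 /cylinderE[wx0 _]] : cylinder f w [:: 0%N] !=set0.
  by apply: letter_extends => // n b; have [_ _ _] := loc n; apply.
pose K := fine (sup_norm f w (fun x => (phi w x)%:E)).
have phi_le x : fiber f w x -> `|phi w x| <= K.
  move=> wx; rewrite -lee_fin fineK; first by apply: ereal_sup_ubound; exists x.
  rewrite ge0_fin_numE//; apply: (@le_trans _ _ (`|phi w x0|)%:E).
    by rewrite lee_fin.
  by apply: ereal_sup_ubound; exists x0.
pose e := (C w)^-1 / (lambda w * expR K).
have e0 : 0 < e by rewrite divr_gt0 ?invr_gt0// mulr_gt0 ?expR_gt0.
have cyl_ge a : (e%:E <= mu w (cylinder f w [:: a]))%E.
  have [x /cylinderE[wx [xa]]] : cylinder f w [:: a] !=set0.
    by apply: letter_extends => // n b; have [_ _ _] := loc n; apply.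
  have /andP[ge_C _] := gibbs x 1%N wx isT.
  rewrite -word_probE lee_fin /e ler_pdivrMr ?mulr_gt0 ?expR_gt0//.
  apply: (le_trans ge_C); rewrite /cocycle /birkhoff !big_ord1 /= /mkseq/= xa.
  rewrite -[fine _]/(word_prob f mu w [:: a]) mulrAC [leLHS]mulrC.
  apply: ler_wpM2l; first exact: word_prob_ge0.
  rewrite ler_pM2l// ler_expR; have := phi_le x wx.
  by have := ler_norm (- phi w x); rewrite normrN; lra.
have mass n : ((n%:R * e)%:E <= mu w (\big[setU/set0]_(a < n)
    (cylinder f w [:: val a] : set trajectories)))%E.
  rewrite (@measure_bigsetU _ _ _ (mu w)
    (fun a => cylinder f w [:: a] : set trajectories)).
  2: by move=> a; exact: measurable_cylinder.
  2: by move=> i j _ _ [y []] /cylinderE[_ [<-]] /cylinderE[_ [<-]].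
  rewrite (_ : (n%:R * e)%:E = \sum_(a < n) e%:E)%E; last first.
    by rewrite sumEFin big_const_ord iter_addr_0 mulr_natl.
  by apply: lee_sum => a _; exact: cyl_ge.
have := mass (Num.bound (1 / e)); apply/negP; rewrite -ltNge.
apply: (@le_lt_trans _ _ 1%E).
  rewrite -(@prob_kernel _ _ _ _ _ mu w); apply: le_measure; rewrite ?inE//.
  by apply: bigsetU_measurable => a _; exact: measurable_cylinder.
by rewrite lte_fin -ltr_pdivrMr// archi_boundP// divr_ge0// ltW.
Qed.

Hypothesis bip : relative_BIP f.
Hypothesis phi_int :
  P.-integrable [set: Om] (fun w => sup_norm f w (fun x => (phi w x)%:E)).
Hypothesis gibbs : fiber_Gibbs f phi p mu lambda C.

Lemma ae_local_env : {ae P, forall w, forall n, local_env (base_iter f n w)}.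
Proof.
apply: ae_base_iter.
have [_ [Ib [_ aeI]]] := bip.
have ae_fin : {ae P, forall w, sup_norm f w (fun x => (phi w x)%:E) \is a fin_num}.
  have [N [mN N0 finN]] := integrable_ae measurableT phi_int.
  by exists N; split=> // w /= nw; apply: finN => /= /(_ I).
have aeall := ae_and (ae_and (gibbs_fiber gibbs) (gibbs_bounds gibbs))
  (ae_and aeI ae_fin).
apply: filterS aeall => w [[w1 wC] [wI wfin]]; split=> //.
- by rewrite ltey_eq wfin.
- by move=> a /wI[[b _ ab] _]; exists b.
Qed.

Lemma ae_regular_env : {ae P, forall w, regular w}.
Proof.
apply: filterS ae_local_env => w loc n /=.
have [? ? ? _] := loc n; split=> //.
by apply: bound_finite => m; rewrite -base_iterD.
Qed.

Lemma ae_letters : {ae P, forall w, forall n a,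
  letter_set f a (base_iter f n w) -> letters f a}.
Proof.
apply: (@ae_base_iter (fun w => forall a, letter_set f a w -> letters f a)).
apply: ae_foralln => a.
have [la|/contrapT nla] := pselect (letters f a); first exact: nearW.
by move: nla; apply: negligibleS => w /= nw; apply: contrapT => naw; apply: nw.
Qed.

Hypothesis mixing : ext_top_mixing f psi.

(** A uniform mixing time exists because only finitely many letters and group
elements are involved. *)
Lemma ae_spelling_env (H : seq G) (M : nat) : exists N : nat,
  {ae P, forall w, forall n,
    (alphabet_size f (base_iter f n w) <= M)%N ->
    (alphabet_size f (base_iter f (n + N) w) <= M)%N ->
    spelling_env f psi H N (base_iter f n w)}.
Proof.
have ex_N (q : nat * nat * nat) : exists N : nat,
    letters f q.1.1 -> letters f q.1.2 -> {ae P, forall w, forall n, (N <= n)%N ->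
       alphabet f w q.1.1 -> alphabet f (base_iter f n w) q.1.2 ->
       exists u, [/\ words f n w u,
         cylinder f w u `<=` cylinder f w [:: q.1.1],
         cylinder f (base_iter f n w) [:: q.1.2] `<=` iter n shift @` cylinder f w u &
         group_cocycle_word psi u = nth 1%g H q.2]}.
  have [la|nla] := pselect (letters f q.1.1); last by exists 0%N.
  have [lc|nlc] := pselect (letters f q.1.2); last by exists 0%N.
  by have [N NP] := mixing la lc (nth 1%g H q.2); exists N.
have [Nf NfP] := choice ex_N.
pose N := \max_(q : 'I_M * 'I_M * 'I_(size H)) Nf (val q.1.1, val q.1.2, val q.2).
exists N.
have ae_mix : {ae P, forall w, forall a c i, letters f a -> letters f c ->
    forall n, (Nf (a, c, i) <= n)%N ->
    alphabet f w a -> alphabet f (base_iter f n w) c ->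
    exists u, [/\ words f n w u,
      cylinder f w u `<=` cylinder f w [:: a],
      cylinder f (base_iter f n w) [:: c] `<=` iter n shift @` cylinder f w u &
      group_cocycle_word psi u = nth 1%g H i]}.
  apply: ae_foralln => a; apply: ae_foralln => c; apply: ae_foralln => i.
  have [la|nla] := pselect (letters f a); last by apply: nearW => w la.
  have [lc|nlc] := pselect (letters f c); last by apply: nearW => w _ lc.
  by apply: filterS (NfP (a, c, i) la lc) => w wP _ _ n; exact: wP.
have aeall := ae_and (ae_base_iter ae_mix) (ae_and ae_letters ae_regular_env).
apply: filterS aeall => w [mix [let_w rw]] n nM nNM a c h wa wc hH.
have al b x m : cylinder f (base_iter f m w) [:: b] x ->
    alphabet f (base_iter f m w) b.
  by move=> /cylinderE[wx [<-]]; have [] := wx 0%N.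
have la : letters f a by exact: (let_w n).
have lc : letters f c by apply: (let_w (n + N)%N); rewrite base_iterD.
have [xa wxa] := wa; have [xc wxc] := wc.
have aM : (a < M)%N.
  by apply: leq_trans nM; apply/(alphabet_regular rw); exact: al wxa.
have wxc' : cylinder f (base_iter f (n + N) w) [:: c] xc by rewrite base_iterD.
have cM : (c < M)%N.
  by apply: leq_trans nNM; apply/(alphabet_regular rw); exact: al wxc'.
have hE := nth_index 1%g hH; have iH : (index h H < size H)%N by rewrite index_mem.
have [||//|u uP] := mix n a c (index h H) la lc N.
- exact: (@leq_bigmax _ _ (Ordinal aM, Ordinal cM, Ordinal iH)).
- exact: al wxa.
- by rewrite -base_iterD; exact: al wxc'.
by exists u; rewrite -[X in _ = X]hE.
Qed.

End almost_every_environment.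

(** * Growth of the Gibbs cocycle *)

Section growth.
Context {d : measure_display} {Om : measurableType d} {R : realType}.
Context {P : probability Om R} (f : random_shift P).
Variables (phi : Om -> (nat -> nat) -> R) (p : \bar R).
Variables (mu : R.-pker Om ~> trajectories) (lambda C : Om -> R).
Hypothesis bip : relative_BIP f.
Hypothesis phi_int :
  P.-integrable [set: Om] (fun w => sup_norm f w (fun x => (phi w x)%:E)).
Hypothesis gibbs : fiber_Gibbs f phi p mu lambda C.
Hypothesis p_lty : (p < +oo)%E.

Local Notation regular := (regular_env f phi mu lambda C).
Local Notation Lam := (cocycle f lambda).
Let lambda_gt0 := gibbs_lambda_gt0 gibbs.
Let C_gt0 := gibbs_C_gt0 gibbs.

(** The Gibbs property for words of length [1], whose probability is at most [1]. *)
Lemma ln_lambda_ge w : regular w ->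
  - ln (lambda w) <= `|ln (C w)| + potential_bound f phi w.
Proof.
move=> rw; have [x wx _] : exists2 x, fiber f w x & mkseq x 0 = [::].
  by apply: (@word_prob_gt0_ex _ _ _ _ f mu w [::]); rewrite (word_prob_nil rw).
have := gibbs_ge lambda_gt0 C_gt0 1 rw wx.
rewrite /cocycle /birkhoff !big_ord1 /= => ge_p.
have : (C w)^-1 / lambda w * expR (phi w x) <= 1.
  apply: (le_trans ge_p); rewrite -lee_fin word_probE -(@prob_kernel _ _ _ _ _ mu w).
  by apply: le_measure; rewrite ?inE//; exact: measurable_cylinder.
rewrite -ler_ln ?posrE ?ltr01//; last first.
  by rewrite mulr_gt0 ?expR_gt0// divr_gt0 ?invr_gt0 ?C_gt0 ?lambda_gt0.
rewrite ln1 !lnM ?posrE ?expR_gt0 ?invr_gt0 ?divr_gt0 ?invr_gt0 ?C_gt0 ?lambda_gt0//.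
rewrite !lnV ?posrE ?C_gt0 ?lambda_gt0// expRK.
have := potential_le rw wx; have := ler_norm (- phi w x); rewrite normrN.
by have := ler_norm (ln (C w)); lra.
Qed.

Let m_ln_lambda : measurable_fun [set: Om] (fun w => (ln (lambda w))%:E).
Proof.
apply/measurable_EFinP; apply: measurableT_comp; first exact: measurable_ln.
exact: gibbs_measurable_lambda gibbs.
Qed.

(** The negative part is dominated by [ln_lambda_ge], so that a pressure below
[+oo] makes the positive part integrable as well. *)
Lemma integrable_ln_lambda :
  P.-integrable [set: Om] (EFin \o (fun w => ln (lambda w))).
Proof.
have /integrableP[m_sup sup_lty] := phi_int.
pose h w := (ln (lambda w))%:E.
have mC : measurable_fun [set: Om] (fun w => (`|ln (C w)|)%:E).
  apply/measurable_EFinP; apply: measurableT_comp => //.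
  apply: measurableT_comp; first exact: measurable_ln.
  exact: gibbs_measurable_C gibbs.
have dom : {ae P, forall w, [set: Om] w -> (h^\- w <= (`|ln (C w)|)%:E +
    `|sup_norm f w (fun x => (phi w x)%:E)|)%E}.
  apply: filterS (ae_regular_env lambda_gt0 C_gt0 bip phi_int gibbs) => w rw _.
  have [_ _ sup_fin _] := rw 0%N.
  rewrite funenegE ge_max; apply/andP; split; last by rewrite adde_ge0// lee_fin.
  apply: (@le_trans _ _ (`|ln (C w)| + potential_bound f phi w)%:E).
    by rewrite -EFinN lee_fin ln_lambda_ge.
  rewrite EFinD leeD2l// /potential_bound.
  case: (sup_norm f w _) => [r| |] /=; rewrite ?leey ?lee_fin//.
  exact: ler_norm.
have neg_lty : (\int[P]_w (h^\- w) < +oo)%E.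
  apply: (@le_lt_trans _ _ (\int[P]_w ((`|ln (C w)|)%:E +
      `|sup_norm f w (fun x => (phi w x)%:E)|))%E).
    apply: ae_ge0_le_integral => //.
    - exact: measurable_funeneg.
    - by move=> w _; rewrite adde_ge0// lee_fin.
    - by apply: emeasurable_funD => //; exact: measurableT_comp.
  rewrite ge0_integralD//; last exact: measurableT_comp.
  by apply: lte_add_pinfty => //; exact: gibbs_C_integrable gibbs.
have pos_lty : (\int[P]_w (h^\+ w) < +oo)%E.
  have := gibbs_lambda_pressure gibbs; rewrite integralE -/h => pE.
  rewrite ltNge leye_eq; apply/negP => /eqP posE; move: p_lty; rewrite -pE posE.
  by case: (\int[P]_w (h^\- w))%E neg_lty => //.
apply/integrableP; split; first exact: m_ln_lambda.
rewrite (_ : (fun w => `|_|)%E = h^\+ \+ h^\-)%E; last by rewrite -fune_abse.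
rewrite ge0_integralD//; first exact: lte_add_pinfty.
- exact: measurable_funepos.
- exact: measurable_funeneg.
Qed.

Lemma pressure_fin : p = (fine p)%:E.
Proof.
rewrite -(gibbs_lambda_pressure gibbs) fineK//.
exact: (integrable_fin_num _ integrable_ln_lambda).
Qed.

Lemma cocycle_expR n w : Lam n w = expR (orbit_sum (base f) (fun w => ln (lambda w)) n w).
Proof.
rewrite /orbit_sum expR_sum; apply: eq_bigr => i _.
by rewrite lnK// posrE lambda_gt0.
Qed.

Lemma ae_cocycle_growth : {ae P, forall w, forall e : R, 0 < e ->
  \forall n \near \oo, expR (n%:R * (fine p - e)) <= Lam n w <=
    expR (n%:R * (fine p + e))}.
Proof.
have birk h := @birkhoff_lower _ _ _ P (base f) (measurable_base f)
  (@base_preserving _ _ _ _ f) (@base_ergodic _ _ _ _ f) h.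
have low := birk _ integrable_ln_lambda.
have up : {ae P, forall w, forall e : R, 0 < e -> \forall n \near \oo,
    n%:R * (- fine p - e) <= orbit_sum (base f) (fun w => - ln (lambda w)) n w}.
  have intN : (\int[P]_w (- ln (lambda w))%:E = - p)%E.
    under eq_integral do rewrite EFinN -mulN1e.
    rewrite (integralZl measurableT integrable_ln_lambda) mulN1e.
    by rewrite (gibbs_lambda_pressure gibbs).
  have := birk (fun w => - ln (lambda w)); rewrite intN fineN; apply.
  rewrite (_ : _ \o _ = \- (EFin \o (fun w => ln (lambda w))))%E//.
  exact: integrableN integrable_ln_lambda.
rewrite (gibbs_lambda_pressure gibbs) in low.
apply: filterS2 low up => w low up e e0.
near=> n; rewrite cocycle_expR !ler_expR; apply/andP; split.
  by near: n; exact: low.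
have : n%:R * (- fine p - e) <= orbit_sum (base f) (fun w => - ln (lambda w)) n w.
  by near: n; exact: up.
by rewrite /orbit_sum sumrN !mulrBr mulrN mulrDr; lra.
Unshelve. all: by end_near.
Qed.

End growth.

(** * The spectral radius *)

Section spectral_radius.
Context {d : measure_display} {Om : measurableType d} {R : realType}.
Context {P : probability Om R} (f : random_shift P).
Context {G : groupType} (psi : (nat -> nat) -> G).
Variables (phi : Om -> (nat -> nat) -> R) (p : \bar R).
Variables (mu : R.-pker Om ~> trajectories) (lambda C : Om -> R).
Hypothesis countG : countable [set: G].
Hypothesis psi0 : forall x y : nat -> nat, x 0%N = y 0%N -> psi x = psi y.
Hypothesis bip : relative_BIP f.
Hypothesis mixing : ext_top_mixing f psi.
Hypothesis phi_int :
  P.-integrable [set: Om] (fun w => sup_norm f w (fun x => (phi w x)%:E)).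
Hypothesis gibbs : fiber_Gibbs f phi p mu lambda C.
Hypothesis p_lty : (p < +oo)%E.

Local Notation regular := (regular_env f phi mu lambda C).
Local Notation Lam := (cocycle f lambda).
Local Notation spr := (spr f psi phi mu).
Local Notation Hopnorm := (Hopnorm f psi phi mu).
Let lambda_gt0 := gibbs_lambda_gt0 gibbs.
Let C_gt0 := gibbs_C_gt0 gibbs.
Let ae_regular := ae_regular_env lambda_gt0 C_gt0 bip phi_int gibbs.
Let ae_growth := ae_cocycle_growth bip phi_int gibbs p_lty.

Let ae_and (A B : Om -> Prop) : {ae P, forall w, A w} -> {ae P, forall w, B w} ->
  {ae P, forall w, A w /\ B w}.
Proof. by move=> aeA aeB; apply: filterI. Qed.

Lemma Hopnorm_ge0 w n : (0 <= Hopnorm w n)%E.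
Proof.
pose o : (nat -> nat) -> G -> R := fun _ _ => 0.
have Ho : Hnorm mu w o = 0%E.
  have o0 g : ('N[mu w]_+oo[(fun x : trajectories => (o x g)%:E)])%E = 0%E.
    exact: Lnorm0.
  rewrite /Hnorm esum1 => [|g _]; last by rewrite o0 expe2 mul0e.
  by rewrite poweR0r// invr_neq0.
have Hspace_o : Hspace f mu w o.
  by split; [move=> g; exact: measurable_cst|rewrite Ho].
apply: (@le_trans _ _ (Hnorm mu (base_iter f n w) (ext_transfer_iter f psi phi w n o))).
  exact: poweR_ge0.
by apply: ereal_sup_ubound; exists o => //; split=> //; rewrite Ho.
Qed.

Lemma spr_ge0 w : (0 <= spr w)%E.
Proof.
rewrite /Defs.spr limn_esupE; apply: le_ereal_inf_tmp => _ [N _ <-].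
apply: (@le_trans _ _ (Hopnorm w N `^ N%:R^-1)%E); first exact: poweR_ge0.
by apply: ereal_sup_ubound; exists N => //=; exact: leqnn.
Qed.

Lemma Hopnorm_le_cocycle w n : regular w ->
  (Hopnorm w n <= (C w * Lam n w)%:E)%E.
Proof.
move=> rw; rewrite -[X in X%:E]mulr1; apply: Hopnorm_le => // b b0 bfin.
rewrite expr1n mul1e.
have bE : sqnorm b = (fine (sqnorm b))%:E.
  by rewrite fineK// ge0_fin_numE ?sqnorm_ge0.
rewrite [X in (_ <= X)%E]bE -[n in branch _ _ _ _ n]addn0.
apply: sqnorm_branch_le => //.
- exact: word_prob_ge0.
- exact: word_prob_sum rw.
- by rewrite (word_prob_nil rw).
- by move=> u _ pu; rewrite branch0// -bE.
Qed.

Lemma ae_spr_le : {ae P, forall w, (spr w <= (expR (fine p))%:E)%E}.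
Proof.
apply: filterS (ae_and ae_regular ae_growth) => w [rw growth].
apply: limn_esup_root_le => [n|e e0]; first exact: Hopnorm_ge0.
exists (C w) => //; apply: filterS (growth e e0) => n /andP[_ Lam_le].
by apply: (le_trans (Hopnorm_le_cocycle n rw)); rewrite lee_fin ler_pM2l.
Qed.

Let small_alphabet M : set Om := [set w | (alphabet_size f w <= M)%N].

Let measurable_small_alphabet M : measurable (small_alphabet M).
Proof.
rewrite (_ : small_alphabet M = bound f @^-1` [set None] `|`
    \bigcup_(m in [set m | (m <= M)%N]) bound f @^-1` [set Some m]).
  apply: measurableU; first exact: measurable_bound.
  by apply: bigcup_measurable => m _; exact: measurable_bound.
apply/seteqP; split=> w; rewrite /small_alphabet /alphabet_size /=.
  by case wE: (bound f w) => [m|] wM; [right; exists m|left].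
by move=> [->//|[m /= mM ->]].
Qed.

Let small_alphabets (e : R) : 0 < e -> exists M, (P (~` small_alphabet M) < e%:E)%E.
Proof.
move=> e0; apply: exhaustion => //.
- by move=> n m nm w wn; exact: leq_trans wn nm.
- by move=> w; exists (alphabet_size f w); exact: leqnn.
Qed.

(** The alphabet at time [n] is at most [M] for infinitely many [n], along which
the lower bound on the norm loses only a constant factor. *)
Lemma ae_spr_ge : almost_invariant R G ->
  {ae P, forall w, ((expR (fine p))%:E <= spr w)%E}.
Proof.
move=> ai; have [M PM] := small_alphabets ltr01.
have PM0 : (0 < P (small_alphabet M))%E.
  rewrite lt0e measure_ge0 andbT; apply/eqP => PM0.
  by move: PM; rewrite probability_setC// PM0 sube0 ltxx.
have recur := visits_recur (measurable_base f) (@base_preserving _ _ _ _ f)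
  (@base_ergodic _ _ _ _ f) (measurable_small_alphabet M) PM0.
apply: filterS (ae_and ae_regular (ae_and ae_growth recur)).
move=> w [rw [growth {}recur]]; apply: limn_esup_root_ge => e e0.
have size_gt0 n : (0 < alphabet_size f (base_iter f n w))%N.
  have [[m wm] _ _ _] := rw n; have := bound_gt1 f (base_iter f n w).
  by rewrite /alphabet_size wm /=; case: m {wm}.
have M0 : (0 < M)%N.
  by have [n _ wn] := recur 0%N; exact: leq_trans (size_gt0 n) wn.
exists ((C w)^-1 / (4 * M%:R)).
  by rewrite divr_gt0 ?invr_gt0 ?mulr_gt0 ?ltr0n.
move=> N; have [N0 _ {}growth] := growth e e0.
have [n Nn wn] := recur (maxn N N0); exists n.
  exact: leq_trans (leq_maxl _ _) Nn.
apply: le_trans (Hopnorm_ge psi0 lambda_gt0 C_gt0 n rw ai).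
have /andP[Lam_ge _] := growth n (leq_trans (leq_maxr _ _) Nn).
rewrite lee_fin mulrAC; apply: ler_pM.
- by rewrite mulr_ge0 ?invr_ge0 ?expR_ge0// ltW.
- by rewrite invr_ge0 mulr_ge0.
- by rewrite ler_pM2l ?invr_gt0.
rewrite lef_pV2 ?posrE ?mulr_gt0 ?ltr0n ?size_gt0// ler_pM2l// ler_nat.
exact: wn.
Qed.

Let measureU_le (A B : set Om) : measurable A -> measurable B ->
  (P (A `|` B) <= P A + P B)%E.
Proof.
move=> mA mB; rewrite (_ : A `|` B = A `|` (B `\` A)); last first.
  apply/seteqP; split=> w [Aw|]; [by left| |by left|by move=> [? _]; right].
  by move=> Bw; have [Aw|nAw] := pselect (A w); [left|right].
have mBA : measurable (B `\` A) by exact: measurableD.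
rewrite measureU//; last by rewrite setDE setIC -setIA setICl setI0.
by apply: leeD2l; apply: le_measure; rewrite ?inE//; exact: subDsetl.
Qed.

Let measurable_block_cost k : measurable_fun [set: Om] (block_cost f phi lambda k).
Proof.
have m_iter h i : measurable_fun [set: Om] h ->
    measurable_fun [set: Om] (fun w => h (base_iter f i w) : R).
  by move=> mh; exact: (measurableT_comp mh (measurable_iter (measurable_base f) i)).
rewrite /block_cost; apply: measurable_funM.
  apply: measurable_prod => i _; apply: m_iter.
  exact: gibbs_measurable_lambda gibbs.
apply: measurableT_comp; first exact: measurable_expR.
apply: measurable_sum => i; apply: m_iter.
exact: (measurableT_comp (fine_measurable measurableT) (measurable_int _ phi_int)).
Qed.

Let measurable_cheap k (a : R) : measurable [set w | block_cost f phi lambda k w <= a].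
Proof.
rewrite (_ : [set _ | _] = [set: Om] `&` block_cost f phi lambda k @^-1` `]-oo, a]).
  exact: measurable_block_cost.
by apply/seteqP; split=> w /=; rewrite in_itv/= => // -[].
Qed.

(** A good environment recurs with positive frequency, and each visit costs a
factor; the environments with a Gibbs constant at most [C0] lose a common rate. *)
Lemma ae_spr_lt (C0 : R) : ~ almost_invariant R G -> 1 <= C0 ->
  exists2 q, q < fine p & {ae P, forall w, C w <= C0 -> (spr w <= (expR q)%:E)%E}.
Proof.
move=> nai C01; have C00 : 0 < C0 by exact: lt_le_trans ltr01 C01.
have gap0 : 0 < (8 * (C0 ^+ 4) ^+ 4)^-1.
  by rewrite invr_gt0 mulr_gt0// !exprn_gt0.
have [H H0 gap] := strong_spectral_gap nai gap0.
have e40 : 0 < 4^-1 :> R by rewrite invr_gt0.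
have [M PM] := small_alphabets e40.
have [N ae_spell] := ae_spelling_env lambda_gt0 C_gt0 bip phi_int gibbs mixing H M.
have [B PB] : exists B : nat,
    (P (~` [set w | block_cost f phi lambda N.+1 w <= B.+1%:R]%R) < (4^-1)%:E)%E.
  apply: (@exhaustion _ _ _ P (fun n => [set w | block_cost f phi lambda N.+1 w <= n.+1%:R])) => //.
  - by move=> n m nm w /= /le_trans; apply; rewrite ler_nat ltnS.
  - move=> w; exists (Num.bound (block_cost f phi lambda N.+1 w)) => /=.
    apply: (le_trans (ltW (archi_boundP _))); last by rewrite ler_nat.
    by apply/ltW/block_cost_gt0; exact: lambda_gt0.
(* Each of the three conditions fails with probability less than [1 / 4]. *)
pose cheap : set Om := [set w | block_cost f phi lambda N.+1 w <= B.+1%:R].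
pose E := small_alphabet M `&` base_iter f N @^-1` small_alphabet M `&` cheap.
have miter A : measurable A -> measurable (base_iter f N @^-1` A).
  move=> mA; rewrite -[X in measurable X]setTI.
  exact: (measurable_iter (measurable_base f) N measurableT mA).
have mcheap : measurable cheap by exact: measurable_cheap.
have mE : measurable E.
  by apply: measurableI => //; apply: measurableI => //; exact: miter.
have PE : (0 < P E)%E.
  rewrite lt0e measure_ge0 andbT; apply/eqP => PE0.
  have : P (~` E) = 1%E by rewrite probability_setC// PE0 sube0.
  rewrite /E !setCI => PCE.
  set A := small_alphabet M in PM PCE; set A' := base_iter f N @^-1` A in PCE.
  have mA : measurable (~` A).
    exact: (measurableC (measurable_small_alphabet M)).
  have mA' : measurable (~` A').
    exact: (measurableC (miter _ (measurable_small_alphabet M))).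
  have PA' : P (~` A') = P (~` A) by rewrite -(base_iter_preserving f N mA).
  have : (1 <= P (~` A) + P (~` A') + P (~` cheap))%E.
    rewrite -PCE; apply: (le_trans (measureU_le (measurableU _ _ mA mA') _)).
      exact: measurableC.
    by rewrite leeD2r// measureU_le.
  apply/negP; rewrite -ltNge PA'.
  apply: (@lt_trans _ _ ((4^-1)%:E + (4^-1)%:E + (4^-1)%:E)%E).
    by rewrite !lteD.
  by rewrite -!EFinD lte_fin; lra.
set c := fine (P E).
have c0 : 0 < c.
  by rewrite fine_gt0// PE (le_lt_trans (probability_le1 _ _))// ltry.
have freq := visits_linear (measurable_base f) (@base_preserving _ _ _ _ f)
  (@base_ergodic _ _ _ _ f) mE PE.
pose rho := block_rate (C0 ^+ 4) (C0 ^+ 2 * B.+1%:R)^-1.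
pose L := - ln rho; pose K : R := N.+1%:R.
have K0 : 0 < K by rewrite ltr0n.
have B1 : 1 <= B.+1%:R :> R by rewrite ler1n.
have C2B : 1 <= C0 ^+ 2 * B.+1%:R.
  apply: (le_trans (_ : 1 <= C0 ^+ 2)); first exact: exprn_ege1.
  by rewrite ler_peMr ?ler1n// exprn_ge0// ltW.
have eta0 : 0 < (C0 ^+ 2 * B.+1%:R)^-1 by rewrite invr_gt0 (lt_le_trans ltr01 C2B).
have D1 : 1 <= C0 ^+ 4 by exact: exprn_ege1.
have rho0 : 0 < rho.
  apply: (@lt_le_trans _ _ 2^-1); first by rewrite invr_gt0.
  by apply: block_rate_ge12 => //; rewrite eta0 invf_le1 ?(lt_le_trans ltr01 C2B)// C2B.
have L0 : 0 < L.
  rewrite oppr_gt0 ln_lt0// rho0 /rho /block_rate gtrBl divr_gt0 ?exprn_gt0//.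
  by rewrite mulr_gt0 ?exprn_gt0.
pose delta := c * L / (4 * K).
exists (fine p - delta).
  by rewrite ltrBlDr ltrDl !divr_gt0 ?mulr_gt0.
apply: filterS (ae_and ae_regular (ae_and ae_growth (ae_and ae_spell freq))).
move=> w [rw [growth [spell {}freq]]] CC0.
apply: limn_esup_root_le => [n|e e0]; first exact: Hopnorm_ge0.
exists (C0 * expR L); first by rewrite mulr_gt0 ?expR_gt0.
apply: filterS2 (growth e e0) freq => n /andP[_ Lam_le] visits.
apply: (le_trans (Hopnorm_decay psi0 lambda_gt0 C_gt0 countG N n rw CC0 C01 B1 H0 gap)).
rewrite -/rho lee_fin.
set good := \sum_(0 <= i < n) _.
have good_ge : n%:R * (c / 2) <= good%:R :> R.
  apply: (le_trans visits); rewrite ler_nat; apply: leq_sum => i _.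
  case: asboolP => // -[[Mi MNi] costi]; rewrite lt0b; apply/asboolP; split=> //.
  by apply: spell => //; rewrite base_iterD.
set k := (good %/ N.+1).-1.
have -> : Num.sqrt (rho ^+ k) = expR (- (L * k%:R / 2)).
  rewrite -[in LHS](lnK rho0) -expRM_natl.
  rewrite (_ : k%:R * ln rho = 2%:R * - (L * k%:R / 2)); last by rewrite /L; field.
  by rewrite expRM_natl sqrtr_sqr ger0_norm ?expR_ge0.
have good_le : good%:R <= K * (k%:R + 2) :> R.
  rewrite /K -natrD -natrM ler_nat; apply: ltnW.
  apply: (leq_trans (ltn_ceil good (ltn0Sn N))); rewrite mulnC leq_mul2l /=.
  by rewrite /k; case: (good %/ N.+1)%N => [|m] //=; rewrite addn2.
have k_ge : n%:R * delta <= (k%:R + 2) * (L / 2).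
  rewrite (_ : _ * delta = (n%:R * (c / 2)) / K * (L / 2)); last first.
    by rewrite /delta; field; rewrite gt_eqF.
  rewrite ler_pM2r ?divr_gt0// ler_pdivrMr// [leRHS]mulrC.
  exact: le_trans good_ge good_le.
rewrite -!mulrA ler_pM2l// -expRD.
apply: (@le_trans _ _ (expR (n%:R * (fine p + e)) * expR (- (L * (k%:R / 2))))).
  by rewrite ler_pM2r ?expR_gt0.
rewrite -expRD ler_expR; move: k_ge; move: (k%:R : R) delta => x y.
by move: (n%:R : R) => m; rewrite !mulrDr !mulrDl mulrN; lra.
Qed.

End spectral_radius.

Theorem theorem1p9 (d : measure_display) (Om : measurableType d) (R : realType)
    (P : probability Om R) (f : random_shift P)
    (G : groupType) (psi : (nat -> nat) -> G)
    (phi : Om -> (nat -> nat) -> R) (p : \bar R)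
    (mu : R.-pker Om ~> trajectories) (lambda C : Om -> R) :
  countable [set: G] ->
  (forall x y : nat -> nat, x 0%N = y 0%N -> psi x = psi y) ->
  relative_BIP f ->
  ext_top_mixing f psi ->
  measurable_potential f phi ->
  locally_fiber_Holder f phi ->
  P.-integrable [set: Om] (fun w => sup_norm f w (fun x => (phi w x)%:E)) ->
  P.-integrable [set: Om]
    (fun w => lne (sup_norm f (base f w) (transfer_one f phi w))) ->
  is_gurevic_pressure f phi p ->
  (p < +oo)%E ->
  fiber_Gibbs f phi p mu lambda C ->
  {ae P, forall w, lne (spr f psi phi mu w) = p} <-> amenable R G.
Proof.
move=> countG psi0 bip mixing _ _ phi_int _ _ p_lty gibbs.
have pE := pressure_fin bip phi_int gibbs p_lty.
have ae_le := ae_spr_le countG psi0 bip phi_int gibbs p_lty.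
split=> [ae_lne|amG].
  apply: almost_invariant_amenable; apply: contrapT => nai.
  (* The gap below the pressure depends on the bound for [C w]. A single environment
  gives the contradiction, so all integer bounds can be tried. *)
  have ae_ne (n : nat) : {ae P, forall w, ~ C w <= n.+1%:R}.
    have n1 : 1 <= n.+1%:R :> R by rewrite ler1n.
    have [q q_lt ae_q] := ae_spr_lt countG psi0 bip mixing phi_int gibbs p_lty nai n1.
    apply: filterS2 ae_lne ae_q => w lne_p le_q /le_q.
    rewrite -[(expR q)%:E]/(expeR q%:E) -lee_lne ?expeRK ?lne_p; last 2 first.
      by rewrite in_itv/= spr_ge0 leey.
      by rewrite in_itv/= lee_fin expR_ge0 leey.
    by rewrite pE lee_fin leNgt q_lt.
  have [w wC] : exists w, forall n : nat, ~ C w <= n.+1%:R.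
    apply: contrapT => /forallNP none; have := ae_foralln ae_ne => -[N [mN N0 NC]].
    have : N = [set: Om] by apply/seteqP; split=> // w _; apply: NC => wC; exact: (none w wC).
    move=> NT; have /eqP := etrans (esym (probability_setT P)) (etrans (congr1 P (esym NT)) N0).
    by rewrite onee_eq0.
  apply: (wC (Num.bound (C w))); apply: (le_trans (ltW (archi_boundP _))).
    exact: ltW (gibbs_C_gt0 gibbs w).
  by rewrite ler_nat.
have ae_ge := ae_spr_ge psi0 bip phi_int gibbs p_lty
  (amenable_almost_invariant countG amG).
apply: filterS2 ae_le ae_ge => w le_p ge_p.
have -> : spr f psi phi mu w = (expR (fine p))%:E by apply/eqP; rewrite eq_le le_p.
by rewrite -[(expR _)%:E]/(expeR (fine p)%:E) expeRK -pE.
Qed.
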